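(* Let $f=f(x,u,p,q,r)$ be of class $C^1$ and, only at $r=0$, let also $f_p,f_q,f_r$ be of class $C^1$. Assume the parabolicity condition $f_q\cdot f_r<0$ at every argument $(x,u,p,q,r)$. Consider the equation $$f(x,u,u_x,u_{xx},u_t)=0,\qquad x\in(0,1),$$ with separated boundary conditions: at each boundary point $x=\iota\in\{0,1\}$ separately, either the Dirichlet condition $u=0$, or a nonlinear Robin condition $u_x=b^\iota(u)$ with a given function $b^\iota\in C^1$. Suppose that the semiflow $u(t)$ of classical solutions of this problem in the phase space $X$ is bounded and dissipative with precompact orbits, and that all equilibria are hyperbolic. Then the global attractor $\mathcal{A}\subset X$ of the semiflow consists of finitely many equilibria and of heteroclinic orbits $u(t)$, $t\in\mathbb{R}$, with pairs of distinct equilibria as $\alpha$- and $\omega$-limit sets.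
   Context: Indices denote partial derivatives, and the arguments are $(x,u,p,q,r)=(x,u,u_x,u_{xx},u_t)$, with $x\in[0,1]$ and $u,p,q,r$ real. Since $f_q\ne0$, the equation is solved for $q=u_{xx}$ as $u_{xx}=F(x,u,u_x,u_t)$ with $F_r=-f_r/f_q>0$. For each $(x,u,p)$, $F(x,u,p,\cdot)$ need only be defined on an open interval of $r$, with limits $\pm\infty$ of $F$ at its boundaries. It is assumed throughout that $F^0(x,u,p):=F(x,u,p,0)$ is well-defined for all $(x,u,p)$. Classical solution: a function $u=u(t,x)$ satisfying the equation for $t\in(0,T)$, $x\in(0,1)$, such that $u$, $u_t$, $u_{xx}$ are bounded and continuous for $t\in(0,T)$, $x\in(0,1)$. The initial condition $u(0,x)=u_0(x)$ is approached continuously in the sup-norm in $x$ as $t\searrow0$. The boundary values of $u(t,x)$ and $u_x(t,x)$ exist as continuous limits for $x\to\iota\in\{0,1\}$ and satisfy the boundary condition prescribed at $x=\iota$. Phase space: $X$ is a Banach space of functions on $[0,1]$, continuously embedded in $C^1([0,1])$, (or a corresponding phase space within it incorporating the boundary conditions), on which the classical solutions define a semiflow $u(t)=u(t,\cdot)$. Bounded and dissipative: any solution $u(t)$ remains bounded in $X$ for all times and eventually enters some a priori fixed large ball in $X$. Precompact orbits: global orbits are precompact in $X$, that is, the closure of $\{u(t)\mid t\in\mathbb{R}\}$ is compact in $X$. Under these assumptions the semiflow possesses a global attractor $\mathcal{A}\subset X$ (Ladyzhenskaya, Attractors for Semi-groups and Evolution Equations, Theorem 2.2), i.e. the maximal compact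 invariant set, which attracts all bounded sets; it consists of all bounded global orbits $u(t)$, $t\in\mathbb{R}$. Equilibrium: a time-independent solution. It is hyperbolic if the linearization of the problem at it (including linearized boundary conditions) has no spectrum on the imaginary axis. Heteroclinic orbit: a global orbit $u(t)$, $t\in\mathbb{R}$, whose $\alpha$-limit set and $\omega$-limit set each consist of a single equilibrium, these two equilibria being distinct. *)

(* Defs.v *)
From HB Require Import structures.
From mathcomp Require Import all_boot all_order all_algebra.
From mathcomp Require Import complex.
From mathcomp Require Import all_classical all_reals all_analysis.
Set Implicit Arguments.
Unset Strict Implicit.
Unset Printing Implicit Defensive.
Import Order.TTheory GRing.Theory Num.Theory.
Import numFieldNormedType.Exports.
Local Open Scope classical_set_scope.
Local Open Scope ring_scope.

Section Nonlinearity.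
Context {R : realType}.
Implicit Types g f : R -> R -> R -> R -> R -> R.

(* The arguments (x, u, p, q, r) range over [0, 1] * R^4; values of the total
   functions below for x outside [0, 1] are irrelevant. *)
Definition continuous_args g : Prop :=
  {within [set z : R * R * R * R * R | 0 <= z.1.1.1.1 <= 1],
     continuous (fun z => g z.1.1.1.1 z.1.1.1.2 z.1.1.2 z.1.2 z.2)}.

Definition partial_x g x u p q r : R := derive1 (fun s => g s u p q r) x.
Definition partial_u g x u p q r : R := derive1 (fun s => g x s p q r) u.
Definition partial_p g x u p q r : R := derive1 (fun s => g x u s q r) p.
Definition partial_q g x u p q r : R := derive1 (fun s => g x u p s r) q.
Definition partial_r g x u p q r : R := derive1 (fun s => g x u p q s) r.

(* Class C^1 up to the boundary x = 0, 1: the x-derivative is taken for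
   0 < x < 1 and is required to extend continuously to [0, 1] * R^4. *)
Definition class_C1 g : Prop :=
  [/\ continuous_args g,
      (exists2 gx, continuous_args gx & forall x u p q r, 0 < x < 1 ->
         derivable (fun s => g s u p q r) x 1 /\
         partial_x g x u p q r = gx x u p q r),
      (forall x u p q r, 0 <= x <= 1 ->
         [/\ derivable (fun s => g x s p q r) u 1,
             derivable (fun s => g x u s q r) p 1,
             derivable (fun s => g x u p s r) q 1
           & derivable (fun s => g x u p q s) r 1])
    & [/\ continuous_args (partial_u g), continuous_args (partial_p g),
          continuous_args (partial_q g) & continuous_args (partial_r g)]].

(* Class C^1 of the restriction of g to {r = 0}, a function of (x, u, p, q). *)
Definition class_C1_at_r0 g : Prop := class_C1 (fun x u p q _ => g x u p q 0).

Definition parabolic f : Prop :=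
  forall x u p q r, 0 <= x <= 1 ->
    partial_q f x u p q r * partial_r f x u p q r < 0.

(* Under parabolicity the solution q is unique, hence q = F^0(x, u, p). *)
Definition F0_well_defined f : Prop :=
  forall x u p, 0 <= x <= 1 -> exists q, f x u p q 0 = 0.

End Nonlinearity.

Section BoundaryConditions.
Context {R : realType}.

Inductive boundary_condition := Dirichlet | Robin of R -> R.

Definition class_C1_bc (bc : boundary_condition) : Prop :=
  if bc is Robin b then (forall s, derivable b s 1) /\ continuous (derive1 b)
  else True.

Definition bc_holds (bc : boundary_condition) (u ux : R) : Prop :=
  match bc with
  | Dirichlet => u = 0
  | Robin b => ux = b u
  end.

(* Linearization of the boundary condition at the boundary value c. *)
Definition linearized_bc (bc : boundary_condition) (c : R) :=
  match bc with
  | Dirichlet => Dirichlet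
  | Robin b => Robin (fun s => derive1 b c * s)
  end.

(* w is of class C^1 on [0, 1] with derivative w1, one-sided at 0 and 1. *)
Definition C1_on01 (w w1 : R -> R) : Prop :=
  [/\ {within `[0, 1], continuous w}, {within `[0, 1], continuous w1}
    & forall x, 0 < x < 1 -> derivable w x 1 /\ derive1 w x = w1 x].

Definition satisfies_bc (bc0 bc1 : boundary_condition) (w w1 : R -> R) : Prop :=
  bc_holds bc0 (w 0) (w1 0) /\ bc_holds bc1 (w 1) (w1 1).

(* At x = 0 (resp. x = 1), where x --> i within ]0, 1[ is the filter F: the
   boundary values of u and u_x exist, are continuous in t, and satisfy bc. *)
Definition boundary_values (T : R) (u : R -> R -> R) (F : set_system R)
    (bc : boundary_condition) : Prop :=
  exists v v1 : R -> R,
    [/\ {in `]0, T[, continuous v}, {in `]0, T[, continuous v1}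
      & forall t, 0 < t < T ->
          [/\ u t x @[x --> F] --> v t, derive1 (u t) x @[x --> F] --> v1 t
            & bc_holds bc (v t) (v1 t)]].

Definition bounded_continuous (T : R) (g : R -> R -> R) : Prop :=
  let Q := [set z : R * R | 0 < z.1 < T /\ 0 < z.2 < 1] in
  {within Q, continuous (fun z => g z.1 z.2)} /\
  exists M, forall z, Q z -> `|g z.1 z.2| <= M.

(* u t x is the solution at time t and position x. *)
Definition classical_solution (f : R -> R -> R -> R -> R -> R)
    (bc0 bc1 : boundary_condition) (T : R) (u0 : R -> R) (u : R -> R -> R)
    : Prop :=
  [/\ (forall t x, 0 < t < T -> 0 < x < 1 ->
         [/\ derivable (u ^~ x) t 1, derivable (u t) x 1,
             derivable (derive1 (u t)) x 1
           & f x (u t x) (derive1 (u t) x)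
               (derive1 (derive1 (u t)) x) (derive1 (u ^~ x) t) = 0]),
      [/\ bounded_continuous T u,
          bounded_continuous T (fun t x => derive1 (u ^~ x) t)
        & bounded_continuous T (fun t x => derive1 (derive1 (u t)) x)],
      (forall e, 0 < e -> \forall t \near 0^'+,
         forall x, 0 < x < 1 -> `|u t x - u0 x| < e)
    & boundary_values T u 0^'+ bc0 /\ boundary_values T u 1^'- bc1].

End BoundaryConditions.
Arguments boundary_condition : clear implicits.

Section Spectrum.
Context {R : realType}.
Variables (f : R -> R -> R -> R -> R -> R) (bc0 bc1 : boundary_condition R).

(* The linearization f_r w_t + f_q w_xx + f_p w_x + f_u w = 0 of the equation
   at a time-independent v, written as w_t = L w. *)
Definition linearization (v w : R -> R) (x : R) : R :=
  let at_v (g : R -> R -> R -> R -> R -> R) :=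
    g x (v x) (derive1 v x) (derive1 (derive1 v) x) 0 in
  - (at_v (partial_q f) * derive1 (derive1 w) x + at_v (partial_p f) * derive1 w x
     + at_v (partial_u f) * w x) / at_v (partial_r f).

(* Domain of L: C^2([0, 1]) with the boundary conditions linearized at v. *)
Definition linearization_dom (v w : R -> R) : Prop :=
  exists w1 w2, [/\ C1_on01 w w1, C1_on01 w1 w2
    & satisfies_bc (linearized_bc bc0 (v 0)) (linearized_bc bc1 (v 1)) w w1].

Definition re (w : R -> R[i]) : R -> R := fun x => complex.Re (w x).
Definition im (w : R -> R[i]) : R -> R := fun x => complex.Im (w x).

Definition complex_linearization (v : R -> R) (w : R -> R[i]) (x : R) : R[i] :=
  Complex (linearization v (re w) x) (linearization v (im w) x).

Definition complex_linearization_dom (v : R -> R) (w : R -> R[i]) : Prop :=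
  linearization_dom v (re w) /\ linearization_dom v (im w).

Definition continuous_complex (g : R -> R[i]) : Prop :=
  {within `[0, 1], continuous (re g)} /\ {within `[0, 1], continuous (im g)}.

(* L - lam, as an operator in C([0, 1]; C) equipped with the sup-norm, is onto
   and has a bounded inverse; K = 0 in the estimate is injectivity. *)
Definition resolvent_set (v : R -> R) : set R[i] := [set lam |
  (forall g, continuous_complex g ->
     exists2 w, complex_linearization_dom v w &
       forall x, 0 < x < 1 -> complex_linearization v w x - lam * w x = g x) /\
  (exists M : R, forall w (K : R), complex_linearization_dom v w ->
     (forall x, 0 < x < 1 ->
        Normc.normc (complex_linearization v w x - lam * w x) <= K) ->
     forall x, 0 <= x <= 1 -> Normc.normc (w x) <= M * K)].

Definition spectrum (v : R -> R) : set R[i] := ~` resolvent_set v.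

Definition hyperbolic (v : R -> R) : Prop :=
  forall lam, spectrum v lam -> complex.Re lam != 0.

End Spectrum.

Section PhaseSpace.
Context {R : realType} {X : completeNormedModType R}.

(* The elements of the Banach space X are functions on [0, 1] through ev, and
   X embeds continuously into C^1([0, 1]). *)
Definition embedded_in_C1 (ev : X -> R -> R) : Prop :=
  [/\ (forall (a : R) (phi psi : X) (x : R), 0 <= x <= 1 ->
         ev (a *: phi + psi) x = a * ev phi x + ev psi x),
      (forall phi psi : X, (forall x, 0 <= x <= 1 -> ev phi x = ev psi x) ->
         phi = psi),
      (forall phi, exists w1, C1_on01 (ev phi) w1)
    & exists C : R, forall phi,
        (forall x, 0 <= x <= 1 -> `|ev phi x| <= C * `|phi|) /\
        (forall x, 0 < x < 1 -> `|derive1 (ev phi) x| <= C * `|phi|)].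

(* Either all of X, or a subset of X incorporating the boundary conditions
   (which need not be a linear subspace, as they may be nonlinear). *)
Definition phase_space (ev : X -> R -> R) (bc0 bc1 : boundary_condition R)
    (P : set X) : Prop :=
  P = setT \/
  P `<=` [set phi | exists2 w1, C1_on01 (ev phi) w1 &
                      satisfies_bc bc0 bc1 (ev phi) w1].

Definition semiflow (P : set X) (S : R -> X -> X) : Prop :=
  [/\ (forall t phi, 0 <= t -> P phi -> P (S t phi)),
      (forall phi, P phi -> S 0 phi = phi),
      (forall s t phi, 0 <= s -> 0 <= t -> P phi ->
         S (s + t) phi = S s (S t phi))
    & {within [set z : R * X | 0 <= z.1 /\ P z.2],
         continuous (fun z => S z.1 z.2)}].

(* S is defined by the classical solutions: the classical solution with initial
   condition phi in P exists for all times, is unique, and is S t phi. *)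
Definition classical_semiflow (f : R -> R -> R -> R -> R -> R)
    (bc0 bc1 : boundary_condition R) (ev : X -> R -> R)
    (P : set X) (S : R -> X -> X) : Prop :=
  semiflow P S /\
  forall (phi : X) (T : R) (u : R -> R -> R), P phi -> 0 < T ->
    (classical_solution f bc0 bc1 T (ev phi) u <->
     forall t x, 0 < t < T -> 0 < x < 1 -> u t x = ev (S t phi) x).

Definition equilibrium (f : R -> R -> R -> R -> R -> R)
    (bc0 bc1 : boundary_condition R) (ev : X -> R -> R) (P : set X)
    : set X :=
  [set phi | P phi /\ forall T : R, 0 < T ->
     classical_solution f bc0 bc1 T (ev phi) (fun _ => ev phi)].

Definition bounded_dissipative (P : set X) (S : R -> X -> X) : Prop :=
  (forall phi, P phi -> exists M : R, forall t, 0 <= t -> `|S t phi| <= M) /\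
  (exists rho : R, forall phi, P phi ->
     exists t0 : R, forall t, 0 <= t -> t0 <= t -> `|S t phi| <= rho).

Definition global_orbit (P : set X) (S : R -> X -> X) (gam : R -> X) : Prop :=
  (forall t, P (gam t)) /\
  forall s t, 0 <= s -> gam (s + t) = S s (gam t).

Definition bounded_orbit (gam : R -> X) : Prop := bounded_set (range gam).

Definition precompact_orbits (P : set X) (S : R -> X -> X) : Prop :=
  forall gam, global_orbit P S gam -> bounded_orbit gam ->
    compact (closure (range gam)).

Definition compact_invariant (P : set X) (S : R -> X -> X) (K : set X) : Prop :=
  [/\ K `<=` P, compact K & forall t, 0 <= t -> S t @` K = K].

(* The maximal compact invariant set, attracting all bounded sets. *)
Definition global_attractor (P : set X) (S : R -> X -> X) (A : set X) : Prop :=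
  [/\ compact_invariant P S A,
      (forall K, compact_invariant P S K -> K `<=` A)
    & forall B, B `<=` P -> bounded_set B -> forall e : R, 0 < e ->
        exists t0 : R, forall t phi, 0 <= t -> t0 <= t -> B phi ->
          exists2 a, A a & `|S t phi - a| < e].

Definition alpha_limit (gam : R -> X) : set X := cluster (gam @ -oo%R).
Definition omega_limit (gam : R -> X) : set X := cluster (gam @ +oo%R).

Definition heteroclinic (E P : set X) (S : R -> X -> X) (gam : R -> X) : Prop :=
  global_orbit P S gam /\
  exists e1 e2, [/\ E e1, E e2, e1 <> e2,
    alpha_limit gam = [set e1] & omega_limit gam = [set e2]].

End PhaseSpace.

(* Main.v *)
(** Solving the equation for q yields u_xx = F(x,u,u_x,u_t), and since F
    increases in u_t the sign of u_t is that of u_xx - F0(x,u,u_x), where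
    F0 = F(.,.,.,0).  A Lagrangian L(x,u,p) whose extremals solve u'' = F0 turns
    this into a Lyapunov function: with K = L_p and g = K_p > 0, the integral of
    L(x,u,u_x), plus boundary potentials, has time derivative
    - \int g (u_xx - F0) u_t dx < 0.  Such an L exists as soon as g satisfies the
    transport equation g_x + p g_u + (g F0)_p = 0.

    As F0 is only known to be C^1, with F0_p of class C^1, g is not obtained by
    solving characteristic equations: on a grid of [0,1] the logarithm of g is
    advected by backward Euler steps, which gives Lagrangians solving the
    Euler-Lagrange identity up to an arbitrarily small error, with bounds that do
    not depend on it.  The energies thus decrease up to a small error, and their
    limit along an ultrafilter is a strict Lyapunov function.  Convexity of L in p
    makes it possible to estimate energy increments without u_xt.

    LaSalle's principle places limit points among equilibria.  Hyperbolic
    equilibria are isolated, because the linearization there has a bounded inverse: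
    the difference of two close equilibria, corrected by a small cubic so as to
    satisfy the linearized boundary conditions, is mapped by it to something of
    smaller order.  So there are finitely many equilibria, and the connected limit
    sets are singletons, distinct by strict decay. *)
Require Import Defs.
From HB Require Import structures.
From mathcomp Require Import all_boot all_order all_algebra.
From mathcomp Require Import complex.
From mathcomp Require Import all_classical all_reals all_analysis.
From mathcomp Require Import ring lra.
Import Order.TTheory GRing.Theory Num.Theory.
Import numFieldNormedType.Exports.
Local Open Scope classical_set_scope.
Local Open Scope ring_scope.

(** * Derivatives, continuity, primitives *)

Section Derivatives.
Context {R : realType}.
Implicit Types (f g : R -> R) (x l : R).

(** Two things stand in the way of the usual computation of the time derivative of the energy: u_xt
    need not exist, and u_xx, u_t are merely bounded near x = 0 and x = 1. Against the first, the
    increment of the energy from time t to s is bounded above by convexity with K taken at the old u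
    and the new slope; integration by parts then differentiates K(x, u(t), u_x(s)), which brings in
    only u_x(t) and u_xx(s), and an upper bound of a Dini derivative is all that monotonicity asks
    for. Against the second, a weight of small integral that is at least 1/2 near both ends absorbs
    the boundary layers. On the side of the Lagrangians, g = exp h turns the transport equation into
    h_x + p h_u + F0 h_p + F0_p = 0, whose discrete solutions have gradients bounded uniformly in
    the mesh once F0 is cut off outside a C^1-ball containing the attractor. The Lagrangians
    themselves are not passed to a limit, only their energies, normalised at u = 0. Strictness
    survives that limit because the decay is bounded from below by the integral of a fixed tent
    function lying under (u_xx - F0) u_t. *)

Lemma is_derive_cvg f x l :
  is_derive x 1 f l <-> h^-1 * (f (h + x) - f x) @[h --> 0^'] --> l.
Proof.
have E : (fun h : R => h^-1 *: ((f \o shift x) (h *: (1 : R)) - f x)) =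
         (fun h => h^-1 * (f (h + x) - f x)).
  by apply/funext => h; rewrite /= /GRing.scale /= mulr1.
split.
- move=> [d e]; rewrite -e /derive; move: d; rewrite /derivable !E => d.
  exact: d.
- move=> h; apply: DeriveDef; first by rewrite /derivable E; apply: cvgP h.
  by rewrite /derive E; apply/cvg_lim.
Qed.

Definition der f x l : Prop := is_derive x 1 f l.

(** Expansion without a quotient: it also makes sense at [y = x], so no punctured neighbourhood
    appears and estimates can be fed in and read off directly. *)
Lemma derP f x l :
  der f x l <-> forall e, 0 < e ->
    \forall y \near x, `|f y - f x - l * (y - x)| <= e * `|y - x|.
Proof.
have K (h : R) : h != 0 -> `|l - h^-1 * (f (h + x) - f x)| * `|h| =
    `|f (h + x) - f x - l * h|.
  by move=> h0; rewrite -normrM distrC; congr (`| _ |); field.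
rewrite /der is_derive_cvg; split.
- move=> /cvgrPdist_le h e e0.
  have := h e e0; rewrite near_withinE => H.
  rewrite (near_shift 0 x); near=> h0 => /=.
  rewrite subr0 addrK; have [->|hn0] := eqVneq h0 0.
    by rewrite add0r subrr mulr0 subr0 normr0 mulr0.
  rewrite -K // ler_wpM2r //; move: hn0; near: h0; exact: H.
- move=> h; apply/cvgrPdist_le => e e0; rewrite near_withinE.
  have := h e e0; rewrite (near_shift 0 x) => H; near=> h0 => hn0.
  have : (`|f (h0 + (x - 0)) - f x - l * (h0 + (x - 0) - x)|
     <= e * `|h0 + (x - 0) - x|) by near: h0; exact: H.
  by rewrite subr0 addrK -K // ler_pM2r ?normr_gt0.
Unshelve. all: by end_near.
Qed.

Lemma der_ext f g x l : (\forall y \near x, f y = g y) ->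
  der f x l -> der g x l.
Proof.
move=> fg; rewrite !derP => h e e0.
have fgx : f x = g x by apply: nbhs_singleton fg.
near=> y; rewrite -fgx -(_ : f y = g y); last by near: y.
by near: y; exact: h.
Unshelve. all: by end_near.
Qed.

Lemma der_unique f x l l' :
  der f x l -> der f x l' -> l = l'.
Proof. by move=> [_ <-] [_ <-]. Qed.

Lemma der_derive1 f x l : der f x l -> derive1 f x = l.
Proof. by move=> [_ <-]; rewrite derive1E. Qed.

Lemma derivable_der f x : derivable f x 1 -> der f x (derive1 f x).
Proof. by move=> h; apply: DeriveDef => //; rewrite derive1E. Qed.

Lemma der_add f g x l m : der f x l -> der g x m ->
  der (fun y => f y + g y) x (l + m).
Proof. by move=> ? ?; exact: is_deriveD. Qed.

Lemma der_sub f g x l m : der f x l -> der g x m ->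
  der (fun y => f y - g y) x (l - m).
Proof. by move=> ? ?; exact: is_deriveB. Qed.

Lemma der_opp f x l : der f x l ->
  der (fun y => - f y) x (- l).
Proof. by move=> ?; exact: is_deriveN. Qed.

Lemma der_mul f g x l m : der f x l -> der g x m ->
  der (fun y => f y * g y) x (l * g x + f x * m).
Proof.
move=> hf hg; rewrite addrC [l * _]mulrC.
have := is_deriveM hf hg; exact.
Qed.

Lemma der_const (c x : R) : der (fun=> c) x (0 : R).
Proof. exact: is_derive_cst. Qed.

Lemma der_var x : der (fun y => y) x (1 : R).
Proof. exact: is_derive_id. Qed.

Lemma der_comp f g x l m : der f (g x) l -> der g x m ->
  der (fun y => f (g y)) x (l * m).
Proof. by move=> ? ?; exact: is_derive1_comp. Qed.

Lemma der_to f x l l' : der f x l -> l = l' -> der f x l'.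
Proof. by move=> h <-. Qed.

Lemma der_continuous f x l : der f x l -> {for x, continuous f}.
Proof.
move=> [h _]; apply: differentiable_continuous; exact/derivable1_diffP.
Qed.

Lemma derivative_continuous f df : (forall x, der f x (df x)) ->
  continuous f.
Proof. by move=> h x; apply: der_continuous (h x). Qed.

Lemma MVT_nonincreasing f df a b : a <= b -> (forall x, a < x < b -> der f x (df x)) ->
  {within `[a, b], continuous f} -> (forall x, a < x < b -> df x <= 0) ->
  f b <= f a.
Proof.
rewrite le_eqVlt => /predU1P[->//|ab] d c df0.
have d' x : x \in `]a, b[%R -> der f x (df x).
  by rewrite in_itv /=; exact: d.
have [z zI e] := @MVT R f df a b ab d' c.
rewrite -subr_le0 e mulr_le0_ge0 ?subr_ge0 ?(ltW ab)//.
by apply: df0; move: zI; rewrite in_itv.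
Qed.

Lemma MVT_line f df a b : (forall x, der f x (df x)) ->
  exists2 z, f b - f a = df z * (b - a) & Num.min a b <= z <= Num.max a b.
Proof.
move=> d; have fc := derivative_continuous _ _ d.
have W a' b' : {within `[a', b'], continuous f} by exact: continuous_subspaceT.
have [ab|ba] := leP a b.
  have [z zI e] := @MVT_segment R f df a b ab (fun x _ => d x) (W _ _).
  exists z => //; by move: zI; rewrite in_itv.
have [z zI e] := @MVT_segment R f df b a (ltW ba) (fun x _ => d x) (W _ _).
exists z; last by move: zI; rewrite in_itv.
by rewrite -[LHS]opprB e -mulrN opprB.
Qed.

Lemma MVT_bound f df a b C : (forall x, der f x (df x)) ->
  (forall x, Num.min a b <= x <= Num.max a b -> `|df x| <= C) ->
  `|f b - f a| <= C * `|b - a|.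
Proof.
move=> d h; have [z -> zI] := MVT_line f df a b d.
by rewrite normrM ler_wpM2r ?h.
Qed.

(* A lower right Dini derivative bound integrates: only one later point [t']
   is needed for each [t]. *)
Lemma dini_le (v : R -> R) (a b l : R) : a <= b -> continuous v ->
  (forall t e, a <= t < b -> 0 < e ->
     exists2 t', t < t' <= b & v t' - v t <= (l + e) * (t' - t)) ->
  v b - v a <= l * (b - a).
Proof.
move=> ab vc h.
suff H e : 0 < e -> v b - v a <= (l + e) * (b - a).
  apply/ler_addgt0Pr => e e0.
  (* The [+ 1] covers the case [a = b]. *)
  have d0 : 0 < e / (b - a + 1) by rewrite divr_gt0 // ltr_wpDl ?subr_ge0.
  apply: (le_trans (H _ d0)); rewrite mulrDl lerD2l mulrAC ler_pdivrMr.
    by rewrite ler_pM2l// lerDl.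
  by rewrite ltr_wpDl ?subr_ge0.
move=> e0.
pose q t := v t - v a - (l + e) * (t - a).
(* [A] need not be an interval: its supremum belongs to it by continuity of [q], and were the
   supremum below [b], the hypothesis would give a later point of [A]. *)
pose A := [set t | a <= t <= b /\ q t <= 0].
have Aa : A a by rewrite /A /q /= lexx ab !subrr mulr0 subrr.
have hA : has_sup A.
  by split; [exists a | exists b => t [/andP[]]].
pose s := sup A.
have as' : a <= s by apply: ub_le_sup => //; case: hA.
have sb : s <= b by apply: ge_sup => // [|t [/andP[]]//]; exists a.
have qc : continuous q.
  move=> t; apply: cvgB; first by apply: cvgB; [exact: vc | exact: cvg_cst].
  by apply: cvgM; [exact: cvg_cst | apply: cvgB; [exact: cvg_id|exact: cvg_cst]].
have qs : q s <= 0.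
  rewrite leNgt; apply/negP => qs0.
  have /cvgrPdist_lt/(_ _ qs0) := qc s.
  rewrite near_nbhs => /nbhs_ballP[d /= d0 dq].
  have [t [tab qt] /= st] := sup_adherent d0 hA.
  have ts : t <= s by apply: ub_le_sup => //; case: hA.
  have := dq t; rewrite /ball /= ger0_norm ?subr_ge0// => /(_ _).
  have -> : s - t < d by rewrite ltrBlDr -ltrBlDl.
  move=> /(_ isT); rewrite ltr_norml => /andP[_].
  by rewrite ltrBlDr ltrDl ltNge qt.
have [sb'|] := ltP s b; last first.
  move=> bs; have -> : b = s by apply/eqP; rewrite eq_le bs sb.
  by rewrite -subr_le0.
have [|t' /andP[st' t'b] ht'] := h s e _ e0; first by rewrite as' sb'.
have : A t'.
  split; first by rewrite (le_trans as' (ltW st')) t'b.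
  have -> : q t' = q s + (v t' - v s - (l + e) * (t' - s)) by rewrite /q; ring.
  by rewrite -[leRHS]addr0 lerD// subr_le0.
move=> At'; have : t' <= s by apply: ub_le_sup => //; case: hA.
by rewrite leNgt st'.
Qed.

Lemma primitive_from (f : R -> R) (a : R) : continuous f ->
  exists Phi : R -> R, forall x, a < x -> der Phi x (f x).
Proof.
move=> fc.
exists (fun x => \int[lebesgue_measure]_(t in `[a, x]) f t)%R => x ax.
have x1 : x < x + 1 by rewrite ltrDl.
have [] := continuous_FTC1_closed x1 _ ax (fc x).
- apply: continuous_compact_integrable; first exact: segment_compact.
  exact: continuous_subspaceT.
- by move=> d e; apply: DeriveDef => //; rewrite -derive1E.
Qed.

(** The primitives of [primitive_from] are good only to the right of a base point. Normalised by
    their value at 0, those based to the left of both 0 and x agree at x, so the base point may move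
    off to the left with x. *)
Lemma primitive_exists (f : R -> R) : continuous f ->
  exists Phi : R -> R, Phi 0 = 0 /\ forall x, der Phi x (f x).
Proof.
move=> fc.
have /choice[G GP] := fun a => primitive_from f a fc.
have E a b x : a < 0 -> b < 0 -> a < x -> b < x -> G a x - G a 0 = G b x - G b 0.
  move=> a0 b0 ax bx; pose D y := G a y - G b y.
  have DD y : a < y -> b < y -> der D y 0.
    by move=> ay byy; rewrite -(subrr (f y)); apply: der_sub; exact: GP.
  suff : D x = D 0 by rewrite /D => e; lra.
  have W u v : a < u -> b < u -> u <= v -> D v = D u.
    move=> au bu uv.
    have C : {within `[u, v], continuous D}.
      apply: continuous_in_subspaceT => y; rewrite inE /= in_itv /= => /andP[uy _].
      exact: der_continuous (DD y (lt_le_trans au uy) (lt_le_trans bu uy)).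
    have DD' y : y \in `]u, v[%R -> der D y 0.
      rewrite in_itv /= => /andP[uy _].
      exact: DD (lt_trans au uy) (lt_trans bu uy).
    have [z _ e] := @MVT_segment R D (fun=> 0) u v uv DD' C.
    by apply/eqP; rewrite -subr_eq0 e mul0r.
  have [x0|x0] := leP 0 x; first by rewrite (W 0 x).
  by rewrite (W x 0)// ltW.
pose b (x : R) := - `|x| - 1.
exists (fun x => G (b x) x - G (b x) 0); split; first by rewrite subrr.
move=> x; have b0 y : b y < 0 by rewrite /b; have := normr_ge0 y; lra.
have bl y : b y < y by rewrite /b; have := ler_norm (- y); rewrite normrN; lra.
(* A single base point serves all points near [x]. *)
pose c := b x - 1.
have c0 : c < 0 by rewrite /c; have := b0 x; lra.
have cx : c < x by rewrite /c; have := bl x; lra.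
apply: (@der_ext (fun y => G c y - G c 0)).
  have : \forall y \near x, c < y by exact: lt_nbhsr.
  apply: filterS => y cy; exact: E.
rewrite -(subr0 (f x)); apply: der_sub; [exact: GP | exact: der_const].
Qed.
End Derivatives.

Section Continuity.
Context {R : realType}.

Definition cont2 (G : R -> R -> R) : Prop :=
  continuous (fun z : R * R => G z.1 z.2).
Definition cont3 (G : R -> R -> R -> R) : Prop :=
  continuous (fun z : R * R * R => G z.1.1 z.1.2 z.2).

Section rules.
Context {T : topologicalType}.
Implicit Types a b c : T -> R.

Lemma contD a b : continuous a -> continuous b -> continuous (fun z => a z + b z).
Proof. by move=> ha hb z; exact: cvgD (ha z) (hb z). Qed.

Lemma contB a b : continuous a -> continuous b -> continuous (fun z => a z - b z).
Proof. by move=> ha hb z; exact: cvgB (ha z) (hb z). Qed.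

Lemma contN a : continuous a -> continuous (fun z => - a z).
Proof. by move=> ha z; exact: cvgN (ha z). Qed.

Lemma contM a b : continuous a -> continuous b -> continuous (fun z => a z * b z).
Proof. by move=> ha hb z; exact: cvgM (ha z) (hb z). Qed.

Lemma cont_cst {U : topologicalType} (c : U) : continuous (fun _ : T => c).
Proof. by move=> z; exact: cvg_cst. Qed.

Lemma cont_max a b : continuous a -> continuous b ->
  continuous (fun z => Num.max (a z) (b z)).
Proof. by move=> ha hb z; exact: continuous_max (ha z) (hb z). Qed.

Lemma cont_min a b : continuous a -> continuous b ->
  continuous (fun z => Num.min (a z) (b z)).
Proof. by move=> ha hb z; exact: continuous_min (ha z) (hb z). Qed.

Lemma contV a : continuous a -> (forall z, a z != 0) ->
  continuous (fun z => (a z)^-1).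
Proof. by move=> h0 h1 z; apply: cvgV; [exact: h1|exact: h0]. Qed.

Lemma cont_comp (f : R -> R) a : continuous f -> continuous a ->
  continuous (fun z => f (a z)).
Proof. by move=> hf ha z; apply: (cvg_comp a f (ha z) (hf _)). Qed.

Lemma cont_pair {U V : topologicalType} (a : T -> U) (b : T -> V) :
  continuous a -> continuous b -> continuous (fun z => (a z, b z)).
Proof. by move=> ha hb z; exact: cvg_pair (ha z) (hb z). Qed.

Lemma cont_comp' {U V : topologicalType} (f : U -> V) (a : T -> U) :
  continuous f -> continuous a -> continuous (fun z => f (a z)).
Proof. by move=> hf ha z; apply: (cvg_comp a f (ha z) (hf _)). Qed.

Lemma cont2_comp G a b : cont2 G -> continuous a -> continuous b ->
  continuous (fun z => G (a z) (b z)).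
Proof.
move=> hG ha hb; have := cont_comp' _ _ hG (cont_pair _ _ ha hb); exact.
Qed.

Lemma cont3_comp G a b c : cont3 G -> continuous a -> continuous b ->
  continuous c -> continuous (fun z => G (a z) (b z) (c z)).
Proof.
move=> hG ha hb hc.
have := cont_comp' _ _ hG (cont_pair _ _ (cont_pair _ _ ha hb) hc); exact.
Qed.

End rules.

Lemma cont_id {T : topologicalType} : continuous (fun z : T => z).
Proof. by move=> z; exact: cvg_id. Qed.

Lemma cont_fst {T U V : topologicalType} (a : T -> U * V) :
  continuous a -> continuous (fun z => (a z).1).
Proof. by move=> ha z; apply: (cvg_comp a fst (ha z)); exact: cvg_fst. Qed.

Lemma cont_snd {T U V : topologicalType} (a : T -> U * V) :
  continuous a -> continuous (fun z => (a z).2).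
Proof. by move=> ha z; apply: (cvg_comp a snd (ha z)); exact: cvg_snd. Qed.

(** Compactness of [K] makes the closeness uniform. Continuity is asked only at the points of the
    slice over [t0], which suits functions known to be continuous only inside a domain. *)
Lemma near_uniform {T U : topologicalType} (phi : T -> U -> R) (K : set U) t0 :
  compact K ->
  (forall s, K s -> {for (t0, s), continuous (fun z : T * U => phi z.1 z.2)}) ->
  forall e, 0 < e -> \forall t \near t0, forall s, K s -> `|phi t s - phi t0 s| < e.
Proof.
move=> /compact_near_coveringP cK hc e e0.
have := cK T (nbhs t0) (fun t s => `|phi t s - phi t0 s| < e) _; apply.
move=> s Ks; have e20 : 0 < e / 2 by rewrite divr_gt0.
have /cvgrPdist_lt/(_ _ e20) := hc s Ks.
move=> [[A B] /= [At0 Bs] AB].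
exists (B, A) => //= -[s' t] /= [Bs' At].
have h1 := AB (t, s') (conj At Bs').
have h2 := AB (t0, s') (conj (nbhs_singleton At0) Bs').
move: h1 h2 => /= h1 h2.
have -> : phi t s' - phi t0 s' = (phi t0 s - phi t0 s') - (phi t0 s - phi t s').
  by ring.
by rewrite (le_lt_trans (ler_normB _ _))// (splitr e) ltrD.
Qed.

Lemma compact_bounded_fun {T : topologicalType} (f : T -> R) (K : set T) :
  compact K -> {within K, continuous f} ->
  exists C : R, forall z, K z -> `|f z| <= C.
Proof.
move=> cK hf.
have := continuous_compact hf cK => /compact_bounded[M [_ hM]].
exists (M + 1) => z Kz; apply: (hM (M + 1)); first by rewrite ltrDl.
by exists z.
Qed.

Lemma compact_bounded_funs {T : topologicalType} (f : T -> R) (K : set T) :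
  compact K -> continuous f ->
  exists2 C : R, 0 <= C & forall z, K z -> `|f z| <= C.
Proof.
move=> cK hf; have [|C hC] := compact_bounded_fun f K cK.
  exact: continuous_subspaceT.
exists `|C| => // z Kz; exact: le_trans (hC z Kz) (ler_norm _).
Qed.

End Continuity.

Ltac cont_tac :=
  repeat (cbv beta; match goal with
  | H : continuous ?f |- continuous ?f => exact: H
  | |- continuous (fun _ => ?c) => exact: cont_cst
  | |- continuous (fun z => z) => exact: cont_id
  | |- continuous (fun z => (_ + - _)) => apply: contB
  | |- continuous (fun z => (_ + _)) => apply: contD
  | |- continuous (fun z => (- _)) => apply: contN
  | |- continuous (fun z => (_ * _)) => apply: contM
  | |- continuous (fun z => Num.max _ _) => apply: cont_max
  | |- continuous (fun z => Num.min _ _) => apply: cont_min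
  | |- continuous (fun z => (_, _)) => apply: cont_pair
  | |- continuous fst => refine (cont_fst (fun z => z) cont_id)
  | |- continuous snd => refine (cont_snd (fun z => z) cont_id)
  | |- continuous expR => exact: continuous_expR
  | |- continuous (fun z => (@?a z).1) => apply: (cont_fst a)
  | |- continuous (fun z => (@?a z).2) => apply: (cont_snd a)
  | H : cont3 ?G |- continuous (fun z => ?G (@?a z) (@?b z) (@?c z)) =>
     apply: (cont3_comp G a b c H)
  | H : cont2 ?G |- continuous (fun z => ?G (@?a z) (@?b z)) =>
     apply: (cont2_comp G a b H)
  | H : cont2 ?G |- continuous (?G ?a) =>
     refine (cont2_comp G (fun _ => a) (fun z => z) H (cont_cst a) cont_id)
  | H : cont3 ?G |- continuous (?G ?a ?b) =>
     refine (cont3_comp G (fun _ => a) (fun _ => b) (fun z => z) H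
       (cont_cst a) (cont_cst b) cont_id)
  | H : forall k, cont3 (?G k) |- continuous (fun z => ?G ?k (@?a z) (@?b z) (@?c z)) =>
     apply: (cont3_comp (G k) a b c (H k))
  | H : forall k, cont2 (?G k) |- continuous (fun z => ?G ?k (@?a z) (@?b z)) =>
     apply: (cont2_comp (G k) a b (H k))
  | |- continuous (fun z => expR (@?a z)) => apply: (cont_comp expR a (@continuous_expR _))
  | |- continuous (fun z => sin (@?a z)) => apply: (cont_comp sin a (@continuous_sin _))
  | |- continuous (fun z => cos (@?a z)) => apply: (cont_comp cos a (@continuous_cos _))
  | H : continuous ?f |- continuous (fun z => ?f (@?a z)) => apply: (cont_comp f a H)
  end).

(** * Uniform estimates on compact boxes *)

Section UnitBox.
Context {R : realType}.

Lemma itv01_open_closed (x : R) : 0 < x < 1 -> 0 <= x <= 1.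
Proof. by move=> /andP[x0 x1]; rewrite !ltW. Qed.

Lemma near_in01 (x : R) : 0 < x < 1 -> \forall y \near x, 0 < y < 1.
Proof.
case/andP=> x0 x1; have i0 : \forall y \near x, 0 < y by exact: lt_nbhsr.
have i1 : \forall y \near x, y < 1 by exact: lt_nbhsl.
by apply: filterS2 i0 i1 => y -> ->.
Qed.

Definition box (M : R) : set (R * R * R) :=
  (`[0, 1]%classic `*` `[- M, M]%classic) `*` `[- M, M]%classic.

Lemma boxP (M x u p : R) : 0 <= x <= 1 -> `|u| <= M -> `|p| <= M -> box M (x, u, p).
Proof. by rewrite /box /= !in_itv /= !ler_norml => -> -> ->. Qed.

Lemma compact_box (M : R) : compact (box M).
Proof. by apply: compact_setX; [apply: compact_setX|]; exact: segment_compact. Qed.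

Lemma box_bounded (G : R -> R -> R -> R) (M : R) : cont3 G ->
  exists2 D, 0 <= D & forall x u p, 0 <= x <= 1 -> `|u| <= M -> `|p| <= M ->
    `|G x u p| <= D.
Proof.
move=> cG; have [D D0 hD] := compact_bounded_funs _ _ (compact_box M) cG.
by exists D => // x u p x01 uM pM; exact: hD (boxP _ _ _ _ x01 uM pM).
Qed.

Lemma box_near {T : topologicalType} (phi : T -> R -> R -> R -> R) (M w : R) t0 :
  continuous (fun z : T * (R * R * R) => phi z.1 z.2.1.1 z.2.1.2 z.2.2) -> 0 < w ->
  \forall t \near t0, forall x u p, 0 <= x <= 1 -> `|u| <= M -> `|p| <= M ->
    `|phi t x u p - phi t0 x u p| <= w.
Proof.
move=> cphi w0.
have := near_uniform (fun t z => phi t z.1.1 z.1.2 z.2) _ t0 (compact_box M)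
  (fun s _ => cphi (t0, s)) w w0.
by apply: filterS => t h x u p x01 uM pM; exact: ltW (h _ (boxP _ _ _ _ x01 uM pM)).
Qed.

Lemma box_modulus (G : R -> R -> R -> R) (M w : R) : cont3 G -> 0 < w ->
  exists2 r, 0 < r & forall x s u p, 0 <= x <= 1 -> `|s| < r -> `|u| <= M ->
    `|p| <= M -> `|G (x + s) u p - G x u p| <= w.
Proof.
move=> cG w0; have := box_near (fun s x u p => G (x + s) u p) M w 0 _ w0.
have c : continuous (fun z : R * (R * R * R) => G (z.2.1.1 + z.1) z.2.1.2 z.2.2) by cont_tac.
move=> /(_ c)/nbhs_ballP[r /= r0 hr]; exists r => // x s u p x01 sr uM pM.
by rewrite -{2}[x]addr0; apply: hr; rewrite // /ball /= sub0r normrN.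
Qed.

Lemma box_uniform (G : R -> R -> R -> R) (M w : R) : cont3 G -> 0 < w ->
  exists2 r, 0 < r & forall x u p a b, 0 <= x <= 1 -> `|u| <= M -> `|p| <= M ->
    `|a| < r -> `|b| < r -> `|G x (u + a) (p + b) - G x u p| <= w.
Proof.
move=> cG w0; have := box_near (fun s x u p => G x (u + s.1) (p + s.2)) M w (0, 0) _ w0.
have c : continuous (fun z : (R * R) * (R * R * R) =>
  G z.2.1.1 (z.2.1.2 + z.1.1) (z.2.2 + z.1.2)) by cont_tac.
move=> /(_ c)[[A B] /= [/nbhs_ballP[r1 /= r10 h1] /nbhs_ballP[r2 /= r20 h2]] AB].
exists (Num.min r1 r2); first by rewrite lt_min r10 r20.
move=> x u p a b x01 uM pM; rewrite !lt_min => /andP[ar1 _] /andP[_ br2].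
have Aa : A a by apply: h1; rewrite /ball /= sub0r normrN.
have Bb : B b by apply: h2; rewrite /ball /= sub0r normrN.
by have := AB (a, b) (conj Aa Bb) x u p x01 uM pM; rewrite /= !addr0.
Qed.

End UnitBox.

(** * Chain rules, implicit functions, integrals with a parameter *)

Section Calculus.
Context {R : realType}.
Implicit Types (f g : R -> R) (x y l : R).

(** The difference quotient, completed by the derivative at [x], is continuous there. Chain rules
    become limits of products, with no case distinction on vanishing increments. *)
Lemma caratheodory f x l : der f x l <->
  exists2 m : R -> R, forall y, f y - f x = m y * (y - x) & m y @[y --> x] --> l.
Proof.
split; last first.
  move=> [m hm /cvgrPdist_le hc]; apply/derP => e e0.
  have := hc e e0; apply: filterS => y hy.
  by rewrite hm -mulrBl normrM distrC ler_wpM2r.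
move=> /derP h; exists (fun y => if y == x then l else (f y - f x) / (y - x)).
  move=> y; case: eqVneq => [->|yx]; first by rewrite !subrr mulr0.
  by rewrite divfK // subr_eq0.
apply/cvgrPdist_le => e e0; have := h e e0; apply: filterS => y.
case: eqVneq => [_ _|yx hy]; first by rewrite subrr normr0 ltW.
have n0 : 0 < `|y - x| by rewrite normr_gt0 subr_eq0.
rewrite -(ler_pM2r n0) -normrM mulrBl divfK ?subr_eq0// distrC.
exact: hy.
Qed.

(** For intermediate points of the mean value theorem: they converge although nothing is known of
    how they are selected. *)
Lemma between_cvg (a z : R -> R) y a0 : a t @[t --> y] --> a0 ->
  (forall t, Num.min a0 (a t) <= z t <= Num.max a0 (a t)) ->
  z t @[t --> y] --> a0.
Proof.
move=> ha hz; have c : (fun=> a0) t @[t --> y] --> a0 by exact: cvg_cst.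
apply: (@squeeze_cvgr _ _ _ _ (fun t => a0 - `|a t - a0|) (fun t => a0 + `|a t - a0|)).
- apply: filterE => t; have /andP[h1 h2] := hz t.
  have : `|a t - a0| >= a t - a0 by exact: ler_norm.
  have : `|a t - a0| >= a0 - a t by rewrite distrC; exact: ler_norm.
  by move: h1 h2; case: (leP a0 (a t)) => _ h1 h2 h3 h4; apply/andP; split; lra.
- have : (fun t => a0 - `|a t - a0|) t @[t --> y] --> a0 - `|a0 - a0|.
    by apply: cvgB => //; apply: cvg_norm; exact: cvgB.
  by rewrite subrr normr0 subr0.
- have : (fun t => a0 + `|a t - a0|) t @[t --> y] --> a0 + `|a0 - a0|.
    by apply: cvgD => //; apply: cvg_norm; exact: cvgB.
  by rewrite subrr normr0 addr0.
Qed.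

Lemma cvg3_comp (G : R -> R -> R -> R) (a b c : R -> R) y a0 b0 c0 : cont3 G ->
  a t @[t --> y] --> a0 -> b t @[t --> y] --> b0 -> c t @[t --> y] --> c0 ->
  G (a t) (b t) (c t) @[t --> y] --> G a0 b0 c0.
Proof.
move=> hG ha hb hc.
have h0 : (a t, b t) @[t --> y] --> (a0, b0) by exact: (cvg_pair ha hb).
have h : (a t, b t, c t) @[t --> y] --> (a0, b0, c0) by exact: (cvg_pair h0 hc).
have := cvg_comp _ _ h (hG (a0, b0, c0)); exact.
Qed.

(** The increment is split into three, one argument changing at a time; the mean value theorem gives
    each part a slope, and joint continuity of the partial derivatives gives the slope its limit. *)
Lemma der_chain3 (G Ga Gb Gc : R -> R -> R -> R) (a b c : R -> R) y a' b' c' :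
  cont3 Ga -> cont3 Gb -> cont3 Gc ->
  (forall u v w, der (fun s => G s v w) u (Ga u v w)) ->
  (forall u v w, der (fun s => G u s w) v (Gb u v w)) ->
  (forall u v w, der (fun s => G u v s) w (Gc u v w)) ->
  der a y a' -> der b y b' -> der c y c' ->
  der (fun t => G (a t) (b t) (c t)) y
    (Ga (a y) (b y) (c y) * a' + Gb (a y) (b y) (c y) * b'
     + Gc (a y) (b y) (c y) * c').
Proof.
move=> cA cB cC dA dB dC ha hb hc.
have ca := der_continuous _ _ _ ha.
have cb := der_continuous _ _ _ hb.
have cc := der_continuous _ _ _ hc.
move: ha hb hc => /caratheodory[ma Ea la] /caratheodory[mb Eb lb] /caratheodory[mc Ec lc].
have /choice[za Za] : forall t, exists z, G (a t) (b t) (c t) - G (a y) (b t) (c t) =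
    Ga z (b t) (c t) * (a t - a y) /\ Num.min (a y) (a t) <= z <= Num.max (a y) (a t).
  by move=> t; have [z] := MVT_line _ _ (a y) (a t) (fun u => dA u (b t) (c t)); exists z.
have /choice[zb Zb] : forall t, exists z, G (a y) (b t) (c t) - G (a y) (b y) (c t) =
    Gb (a y) z (c t) * (b t - b y) /\ Num.min (b y) (b t) <= z <= Num.max (b y) (b t).
  by move=> t; have [z] := MVT_line _ _ (b y) (b t) (fun u => dB (a y) u (c t)); exists z.
have /choice[zc Zc] : forall t, exists z, G (a y) (b y) (c t) - G (a y) (b y) (c y) =
    Gc (a y) (b y) z * (c t - c y) /\ Num.min (c y) (c t) <= z <= Num.max (c y) (c t).
  by move=> t; have [z] := MVT_line _ _ (c y) (c t) (fun u => dC (a y) (b y) u); exists z.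
apply/caratheodory; exists (fun t => Ga (za t) (b t) (c t) * ma t
    + Gb (a y) (zb t) (c t) * mb t + Gc (a y) (b y) (zc t) * mc t).
  move=> t; have [e1 _] := Za t; have [e2 _] := Zb t; have [e3 _] := Zc t.
  move: e1 e2 e3; rewrite Ea Eb Ec => e1 e2 e3.
  rewrite !mulrDl -!mulrA -e1 -e2 -e3; ring.
have cst (k : R) : (fun=> k) t @[t --> y] --> k by exact: cvg_cst.
have va := between_cvg _ _ _ _ ca (fun t => (Za t).2).
have vb := between_cvg _ _ _ _ cb (fun t => (Zb t).2).
have vc := between_cvg _ _ _ _ cc (fun t => (Zc t).2).
apply: cvgD; first apply: cvgD.
- by apply: cvgM => //; exact: cvg3_comp.
- by apply: cvgM => //; apply: cvg3_comp.
- by apply: cvgM => //; apply: cvg3_comp.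
Qed.

Lemma der_chain2 (G Ga Gb : R -> R -> R) (a b : R -> R) y a' b' :
  cont2 Ga -> cont2 Gb ->
  (forall u v, der (fun s => G s v) u (Ga u v)) ->
  (forall u v, der (fun s => G u s) v (Gb u v)) ->
  der a y a' -> der b y b' ->
  der (fun t => G (a t) (b t)) y (Ga (a y) (b y) * a' + Gb (a y) (b y) * b').
Proof.
move=> cA cB dA dB ha hb.
have c0 : cont3 (fun _ _ _ : R => (0 : R)) by rewrite /cont3; cont_tac.
have cA3 : cont3 (fun u v _ : R => Ga u v) by rewrite /cont3; cont_tac.
have cB3 : cont3 (fun u v _ : R => Gb u v) by rewrite /cont3; cont_tac.
have := der_chain3 (fun u v _ => G u v) _ _ (fun _ _ _ => 0) a b (fun=> 0) y a' b' 0
  cA3 cB3 c0 (fun u v _ => dA u v) (fun u v _ => dB u v) (fun u v w => der_const _ _)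
  ha hb (der_const _ _).
by rewrite mul0r addr0.
Qed.

(** Expanding G(t, phi t) - G(x, phi x) = 0 by the mean value theorem in each variable leaves a
    linear equation for the increment of [phi], whose coefficients converge as soon as [phi] is
    continuous at [x]. *)
Lemma der_implicit (G Ga Gb : R -> R -> R) (phi : R -> R) x :
  cont2 Ga -> cont2 Gb ->
  (forall u v, der (fun s => G s v) u (Ga u v)) ->
  (forall u v, der (fun s => G u s) v (Gb u v)) ->
  {for x, continuous phi} -> (forall u, G u (phi u) = 0) -> Gb x (phi x) != 0 ->
  der phi x (- Ga x (phi x) / Gb x (phi x)).
Proof.
move=> cA cB dA dB hphi G0 nz.
have cA3 : cont3 (fun u v _ : R => Ga u v) by rewrite /cont3; cont_tac.
have cB3 : cont3 (fun u v _ : R => Gb u v) by rewrite /cont3; cont_tac.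
have /choice[za Za] : forall t, exists z, G t (phi t) - G x (phi t) =
    Ga z (phi t) * (t - x) /\ Num.min x t <= z <= Num.max x t.
  by move=> t; have [z] := MVT_line _ _ x t (fun u => dA u (phi t)); exists z.
have /choice[zb Zb] : forall t, exists z, G x (phi t) - G x (phi x) =
    Gb x z * (phi t - phi x) /\ Num.min (phi x) (phi t) <= z <= Num.max (phi x) (phi t).
  by move=> t; have [z] := MVT_line _ _ (phi x) (phi t) (fun u => dB x u); exists z.
have cst (k : R) : (fun=> k) t @[t --> x] --> k by exact: cvg_cst.
have idc : (fun t : R => t) t @[t --> x] --> x by exact: cvg_id.
have va := between_cvg (fun t => t) za x x idc (fun t => (Za t).2).
have vb := between_cvg _ _ _ _ hphi (fun t => (Zb t).2).
have lB : Gb x (zb t) @[t --> x] --> Gb x (phi x).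
  exact: (cvg3_comp _ _ _ (fun=> 0) x _ _ 0 cB3 (cst x) vb (cst 0)).
have lA : Ga (za t) (phi t) @[t --> x] --> Ga x (phi x).
  exact: (cvg3_comp _ _ _ (fun=> 0) x _ _ 0 cA3 va hphi (cst 0)).
have hm : - Ga (za t) (phi t) / Gb x (zb t) @[t --> x] --> - Ga x (phi x) / Gb x (phi x).
  by apply: cvgM; [exact: cvgN | exact: cvgV].
apply/derP => e e0.
have nB : \forall t \near x, Gb x (zb t) != 0.
  have /cvgrPdist_lt/(_ `|Gb x (phi x)|) := lB.
  rewrite normr_gt0 => /(_ nz); apply: filterS => t.
  by apply: contraTneq => ->; rewrite subr0 ltxx.
have /cvgrPdist_le/(_ _ e0) := hm.
apply: filterS2 nB => t nt ht.
have E : phi t - phi x = - Ga (za t) (phi t) / Gb x (zb t) * (t - x).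
  have [e1 _] := Za t; have [e2 _] := Zb t.
  have e3 : Ga (za t) (phi t) * (t - x) + Gb x (zb t) * (phi t - phi x) = 0.
    by rewrite -e1 -e2 !G0; ring.
  apply: (mulfI nt); rewrite mulrAC [RHS]mulrCA divff // mulr1.
  by apply/eqP; rewrite mulNr -addr_eq0 addrC e3.
by rewrite E -mulrBl normrM distrC ler_wpM2r.
Qed.

(** The integral from 0, selected by the two properties through which it is used; the default, the
    zero function, occurs only when [f] has no primitive. *)
Definition prim (f : R -> R) : R -> R :=
  xget (fun=> 0) [set Phi | Phi 0 = 0 /\ forall x, der Phi x (f x)].

Lemma primP f : continuous f -> prim f 0 = 0 /\ forall x, der (prim f) x (f x).
Proof.
move=> fc; rewrite /prim; case: xgetP => [Phi _ //|h].
by have [Phi hPhi] := primitive_exists f fc; case: (h Phi).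
Qed.

Lemma prim0 f : continuous f -> prim f 0 = 0.
Proof. by case/primP. Qed.

Lemma der_prim f : continuous f -> forall x, der (prim f) x (f x).
Proof. by case/primP. Qed.

Lemma prim_bound f x y C : continuous f ->
  (forall s, Num.min x y <= s <= Num.max x y -> `|f s| <= C) ->
  `|prim f y - prim f x| <= C * `|y - x|.
Proof. by move=> fc; apply: MVT_bound; exact: der_prim. Qed.

Lemma der_eq0 f x y : (forall z, der f z 0) -> f x = f y.
Proof.
move=> d; apply/eqP; rewrite -subr_eq0 -normr_le0.
have -> : 0 = 0 * `|x - y| by rewrite mul0r.
by apply: (MVT_bound _ (fun=> 0)) => // z _; rewrite normr0.
Qed.

Lemma primB f g x : continuous f -> continuous g ->
  prim (fun y => f y - g y) x = prim f x - prim g x.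
Proof.
move=> fc gc; have fgc : continuous (fun y => f y - g y) by cont_tac.
apply/eqP; rewrite -subr_eq0.
have := @der_eq0 (fun x => prim (fun y => f y - g y) x - (prim f x - prim g x)) x 0.
rewrite !prim0 // !subrr => -> // z.
rewrite -(subrr (f z - g z)); apply: der_sub; first exact: der_prim.
by apply: der_sub; exact: der_prim.
Qed.

Lemma der_sub_le f g df dg a b : a <= b -> (forall z, der f z (df z)) ->
  (forall z, der g z (dg z)) -> (forall z, a <= z <= b -> df z <= dg z) ->
  f b - f a <= g b - g a.
Proof.
move=> ab hf hg h.
have dfg z : der (fun y => f y - g y) z (df z - dg z) by exact: der_sub.
have : f b - g b <= f a - g a; last by lra.
apply: (@MVT_nonincreasing _ (fun y => f y - g y) (fun z => df z - dg z)) => //.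
- by apply: continuous_subspaceT; exact: derivative_continuous dfg.
- by move=> z /andP[az zb]; rewrite subr_le0 h // !ltW.
Qed.

(** The endpoint and the parameter vary separately: the former by continuity of one primitive, the
    latter by uniform closeness of the integrands on a compact interval around 0 that contains all
    nearby endpoints. *)
Lemma cont_param {T : topologicalType} (phi : T -> R -> R) :
  continuous (fun z : T * R => phi z.1 z.2) ->
  continuous (fun z : T * R => prim (phi z.1) z.2).
Proof.
move=> hphi.
have pc t : continuous (phi t).
  have := cont_comp' (fun z : T * R => phi z.1 z.2) (fun s => (t, s)) hphi; apply.
  by cont_tac.
move=> [t0 p0] /=; apply/cvgrPdist_lt => e e0.
pose C := `|p0| + 1.
have C0 : 0 < C by rewrite /C ltr_wpDl.
have e2 : 0 < e / 2 / C by rewrite !divr_gt0.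
have K : compact `[- C, C]%classic by exact: segment_compact.
have U := near_uniform phi _ t0 K (fun s _ => hphi (t0, s)) _ e2.
have e20 : 0 < e / 2 by rewrite divr_gt0.
have /cvgrPdist_lt/(_ _ e20) V := der_continuous _ _ _ (der_prim _ (pc t0) p0).
have W : \forall p \near p0, `|p0 - p| < 1 by exact: (@nbhsx_ballx _ _ p0 1 ltr01).
near=> z.
have -> : prim (phi t0) p0 - prim (phi z.1) z.2 =
  (prim (phi t0) p0 - prim (phi t0) z.2)
   + (prim (fun s => phi t0 s - phi z.1 s) z.2 - prim (fun s => phi t0 s - phi z.1 s) 0).
  have cc : continuous (fun s => phi t0 s - phi z.1 s).
    have := pc t0; have := pc z.1 => h1 h2; cont_tac.
  rewrite (prim0 (fun s => _ - _)) // subr0 primB //; ring.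
rewrite (splitr e) (le_lt_trans (ler_normD _ _)) // ltr_leD //.
  near: z; exact: (@cvg_snd _ _ (nbhs t0) (nbhs p0) _ _ V).
have hz1 : forall s, `[- C, C]%classic s -> `|phi z.1 s - phi t0 s| < e / 2 / C.
  near: z; exact: (@cvg_fst _ _ (nbhs t0) (nbhs p0) _ _ U).
have hz2 : `|p0 - z.2| < 1.
  near: z; exact: (@cvg_snd _ _ (nbhs t0) (nbhs p0) _ _ W).
have hz3 : `|z.2| <= C.
  rewrite /C -[z.2](subKr p0) (le_trans (ler_normB _ _))// lerD2l; exact: ltW.
have h4 : e / 2 / C * `|z.2 - 0| <= e / 2.
  by rewrite subr0 mulrAC ler_pdivrMr // ler_pM2l.
apply: le_trans h4; apply: prim_bound.
  have := pc t0; have := pc z.1 => h1 h2; cont_tac.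
move=> s hs; rewrite distrC ltW // hz1 //= in_itv /=.
move: hz3; rewrite ler_norml; move: hs.
by case: (leP 0 z.2) => h /andP[h1 h2] /andP[h3 h4']; apply/andP; split; lra.
Unshelve. all: by end_near.
Qed.

(** Differentiation under the integral sign: the first-order remainder [psi] of the integrand is o(t
    - y) uniformly in s, by the mean value theorem in t and the uniform continuity of [dphi], and so
    is its primitive. *)
Lemma der_param (phi dphi : R -> R -> R) y p : cont2 phi -> cont2 dphi ->
  (forall t s, der (fun t => phi t s) t (dphi t s)) ->
  der (fun t => prim (phi t) p) y (prim (dphi y) p).
Proof.
move=> c1 c2 d; apply/derP => e e0.
have pc t : continuous (phi t) by cont_tac.
have dpc t : continuous (dphi t) by cont_tac.
pose C := `|p| + 1.
have C0 : 0 < C by rewrite /C ltr_wpDl.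
have eC : 0 < e / C by rewrite divr_gt0.
have K : compact `[- C, C]%classic by exact: segment_compact.
have := near_uniform dphi _ y K (fun s _ => c2 (y, s)) _ eC.
move=> /nbhs_ballP[r /= r0 hr].
apply/nbhs_ballP; exists r; first exact: r0.
move=> t yt /=.
pose psi s := phi t s - phi y s - dphi y s * (t - y).
have hpsi : continuous psi by rewrite /psi; cont_tac.
have E x : prim psi x = prim (phi t) x - prim (phi y) x - prim (dphi y) x * (t - y).
  apply/eqP; rewrite -subr_eq0.
  have := @der_eq0 (fun x => prim psi x -
    (prim (phi t) x - prim (phi y) x - prim (dphi y) x * (t - y))) x 0.
  rewrite !prim0 // mul0r !subr0 => -> // z.
  rewrite -(subrr (psi z)); apply: der_sub; first exact: der_prim.
  apply: der_sub; first by apply: der_sub; exact: der_prim.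
  apply: der_to; first by apply: der_mul; [exact: der_prim | exact: der_const].
  by rewrite mulr0 addr0.
rewrite -E -[prim psi p]subr0 -(prim0 psi) //.
apply: (@le_trans _ _ (e / C * `|t - y| * `|p - 0|)); last first.
  rewrite subr0 mulrAC ler_wpM2r // mulrAC ler_pdivrMr // ler_wpM2l ?ltW //.
  by rewrite /C ltrDl.
apply: prim_bound => // s hs; rewrite /psi.
have [z -> hz] := MVT_line _ _ y t (fun u => d u s).
rewrite -mulrBl normrM ler_wpM2r // ltW // hr //.
  move: yt; rewrite /ball /= !ltr_distl; move: hz.
  by case: (leP y t) => h /andP[h1 h2] /andP[h3 h4]; apply/andP; split; lra.
rewrite /= in_itv /= /C; have := ler_norm p; have := ler_norm (- p); rewrite normrN.
by move: hs; case: (leP 0 p) => h /andP[h1 h2] h3 h4; apply/andP; split; lra.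
Qed.

End Calculus.

(** * Approximate Lagrangians *)

Section Cutoff.
Context {R : realType}.
Variable M : R.
Hypothesis M0 : 0 < M.

Definition clamp (s : R) : R := Num.max (- M) (Num.min s M).
(* Of class C^2, since [sin] agrees with the identity to second order at 0. *)
Definition cutoff (s : R) : R := clamp s + sin (s - clamp s).
Definition dcutoff (s : R) : R := cos (s - clamp s).
Definition ddcutoff (s : R) : R := - sin (s - clamp s).

Lemma cont_clamp : continuous clamp.
Proof. rewrite /clamp; cont_tac. Qed.

Lemma cont_cutoff : continuous cutoff.
Proof. have h := cont_clamp; rewrite /cutoff; cont_tac. Qed.

Lemma cont_dcutoff : continuous dcutoff.
Proof. have h := cont_clamp; rewrite /dcutoff; cont_tac. Qed.

Lemma cont_ddcutoff : continuous ddcutoff.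
Proof. have h := cont_clamp; rewrite /ddcutoff; cont_tac. Qed.

Lemma clamp_id s : `|s| <= M -> clamp s = s.
Proof.
by rewrite ler_norml => /andP[h1 h2]; rewrite /clamp (min_idPl h2) (max_idPr h1).
Qed.

Lemma clamp_hi s : M <= s -> clamp s = M.
Proof.
by move=> h; rewrite /clamp (min_idPr h) (max_idPr _) //; move: M0; lra.
Qed.

Lemma clamp_lo s : s <= - M -> clamp s = - M.
Proof.
move=> h; rewrite /clamp (min_idPl _); first by rewrite (max_idPl h).
by move: M0 h; lra.
Qed.

Lemma cutoff_id s : `|s| <= M -> cutoff s = s.
Proof. by move=> /clamp_id; rewrite /cutoff => ->; rewrite subrr sin0 addr0. Qed.

Lemma cutoff_bound s : `|cutoff s| <= M + 1.
Proof.
rewrite (le_trans (ler_normD _ _)) // lerD //.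
  rewrite /clamp ler_norml le_max lexx /= ge_max ge_min lexx orbT andbT.
  by move: M0; lra.
by rewrite ler_norml sin_geN1 sin_le1.
Qed.

Lemma dcutoff_bound s : `|dcutoff s| <= 1.
Proof. by rewrite ler_norml cos_geN1 cos_le1. Qed.

Lemma ddcutoff_bound s : `|ddcutoff s| <= 1.
Proof. by rewrite normrN ler_norml sin_geN1 sin_le1. Qed.

(** At a breakpoint of a piecewise definition every nearby point belongs to one of two pieces with
    common value and slope. *)
Lemma der_glue (f g h : R -> R) x l : der f x l -> der g x l ->
  f x = h x -> g x = h x -> (\forall y \near x, h y = f y \/ h y = g y) -> der h x l.
Proof.
move=> /derP df /derP dg fx gx hfg; apply/derP => e e0.
have := df e e0; have := dg e e0; move: hfg; apply: filterS3 => y.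
by rewrite fx gx => -[->|->].
Qed.

Let der_shift (f : R -> R) df c x : der f (x - c) df -> der (fun y => f (y - c)) x df.
Proof.
move=> h; apply: der_to; first apply: (der_comp f (fun y => y - c) x df (1 - 0) h).
  by apply: der_sub; [exact: der_var|exact: der_const].
by rewrite subr0 mulr1.
Qed.

(* Near any point the clamped function is one of two consecutive pieces. *)
Let der_pieces (f df : R -> R) (h : R -> R) x (a : R) :
  (forall y, der f y (df y)) ->
  (forall y, h y = a * clamp y + f (y - clamp y)) -> df 0 = a ->
  der h x (df (x - clamp x)).
Proof.
move=> hf hh df0.
have Hid y : der (fun t => a * t + f 0) y a.
  apply: der_to; first by apply: der_add; [apply: der_mul;
    [exact: der_const|exact: der_var]|exact: der_const].
  by rewrite mul0r add0r mulr1 addr0.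
have Hc c y : der (fun t => a * c + f (t - c)) y (df (y - c)).
  apply: der_to; first by apply: der_add; [exact: der_const|apply: der_shift; exact: hf].
  by rewrite add0r.
have in_id y : - M <= y <= M -> h y = a * y + f 0.
  by move=> yM; rewrite hh clamp_id ?ler_norml // subrr.
have in_hi y : M <= y -> h y = a * M + f (y - M).
  by move=> yM; rewrite hh clamp_hi.
have in_lo y : y <= - M -> h y = a * (- M) + f (y - (- M)).
  by move=> yM; rewrite hh clamp_lo.
have MN : - M < M by move: M0; lra.
have [xM|xM|xM] := ltgtP x M.
- have [xN|xN|xN] := ltgtP x (- M).
  + rewrite clamp_lo ?ltW //; apply: (der_glue _ _ _ _ _ (Hc (- M) x) (Hc (- M) x)).
    * by rewrite in_lo ?ltW.
    * by rewrite in_lo ?ltW.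
    * have : \forall y \near x, y < - M by exact: lt_nbhsl.
      by apply: filterS => y /ltW/in_lo ->; left.
  + rewrite clamp_id ?ler_norml ?(ltW xN) ?(ltW xM)// subrr df0.
    apply: (der_glue _ _ _ _ _ (Hid x) (Hid x)).
    * by rewrite in_id // !ltW.
    * by rewrite in_id // !ltW.
    * have : \forall y \near x, - M < y by exact: lt_nbhsr.
      have : \forall y \near x, y < M by exact: lt_nbhsl.
      by apply: filterS2 => y h1 h2; left; rewrite in_id // !ltW.
  + subst x; rewrite clamp_lo //.
    have e : df (- M - - M) = a by rewrite subrr.
    have := Hc (- M) (- M); rewrite e => hc.
    apply: (der_glue _ _ _ _ _ (Hid (- M)) hc).
    * by rewrite in_id // lexx ltW.
    * by rewrite in_lo.
    * have : \forall y \near - M, y < M by exact: lt_nbhsl.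
      apply: filterS => y h1; have [h2|h2] := leP y (- M).
        by right; rewrite in_lo.
      by left; rewrite in_id // !ltW.
- rewrite clamp_hi ?ltW //; apply: (der_glue _ _ _ _ _ (Hc M x) (Hc M x)).
  + by rewrite in_hi ?ltW.
  + by rewrite in_hi ?ltW.
  + have : \forall y \near x, M < y by exact: lt_nbhsr.
    by apply: filterS => y /ltW/in_hi ->; left.
- subst x; rewrite clamp_hi //.
  have e : df (M - M) = a by rewrite subrr.
  have := Hc M M; rewrite e => hc.
  apply: (der_glue _ _ _ _ _ (Hid M) hc).
  + by rewrite in_id // lexx ltW.
  + by rewrite in_hi.
  + have : \forall y \near M, - M < y by exact: lt_nbhsr.
    apply: filterS => y h1; have [h2|h2] := leP y M.
      by left; rewrite in_id // h2 ltW.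
    by right; rewrite in_hi // ltW.
Qed.

Lemma der_cutoff x : der cutoff x (dcutoff x).
Proof.
apply: (der_pieces sin cos cutoff x 1); first exact: is_derive_sin.
  by move=> y; rewrite mul1r.
exact: cos0.
Qed.

Lemma der_dcutoff x : der dcutoff x (ddcutoff x).
Proof.
apply: (der_pieces cos (fun y => - sin y) dcutoff x 0); first exact: is_derive_cos.
  by move=> y; rewrite mul0r add0r.
by rewrite sin0 oppr0.
Qed.

End Cutoff.

(** * Advection of the logarithm of the density *)

Section Transport.
Context {R : realType}.
Variables (B Bu Bp Bpu Bpp : R -> R -> R -> R) (C : R).
Hypotheses (cB : cont3 B) (cBu : cont3 Bu) (cBp : cont3 Bp)
  (cBpu : cont3 Bpu) (cBpp : cont3 Bpp).
Hypotheses (dBu : forall x u p, der (fun s => B x s p) u (Bu x u p))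
  (dBp : forall x u p, der (fun s => B x u s) p (Bp x u p))
  (dBpu : forall x u p, der (fun s => Bp x s p) u (Bpu x u p))
  (dBpp : forall x u p, der (fun s => Bp x u s) p (Bpp x u p)).
Hypothesis C1 : 1 <= C.
Hypotheses (bBu : forall x u p, `|Bu x u p| <= C)
  (bBp : forall x u p, `|Bp x u p| <= C)
  (bBpu : forall x u p, `|Bpu x u p| <= C)
  (bBpp : forall x u p, `|Bpp x u p| <= C).

(* The logarithm [h] of the density, advected along the backward Euler step
   (u, p) |-> (u - s p, p - s B) of the characteristics u' = p, p' = B. *)
Definition advect (h : R -> R -> R) (x s u p : R) : R :=
  h (u - s * p) (p - s * B x u p) - s * Bp x u p.

Record C1_bounded (m c : R) (h hu hp : R -> R -> R) : Prop := C1Bounded {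
  c1b_cont : cont2 h; c1b_contu : cont2 hu; c1b_contp : cont2 hp;
  c1b_du : forall u p, der (fun s => h s p) u (hu u p);
  c1b_dp : forall u p, der (fun s => h u s) p (hp u p);
  c1b_hu : forall u p, `|hu u p| <= m;
  c1b_hp : forall u p, `|hp u p| <= m;
  c1b_h : forall u p, `|h u p| <= c }.

Section OneStep.
Variables (m c : R) (h hu hp : R -> R -> R) (x : R).
Hypothesis hC1 : C1_bounded m c h hu hp.

Let ch : cont2 h := c1b_cont _ _ _ _ _ hC1.
Let chu : cont2 hu := c1b_contu _ _ _ _ _ hC1.
Let chp : cont2 hp := c1b_contp _ _ _ _ _ hC1.
Let dhu := c1b_du _ _ _ _ _ hC1.
Let dhp := c1b_dp _ _ _ _ _ hC1.

Definition advect_s (s u p : R) : R :=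
  hu (u - s * p) (p - s * B x u p) * - p
  + hp (u - s * p) (p - s * B x u p) * - B x u p - Bp x u p.

Definition advect_u (s u p : R) : R :=
  hu (u - s * p) (p - s * B x u p)
  + hp (u - s * p) (p - s * B x u p) * - (s * Bu x u p) - s * Bpu x u p.

Definition advect_p (s u p : R) : R :=
  hu (u - s * p) (p - s * B x u p) * - s
  + hp (u - s * p) (p - s * B x u p) * (1 - s * Bp x u p) - s * Bpp x u p.

Lemma cont_advect : cont3 (advect h x).
Proof. rewrite /cont3 /advect; cont_tac. Qed.
Lemma cont_advect_s : cont3 advect_s.
Proof. rewrite /cont3 /advect_s; cont_tac. Qed.
Lemma cont_advect_u : cont3 advect_u.
Proof. rewrite /cont3 /advect_u; cont_tac. Qed.
Lemma cont_advect_p : cont3 advect_p.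
Proof. rewrite /cont3 /advect_p; cont_tac. Qed.

Lemma der_advect_s s u p : der (fun t => advect h x t u p) s (advect_s s u p).
Proof.
have d (b : R) a : der (fun t => a - t * b) s (- b).
  apply: der_to; first by apply: der_sub; [exact: der_const|apply: der_mul;
    [exact: der_var|exact: der_const]].
  by rewrite /=; ring.
apply: der_to; first apply: der_sub.
- exact: (der_chain2 h hu hp _ _ s _ _ chu chp dhu dhp (d p u) (d (B x u p) p)).
- by apply: der_mul; [exact: der_var|exact: der_const].
- by rewrite /advect_s /=; ring.
Qed.

Lemma der_advect_u s u p : der (fun t => advect h x s t p) u (advect_u s u p).
Proof.
have d1 : der (fun t => t - s * p) u 1.
  by apply: der_to; [apply: der_sub; [exact: der_var|exact: der_const]|rewrite /=; ring].
have d2 : der (fun t => p - s * B x t p) u (- (s * Bu x u p)).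
  by apply: der_to; [apply: der_sub; [exact: der_const|apply: der_mul;
    [exact: der_const|exact: dBu]]|rewrite /=; ring].
apply: der_to; first apply: der_sub.
- exact: (der_chain2 h hu hp _ _ u _ _ chu chp dhu dhp d1 d2).
- by apply: der_mul; [exact: der_const|exact: dBpu].
- by rewrite /advect_u /=; ring.
Qed.

Lemma der_advect_p s u p : der (fun t => advect h x s u t) p (advect_p s u p).
Proof.
have d1 : der (fun t => u - s * t) p (- s).
  by apply: der_to; [apply: der_sub; [exact: der_const|apply: der_mul;
    [exact: der_const|exact: der_var]]|rewrite /=; ring].
have d2 : der (fun t => t - s * B x u t) p (1 - s * Bp x u p).
  by apply: der_to; [apply: der_sub; [exact: der_var|apply: der_mul;
    [exact: der_const|exact: dBp]]|rewrite /=; ring].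
apply: der_to; first apply: der_sub.
- exact: (der_chain2 h hu hp _ _ p _ _ chu chp dhu dhp d1 d2).
- by apply: der_mul; [exact: der_const|exact: dBpp].
- by rewrite /advect_p /=; ring.
Qed.

Lemma advect_bound s u p : 0 <= s -> `|advect h x s u p| <= c + s * C.
Proof.
move=> s0; rewrite (le_trans (ler_normB _ _)) // lerD ?(c1b_h _ _ _ _ _ hC1)//.
by rewrite normrM ger0_norm // ler_wpM2l.
Qed.

Lemma advect_u_bound s u p : 0 <= s ->
  `|advect_u s u p| <= m * (1 + 2 * s * C) + 2 * s * C.
Proof.
move=> s0; rewrite (le_trans (ler_normB _ _)) //.
have m0 : 0 <= m by exact: le_trans (normr_ge0 _) (c1b_hu _ _ _ _ _ hC1 0 0).
have sC : 0 <= s * C by rewrite mulr_ge0 // (le_trans _ C1).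
have h1 : `|s * Bpu x u p| <= s * C by rewrite normrM ger0_norm // ler_wpM2l.
have h2 : `|hp (u - s * p) (p - s * B x u p) * - (s * Bu x u p)| <= m * (s * C).
  rewrite normrM ler_pM ?(c1b_hp _ _ _ _ _ hC1)//.
  by rewrite normrN normrM ger0_norm // ler_wpM2l.
have h3 := c1b_hu _ _ _ _ _ hC1 (u - s * p) (p - s * B x u p).
apply: le_trans (_ : (m + m * (s * C)) + s * C <= _).
  by rewrite lerD // (le_trans (ler_normD _ _)) // lerD.
have : 0 <= m * (s * C) by rewrite mulr_ge0.
by move: sC; set a := s * C => sC ?; rewrite -mulrA -/a; lra.
Qed.

Lemma advect_p_bound s u p : 0 <= s ->
  `|advect_p s u p| <= m * (1 + 2 * s * C) + 2 * s * C.
Proof.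
move=> s0; rewrite (le_trans (ler_normB _ _)) //.
have m0 : 0 <= m by exact: le_trans (normr_ge0 _) (c1b_hu _ _ _ _ _ hC1 0 0).
have sC : s <= s * C by rewrite ler_peMr.
have h1 : `|s * Bpp x u p| <= s * C by rewrite normrM ger0_norm // ler_wpM2l.
have h2 : `|hp (u - s * p) (p - s * B x u p) * (1 - s * Bp x u p)| <= m * (1 + s * C).
  rewrite normrM ler_pM ?(c1b_hp _ _ _ _ _ hC1)//.
  rewrite (le_trans (ler_normB _ _)) // normr1 lerD2l normrM ger0_norm //.
  by rewrite ler_wpM2l.
have h3 : `|hu (u - s * p) (p - s * B x u p) * - s| <= m * s.
  by rewrite normrM normrN (ger0_norm s0) ler_wpM2r // (c1b_hu _ _ _ _ _ hC1).
apply: le_trans (_ : (m * s + m * (1 + s * C)) + s * C <= _).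
  by rewrite lerD // (le_trans (ler_normD _ _)) // lerD.
have : m * s <= m * (s * C) by rewrite ler_wpM2l.
by move: sC; set a := s * C => sC ?; rewrite -!(mulrA 2) -/a; lra.
Qed.

(** One step multiplies [m + 1] by 1 + 2 s C. This discrete Gronwall inequality keeps the gradient
    below exp(2 C) over the whole unit interval, however fine the grid. *)
Lemma advect_C1_bounded s : 0 <= s ->
  C1_bounded (m * (1 + 2 * s * C) + 2 * s * C) (c + s * C)
    (advect h x s) (advect_u s) (advect_p s).
Proof.
move=> s0; have := cont_advect; have := cont_advect_u; have := cont_advect_p.
move=> h1 h2 h3; split.
- rewrite /cont2; cont_tac.
- rewrite /cont2; cont_tac.
- rewrite /cont2; cont_tac.
- by move=> u p; exact: der_advect_u.
- by move=> u p; exact: der_advect_p.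
- by move=> u p; exact: advect_u_bound.
- by move=> u p; exact: advect_p_bound.
- by move=> u p; exact: advect_bound.
Qed.

(* Both gradients of [h] are taken at the same shifted point, so the residual
   is small without any modulus of continuity for them. *)
Lemma advect_residual s u p (M D w : R) : 0 <= s ->
  `|p| <= M -> `|B x u p| <= D -> `|B (x + s) u p| <= D ->
  `|B (x + s) u p - B x u p| <= w -> `|Bp (x + s) u p - Bp x u p| <= w ->
  `|advect_s s u p + p * advect_u s u p + B (x + s) u p * advect_p s u p
     + Bp (x + s) u p| <= (m + 1) * (w + s * (D + C * (M + D))).
Proof.
move=> s0 pM BD B'D w1 w2.
have m0 : 0 <= m by exact: le_trans (normr_ge0 _) (c1b_hu _ _ _ _ _ hC1 0 0).
have M0 : 0 <= M by exact: le_trans pM.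
have D0 : 0 <= D by exact: le_trans BD.
have C0 : 0 <= C by exact: le_trans C1.
rewrite /advect_s /advect_u /advect_p.
set a := hu _ _; set b := hp _ _.
have ha : `|a| <= m by exact: (c1b_hu _ _ _ _ _ hC1).
have hb : `|b| <= m by exact: (c1b_hp _ _ _ _ _ hC1).
set X := (X in `|X|).
have -> : X = - (s * B (x + s) u p * a)
   + b * ((B (x + s) u p - B x u p) - s * (p * Bu x u p + B (x + s) u p * Bp x u p))
   - s * (p * Bpu x u p + B (x + s) u p * Bpp x u p)
   + (Bp (x + s) u p - Bp x u p) by rewrite /X; ring.
have prods (y z : R) : `|y| <= C -> `|z| <= C ->
    `|s * (p * y + B (x + s) u p * z)| <= s * (C * (M + D)).
  move=> hy hz; rewrite normrM ger0_norm // ler_wpM2l //.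
  rewrite (le_trans (ler_normD _ _)) // mulrDr lerD // normrM mulrC ler_pM //.
have e1 : `|s * B (x + s) u p * a| <= s * D * m.
  rewrite !normrM (ger0_norm s0) ler_pM // ?mulr_ge0 //; exact: ler_wpM2l.
have e2 := prods _ _ (bBpu x u p) (bBpp x u p).
have e3 : `|b * ((B (x + s) u p - B x u p) -
     s * (p * Bu x u p + B (x + s) u p * Bp x u p))| <= m * (w + s * (C * (M + D))).
  rewrite normrM ler_pM // (le_trans (ler_normB _ _)) // lerD //.
  exact: prods.
have sD : 0 <= s * D by exact: mulr_ge0.
apply: le_trans (_ : s * D * m + m * (w + s * (C * (M + D))) + s * (C * (M + D)) + w <= _).
  rewrite (le_trans (ler_normD _ _)) // lerD //.
  rewrite (le_trans (ler_normB _ _)) // lerD //.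
  by rewrite (le_trans (ler_normD _ _)) // normrN lerD.
move: sD; rewrite !(mulrDr s); move: (s * D) (s * _) => y z y0; lra.
Qed.
End OneStep.

End Transport.

(* On the strip [a <= x <= b]: a Lagrangian [L] with [K = L_p], strictly convex
   in p as [K_p = g >= c], satisfying up to [e] the Euler-Lagrange identity
   L_u - K_x - p K_u = g F, whose extremals are the solutions of u'' = F. *)
Record lagrangian_strip {R : realType} (F : R -> R -> R -> R) (M c C e a b : R)
    (L Lu K Kx Ku g : R -> R -> R -> R) : Prop := LagrangianStrip {
  ls_cL : cont3 L; ls_cLu : cont3 Lu; ls_cK : cont3 K;
  ls_cKx : cont3 Kx; ls_cKu : cont3 Ku; ls_cg : cont3 g;
  ls_dLu : forall x u p, der (fun s => L x s p) u (Lu x u p);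
  ls_dLp : forall x u p, der (fun s => L x u s) p (K x u p);
  ls_dKx : forall x u p, der (fun s => K s u p) x (Kx x u p);
  ls_dKu : forall x u p, der (fun s => K x s p) u (Ku x u p);
  ls_dKp : forall x u p, der (fun s => K x u s) p (g x u p);
  ls_L0 : forall x, L x 0 0 = 0;
  ls_gc : forall x u p, a <= x <= b -> c <= g x u p;
  ls_gC : forall x u p, a <= x <= b -> g x u p <= C;
  ls_KC : forall x u p, a <= x <= b -> `|K x u p| <= C * `|p|;
  ls_LuC : forall x u p, a <= x <= b -> `|u| <= M -> `|p| <= M -> `|Lu x u p| <= C;
  ls_res : forall x u p, a <= x <= b -> `|u| <= M -> `|p| <= M ->
    `|Lu x u p - Kx x u p - p * Ku x u p - g x u p * F x u p| <= e }.

(** * From a density to a Lagrangian *)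

Section LagrangianOfDensity.
Context {R : realType}.
Variables (B Bp H Hx Hu Hp : R -> R -> R -> R).
Hypotheses (cB : cont3 B) (cBp : cont3 Bp) (cH : cont3 H) (cHx : cont3 Hx)
  (cHu : cont3 Hu).
Hypotheses (dBp : forall x u p, der (fun s => B x u s) p (Bp x u p))
  (dHx : forall x u p, der (fun s => H s u p) x (Hx x u p))
  (dHu : forall x u p, der (fun s => H x s p) u (Hu x u p))
  (dHp : forall x u p, der (fun s => H x u s) p (Hp x u p)).

Definition dens x u p := expR (H x u p).
Definition dens_x x u p := expR (H x u p) * Hx x u p.
Definition dens_u x u p := expR (H x u p) * Hu x u p.
Definition dens_p x u p := expR (H x u p) * Hp x u p.

Lemma cdens : cont3 dens. Proof. rewrite /cont3 /dens; cont_tac. Qed.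
Lemma cdens_x : cont3 dens_x. Proof. rewrite /cont3 /dens_x; cont_tac. Qed.
Lemma cdens_u : cont3 dens_u. Proof. rewrite /cont3 /dens_u; cont_tac. Qed.

Lemma der_dens_x x u p : der (fun s => dens s u p) x (dens_x x u p).
Proof. exact: (der_comp expR _ _ _ _ (is_derive_expR _) (dHx x u p)). Qed.
Lemma der_dens_u x u p : der (fun s => dens x s p) u (dens_u x u p).
Proof. exact: (der_comp expR _ _ _ _ (is_derive_expR _) (dHu x u p)). Qed.
Lemma der_dens_p x u p : der (fun s => dens x u s) p (dens_p x u p).
Proof. exact: (der_comp expR _ _ _ _ (is_derive_expR _) (dHp x u p)). Qed.

Definition lagK x u p := prim (dens x u) p.
Definition lagKx x u p := prim (dens_x x u) p.
Definition lagKu x u p := prim (dens_u x u) p.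

Lemma cont3_prim (G : R -> R -> R -> R) : cont3 G -> cont3 (fun x u => prim (G x u)).
Proof. by move=> cG; exact: (cont_param (fun z : R * R => G z.1 z.2)). Qed.

Lemma clagK : cont3 lagK. Proof. exact: cont3_prim cdens. Qed.
Lemma clagKx : cont3 lagKx. Proof. exact: cont3_prim cdens_x. Qed.
Lemma clagKu : cont3 lagKu. Proof. exact: cont3_prim cdens_u. Qed.

Lemma der_prim_x (G Gx : R -> R -> R -> R) x u p : cont3 G -> cont3 Gx ->
  (forall x u p, der (fun s => G s u p) x (Gx x u p)) ->
  der (fun s => prim (G s u) p) x (prim (Gx x u) p).
Proof.
move=> cG cGx d; apply: (der_param (fun s => G s u) (fun s => Gx s u)) => //;
  rewrite /cont2; cont_tac.
Qed.

Lemma der_prim_u (G Gu : R -> R -> R -> R) x u p : cont3 G -> cont3 Gu ->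
  (forall x u p, der (fun s => G x s p) u (Gu x u p)) ->
  der (fun s => prim (G x s) p) u (prim (Gu x u) p).
Proof.
move=> cG cGu d; apply: (der_param (fun s => G x s) (fun s => Gu x s)) => //;
  rewrite /cont2; cont_tac.
Qed.

Lemma der_prim_p (G : R -> R -> R -> R) x u p : cont3 G ->
  der (fun s => prim (G x u) s) p (G x u p).
Proof. by move=> cG; apply: der_prim; cont_tac. Qed.

(** The added function of (x, u) makes the Euler-Lagrange identity exact at p = 0, where K, K_x and
    K_u vanish. *)
Definition lag x u p :=
  prim (lagK x u) p + prim (fun v => dens x v 0 * B x v 0) u.
Definition lag_u x u p := prim (lagKu x u) p + dens x u 0 * B x u 0.

Lemma clag : cont3 lag.
Proof.
have h1 : cont3 (fun x u => prim (lagK x u)) by exact: cont3_prim clagK.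
have cd := cdens.
have h2 : cont3 (fun x _ => prim (fun v => dens x v 0 * B x v 0)).
  by apply: cont3_prim; rewrite /cont3; cont_tac.
rewrite /cont3 /lag.
have h2' : cont3 (fun x u (_ : R) => prim (fun v => dens x v 0 * B x v 0) u).
  apply: (cont3_comp (fun x _ => prim (fun v => dens x v 0 * B x v 0))
     (fun z : R * R * R => z.1.1) (fun=> 0) (fun z => z.1.2) h2); cont_tac.
exact: contD.
Qed.

Lemma clag_u : cont3 lag_u.
Proof.
have h1 : cont3 (fun x u => prim (lagKu x u)) by exact: cont3_prim clagKu.
have cd := cdens.
rewrite /cont3 /lag_u; apply: contD; first exact: h1.
cont_tac.
Qed.

Lemma lag_residual x u p : exists2 z,
  lag_u x u p - lagKx x u p - p * lagKu x u p - dens x u p * B x u p =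
    - (dens x u z * (Hx x u z + z * Hu x u z + B x u z * Hp x u z + Bp x u z)) * p &
  Num.min 0 p <= z <= Num.max 0 p.
Proof.
pose E s := lag_u x u s - lagKx x u s - s * lagKu x u s - dens x u s * B x u s.
pose dE s := - (dens x u s * (Hx x u s + s * Hu x u s + B x u s * Hp x u s + Bp x u s)).
have dEs s : der E s (dE s).
  apply: der_to.
    apply: der_sub; last by apply: der_mul; [exact: der_dens_p|exact: dBp].
    apply: der_sub; last first.
      by apply: der_mul; [exact: der_var|exact: der_prim_p cdens_u].
    apply: der_sub; last exact: der_prim_p cdens_x.
    by apply: der_add; [exact: der_prim_p clagKu|exact: der_const].
  rewrite /dE /dens_x /dens_u /dens_p /dens /lagKu /=; ring.
have E0 : E 0 = 0.
  have p0 G : cont3 G -> prim (G x u) 0 = 0 by move=> cG; apply: prim0; cont_tac.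
  rewrite /E /lag_u /lagKx /lagKu (p0 _ cdens_x) (p0 _ cdens_u) (p0 _ clagKu).
  by ring.
have [z] := MVT_line E dE 0 p dEs.
by rewrite E0 !subr0 => e hz; exists z.
Qed.

(** In the upper constant, 1 accounts for the density and hence for K, [M * M * m] for the double
    primitive of the u-derivative of the density, and [D] for the term of [lag_u] at p = 0. The [M]
    in [expR c * e * M] bounds the length of the p-interval in [lag_residual]. *)
Lemma lagrangian_of_density (F : R -> R -> R -> R) (M m c e e' D a b : R) :
  (forall x u p, a <= x <= b -> `|H x u p| <= c) ->
  (forall x u p, a <= x <= b -> `|Hu x u p| <= m) ->
  (forall x u p, a <= x <= b -> `|u| <= M -> `|p| <= M ->
     [/\ F x u p = B x u p, `|B x u p| <= D &
     `|Hx x u p + p * Hu x u p + B x u p * Hp x u p + Bp x u p| <= e]) ->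
  0 <= M -> 0 <= m -> 0 <= D -> expR c * e * M <= e' ->
  lagrangian_strip F M (expR (- c)) (expR c * (1 + M * M * m + D))
    e' a b lag lag_u lagK lagKx lagKu dens.
Proof.
move=> hH hHu hbox M0 m0 D0 ee'.
have g0 x u p : 0 < dens x u p by exact: expR_gt0.
have gc x u p : a <= x <= b -> dens x u p <= expR c.
  by move=> xab; rewrite /dens ler_expR (le_trans (ler_norm _)) ?hH.
have ec : 0 <= expR c by exact: expR_ge0.
have MMm : 0 <= M * M * m by rewrite !mulr_ge0.
have cle : expR c <= expR c * (1 + M * M * m + D).
  by rewrite ler_peMr //; lra.
have pc (G : R -> R -> R -> R) x u : cont3 G -> continuous (G x u).
  by move=> cG; cont_tac.
have bnd (G : R -> R -> R -> R) x u p k : cont3 G ->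
    (forall s, `|s| <= `|p| -> `|G x u s| <= k) -> `|prim (G x u) p| <= k * `|p|.
  move=> cG hG; have := prim_bound (G x u) 0 p k (pc _ _ _ cG).
  rewrite (prim0 _ (pc _ x u cG)) !subr0.
  apply => s hs; apply: hG; move: hs.
  by case: (ler0P p) => h /andP[h1 h2]; rewrite ler_norml; apply/andP; split; lra.
split.
- exact: clag.
- exact: clag_u.
- exact: clagK.
- exact: clagKx.
- exact: clagKu.
- exact: cdens.
- move=> x u p; apply: der_add; first exact: der_prim_u clagK clagKu
    (fun x u p => der_prim_u _ _ x u p cdens cdens_u der_dens_u).
  by apply: (@der_prim _ (fun v => dens x v 0 * B x v 0)); have h := cdens; cont_tac.
- move=> x u p; apply: der_to; first by apply: der_add; [exact: der_prim_p clagK|exact: der_const].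
  by rewrite addr0.
- by move=> x u p; exact: der_prim_x cdens cdens_x der_dens_x.
- by move=> x u p; exact: der_prim_u cdens cdens_u der_dens_u.
- by move=> x u p; exact: der_prim_p cdens.
- move=> x; rewrite /lag !prim0 ?addr0 //.
    by have h := cdens; cont_tac.
  exact: pc clagK.
- move=> x u p xab; rewrite /dens ler_expR lerNl (le_trans (ler_norm _)) // normrN.
  exact: hH.
- by move=> x u p xab; exact: le_trans (gc _ _ _ xab) cle.
- move=> x u p xab; apply: (bnd); first exact: cdens.
  by move=> s _; rewrite ger0_norm ?(ltW (g0 _ _ _)) // (le_trans (gc _ _ _ xab)).
- move=> x u p xab uM pM; rewrite (le_trans (ler_normD _ _)) //.
  have h1 : `|prim (lagKu x u) p| <= expR c * m * M * M.
    apply: (@le_trans _ _ (expR c * m * M * `|p|)); last by rewrite ler_wpM2l // !mulr_ge0.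
    apply: (bnd); first exact: clagKu.
    move=> s sp; apply: (@le_trans _ _ (expR c * m * `|s|)); last first.
      by rewrite ler_wpM2l ?mulr_ge0 // (le_trans sp).
    apply: (bnd); first exact: cdens_u.
    move=> r _; rewrite normrM ler_pM // ?hHu //.
    by rewrite ger0_norm ?(ltW (g0 _ _ _)) //; exact: gc.
  have h2 : `|dens x u 0 * B x u 0| <= expR c * D.
    have [|_ hD _] := hbox x u 0 xab uM; first by rewrite normr0.
    by rewrite normrM ler_pM // ger0_norm ?(ltW (g0 _ _ _)) //; exact: gc.
  apply: (le_trans (lerD h1 h2)).
  have -> : expR c * m * M * M + expR c * D = expR c * (M * M * m + D) by ring.
  by rewrite ler_wpM2l //; lra.
- move=> x u p xab uM pM; have [-> _ _] := hbox x u p xab uM pM.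
  have [z -> hz] := lag_residual x u p.
  have zM : `|z| <= M.
    move: pM hz; rewrite !ler_norml.
    by case: (ler0P p) => h /andP[h1 h2] /andP[h3 h4]; apply/andP; split; lra.
  have [_ _ hr] := hbox x u z xab uM zM.
  apply: le_trans ee'; rewrite normrM normrN ler_pM // normrM ler_pM //.
  by rewrite ger0_norm ?(ltW (g0 _ _ _)) //; exact: gc.
Qed.

End LagrangianOfDensity.

(** * Lagrangians on a grid of strips *)

Section Strips.
Context {R : realType}.
Variables (B Bu Bp Bpu Bpp : R -> R -> R -> R) (C : R).
Hypotheses (cB : cont3 B) (cBu : cont3 Bu) (cBp : cont3 Bp)
  (cBpu : cont3 Bpu) (cBpp : cont3 Bpp).
Hypotheses (dBu : forall x u p, der (fun s => B x s p) u (Bu x u p))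
  (dBp : forall x u p, der (fun s => B x u s) p (Bp x u p))
  (dBpu : forall x u p, der (fun s => Bp x s p) u (Bpu x u p))
  (dBpp : forall x u p, der (fun s => Bp x u s) p (Bpp x u p)).
Hypothesis C1 : 1 <= C.
Hypotheses (bBu : forall x u p, `|Bu x u p| <= C)
  (bBp : forall x u p, `|Bp x u p| <= C)
  (bBpu : forall x u p, `|Bpu x u p| <= C)
  (bBpp : forall x u p, `|Bpp x u p| <= C).

(** Logarithm of the density at the node [k * d], started from density 1 at x = 0; the step between
    two nodes freezes the coefficients at the left one. *)
Fixpoint euler (d : R) (k : nat) : R -> R -> R :=
  if k is k'.+1 then advect B Bp (euler d k') (k'%:R * d) d else fun _ _ => 0.

Lemma euler_C1_bounded d k : 0 <= d -> exists hu hp,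
  C1_bounded ((1 + 2 * d * C) ^+ k - 1) (k%:R * d * C) (euler d k) hu hp.
Proof.
move=> d0; elim: k => [|k [hu [hp IH]]].
  exists (fun _ _ => 0), (fun _ _ => 0).
  rewrite -[euler d 0]/(fun _ _ : R => 0 : R); split.
  - by rewrite /cont2; cont_tac.
  - by rewrite /cont2; cont_tac.
  - by rewrite /cont2; cont_tac.
  - by move=> u p; exact: der_const.
  - by move=> u p; exact: der_const.
  - by move=> u p; rewrite normr0 expr0 subrr.
  - by move=> u p; rewrite normr0 expr0 subrr.
  - by move=> u p; rewrite normr0 !mul0r.
have := advect_C1_bounded B Bu Bp Bpu Bpp C cB cBu cBp cBpu cBpp dBu dBp dBpu dBpp
  C1 bBu bBp bBpu bBpp _ _ _ _ _ (k%:R * d) IH d d0.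
set hu' := advect_u _ _ _ _ _ _; set hp' := advect_p _ _ _ _ _ _ => h.
exists (hu' d), (hp' d); rewrite -[euler d k.+1]/(advect B Bp (euler d k) (k%:R * d) d).
have -> : (1 + 2 * d * C) ^+ k.+1 - 1 =
   ((1 + 2 * d * C) ^+ k - 1) * (1 + 2 * d * C) + 2 * d * C by rewrite exprS; ring.
have -> : k.+1%:R * d * C = k%:R * d * C + d * C by rewrite -[k.+1%:R]natr1; ring.
exact: h.
Qed.

Lemma inv_nat_lt (e : R) : 0 < e -> exists2 n, (0 < n)%N & n%:R^-1 < e.
Proof.
move=> e0; have [n _ hn] := near_infty_natSinv_lt (PosNum e0).
by exists n.+1 => //; apply: hn => /=.
Qed.

(** The constants precede [e] because, for every mesh, the logarithm of the density stays within [C]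
    and its gradient within exp(2 C). Between nodes, the step out of the left node is taken with
    length x - x_k; this makes K match at the nodes, which is recorded so that the boundary terms of
    neighbouring strips cancel. *)
Lemma lagrangian_strips (F : R -> R -> R -> R) (M : R) : 0 <= M ->
  (forall x u p, 0 <= x <= 1 -> `|u| <= M -> `|p| <= M -> F x u p = B x u p) ->
  exists c C' : R, 0 < c /\ forall e, 0 < e ->
  exists N L Lu K Kx Ku g, [/\ (0 < N)%N,
    (forall k, (k < N)%N -> lagrangian_strip F M c C' e (k%:R / N%:R) (k.+1%:R / N%:R)
        (L k) (Lu k) (K k) (Kx k) (Ku k) (g k)) &
    forall k u p, K k (k.+1%:R / N%:R) u p = K k.+1 (k.+1%:R / N%:R) u p].
Proof.
move=> M0 FB.
have C0 : 0 <= C by exact: le_trans C1.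
have [D D0 hD] := box_bounded B M cB.
pose m := expR (2 * C).
have m0 : 0 < m by exact: expR_gt0.
exists (expR (- C)), (expR C * (1 + M * M * m + D)); split; first exact: expR_gt0.
move=> e e0.
pose Q := expR C * (M + 1) * m.
have Q0 : 0 < Q by rewrite !mulr_gt0 ?expR_gt0 // ltr_wpDl.
(* The residual will be at most [m * (w + w)]: one [w] for the oscillation of [B] and [Bp] over a
   step, one for the terms proportional to the step, where [Q2] enters. This equals e / (e^C (M +
   1)), which the passage to Lagrangians multiplies by at most e^C M. *)
pose w := e / Q / 2.
have w0 : 0 < w by rewrite !divr_gt0.
have [r1 r10 hr1] := box_modulus B M w cB w0.
have [r2 r20 hr2] := box_modulus Bp M w cBp w0.
pose Q2 := D + C * (M + D) + 1.
have Q20 : 0 < Q2 by rewrite ltr_wpDl // addr_ge0 // mulr_ge0 // addr_ge0.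
have mn0 : 0 < Num.min (Num.min r1 r2) (w / Q2).
  by rewrite !lt_min r10 r20 divr_gt0.
have [N N0 hN] := inv_nat_lt _ mn0.
pose d : R := N%:R^-1.
have N0' : 0 < N%:R :> R by rewrite ltr0n.
have d0 : 0 < d by rewrite invr_gt0.
have /choice[hu /choice[hp hC1]] := fun k => euler_C1_bounded d k (ltW d0).
pose xk k : R := k%:R * d.
pose H k x u p := advect B Bp (euler d k) (xk k) (x - xk k) u p.
pose Hx k x u p := advect_s B Bp (hu k) (hp k) (xk k) (x - xk k) u p.
pose Hu k x u p := advect_u B Bu Bpu (hu k) (hp k) (xk k) (x - xk k) u p.
pose Hp k x u p := advect_p B Bp Bpp (hu k) (hp k) (xk k) (x - xk k) u p.
have shift3 (G : R -> R -> R -> R) k : cont3 G -> cont3 (fun x u p => G (x - xk k) u p).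
  by move=> cG; rewrite /cont3; cont_tac.
have cH k : cont3 (H k).
  by apply: shift3; exact: (cont_advect _ _ cB cBp _ _ _ _ _ _ (hC1 k)).
have cHx k : cont3 (Hx k).
  by apply: shift3; exact: (cont_advect_s _ _ cB cBp _ _ _ _ _ _ (hC1 k)).
have cHu k : cont3 (Hu k).
  by apply: shift3; exact: (cont_advect_u _ _ _ cB cBu cBpu _ _ _ _ _ _ (hC1 k)).
have dHx k x u p : der (fun s => H k s u p) x (Hx k x u p).
  have h := der_advect_s B Bp _ _ _ _ _ (xk k) (hC1 k) (x - xk k) u p.
  have hs : der (fun s => s - xk k) x (1 - 0) by apply: der_sub; [exact: der_var|exact: der_const].
  apply: der_to (mulr1 _); rewrite -(subr0 (1 : R)).
  exact: (der_comp (fun t => advect B Bp (euler d k) (xk k) t u p) (fun s => s - xk k)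
    x _ _ h hs).
have dHu k x u p : der (fun s => H k x s p) u (Hu k x u p).
  exact: (der_advect_u _ _ _ _ dBu dBpu _ _ _ _ _ (xk k) (hC1 k) (x - xk k) u p).
have dHp k x u p : der (fun s => H k x u s) p (Hp k x u p).
  exact: (der_advect_p _ _ _ dBp dBpp _ _ _ _ _ (xk k) (hC1 k) (x - xk k) u p).
pose q := 1 + 2 * d * C.
have dC0 : 0 <= 2 * d * C by rewrite !mulr_ge0 // ltW.
have q1 : 1 <= q by rewrite lerDl.
(* From 1 + y <= exp y, for at most [N] steps of length 1 / N. *)
have qm j : (j <= N)%N -> q ^+ j <= m.
  move=> jN; have h : q <= expR (2 * d * C) by exact: expR_ge1Dx.
  apply: le_trans (lerXn2r j _ _ h) _; rewrite ?nnegrE ?expR_ge0 // ?(le_trans ler01)//.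
  rewrite -expRM_natl ler_expR -!mulrA mulrCA ler_pM2l // mulrA ler_piMl //.
  by rewrite ler_pdivrMr // mul1r ler_nat.
exists N.
exists (fun k => lag B (H k)), (fun k => lag_u B (H k) (Hu k)), (fun k => lagK (H k)),
  (fun k => lagKx (H k) (Hx k)), (fun k => lagKu (H k) (Hu k)), (fun k => dens (H k)).
split => //; last first.
  move=> k u p; congr (prim _ p); apply/funext => s; congr expR; rewrite /H.
  have -> : k.+1%:R / N%:R - xk k = d by rewrite /xk -/d -natr1; ring.
  by rewrite -/d -/(xk k.+1) subrr [RHS]/advect !mul0r !subr0.
move=> k kN.
have strip x : k%:R / N%:R <= x <= k.+1%:R / N%:R ->
    [/\ 0 <= x - xk k, x - xk k <= d, 0 <= x <= 1 & 0 <= xk k <= 1].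
  rewrite /xk -/d => /andP[h1 h2].
  have k0 : 0 <= k%:R * d by rewrite mulr_ge0 // ltW.
  have k1 : k.+1%:R * d <= 1 by rewrite /d ler_pdivrMr // mul1r ler_nat.
  have e3 : k.+1%:R * d = k%:R * d + d by rewrite -natr1; ring.
  by split; [| |apply/andP; split|apply/andP; split]; lra.
have mk0 : 0 <= q ^+ k - 1 by rewrite subr_ge0 exprn_ege1.
apply: (lagrangian_of_density B Bp (H k) (Hx k) (Hu k) (Hp k) cB (cH k) (cHx k) (cHu k)
   dBp (dHx k) (dHu k) (dHp k) F M m C (e / (expR C * (M + 1)))) => //.
- move=> x u p /strip[s0 sd _ _].
  apply: le_trans (advect_bound _ _ _ bBp _ _ _ _ _ _ (hC1 k) _ _ _ s0) _.
  rewrite -mulrDl ler_piMl // (le_trans (lerD (lexx _) sd)) //.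
  have -> : k%:R * d + d = k.+1%:R * d by rewrite -natr1; ring.
  by rewrite ler_pdivrMr // mul1r ler_nat.
- move=> x u p /strip[s0 sd _ _].
  apply: le_trans (advect_u_bound _ _ _ _ C1 bBu bBpu _ _ _ _ _ _ (hC1 k) _ _ _ s0) _.
  apply: le_trans (qm k.+1 kN).
  have sdC : 2 * (x - xk k) * C <= 2 * d * C by rewrite ler_wpM2r // ler_pM2l.
  have -> : q ^+ k.+1 = (q ^+ k - 1) * (1 + 2 * d * C) + 2 * d * C + 1.
    by rewrite exprS /q; ring.
  have : (q ^+ k - 1) * (1 + 2 * (x - xk k) * C) <= (q ^+ k - 1) * (1 + 2 * d * C).
    by rewrite ler_wpM2l // lerD2l.
  by rewrite -/q; lra.
- move=> x u p /strip[s0 sd x01 xk01] uM pM.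
  have xE : xk k + (x - xk k) = x by ring.
  split; [exact: FB|exact: hD|].
  have mn : d < Num.min (Num.min r1 r2) (w / Q2) by exact: hN.
  move: mn; rewrite !lt_min => /andP[/andP[dr1 dr2] dQ].
  have sr1 : `|x - xk k| < r1 by rewrite ger0_norm // (le_lt_trans sd).
  have sr2 : `|x - xk k| < r2 by rewrite ger0_norm // (le_lt_trans sd).
  have := advect_residual B Bu Bp Bpu Bpp C C1 bBu bBp bBpu bBpp _ _ _ _ _ (xk k) (hC1 k)
    (x - xk k) u p M D w s0 pM.
  rewrite xE => /(_ (hD _ _ _ xk01 uM pM) (hD _ _ _ x01 uM pM)).
  have := hr1 _ _ _ _ xk01 sr1 uM pM; have := hr2 _ _ _ _ xk01 sr2 uM pM.
  rewrite xE => h2 h1 /(_ h1 h2); rewrite -/(Hx k x u p) -/(Hu k x u p) -/(Hp k x u p).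
  move=> hres; apply: le_trans hres _.
  rewrite subrK; apply: (@le_trans _ _ (m * (w + w))).
    rewrite ler_pM //.
    + by rewrite exprn_ge0 // (le_trans ler01).
    + by rewrite addr_ge0 ?(ltW w0) // mulr_ge0 // addr_ge0 // mulr_ge0 // addr_ge0.
    + by apply: qm; exact: ltnW.
    rewrite lerD2l (le_trans (_ : _ <= d * Q2)) //.
      rewrite ler_pM // ?addr_ge0 ?mulr_ge0 ?addr_ge0 //.
      by rewrite /Q2 lerDl.
    by move: dQ; rewrite ltr_pdivlMr // => /ltW.
  have -> : w + w = e / Q by rewrite /w -splitr.
  rewrite /Q le_eqVlt; apply/orP; left; apply/eqP; field.
  by rewrite !gt_eqF ?expR_gt0 // ltr_wpDl.
- exact: ltW.
- have h : 0 < expR C * (M + 1) by rewrite mulr_gt0 ?expR_gt0 // ltr_wpDl.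
  have -> : expR C * (e / (expR C * (M + 1))) * M = e * (M / (M + 1)).
    by field; rewrite !gt_eqF ?expR_gt0 // ltr_wpDl.
  by rewrite ler_piMr ?(ltW e0) // ler_pdivrMr ?ltr_wpDl // mul1r lerDl.
Qed.
End Strips.

(** * The equation solved for u_xx *)

Section RightHandSide.
Context {R : realType}.

(** Retraction onto [0, 1]: composing with it turns continuity within the interval into continuity
    on the line. *)
Definition clamp01 (x : R) : R := Num.max 0 (Num.min x 1).

Lemma clamp01_itv x : 0 <= clamp01 x <= 1.
Proof. by rewrite /clamp01 le_max lexx ge_max ler01 ge_min lexx orbT. Qed.

Lemma clamp01_id x : 0 <= x <= 1 -> clamp01 x = x.
Proof. by move=> /andP[h1 h2]; rewrite /clamp01 (min_idPl h2) (max_idPr h1). Qed.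

Lemma cont_clamp01 : continuous clamp01.
Proof. rewrite /clamp01; cont_tac. Qed.

(** The field [rhs_clamp] turns a bound for x in [0, 1] into one for all real x, as the advection
    works with global bounds. *)
Record rhs (F Fu Fp Fpu Fpp : R -> R -> R -> R) : Prop := Rhs {
  rhs_c : cont3 F; rhs_cu : cont3 Fu; rhs_cp : cont3 Fp;
  rhs_cpu : cont3 Fpu; rhs_cpp : cont3 Fpp;
  rhs_du : forall x u p, der (fun s => F x s p) u (Fu x u p);
  rhs_dp : forall x u p, der (fun s => F x u s) p (Fp x u p);
  rhs_dpu : forall x u p, der (fun s => Fp x s p) u (Fpu x u p);
  rhs_dpp : forall x u p, der (fun s => Fp x u s) p (Fpp x u p);
  rhs_clamp : forall x u p, [/\ Fu x u p = Fu (clamp01 x) u p,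
    Fp x u p = Fp (clamp01 x) u p, Fpu x u p = Fpu (clamp01 x) u p &
    Fpp x u p = Fpp (clamp01 x) u p] }.

(** Composing u and p with the cutoff of level [M] changes nothing on the box of that level and
    confines all arguments to the box of level [M + 1], where compactness bounds the coefficients.
    The second p-derivative of the composite involves the second derivative of the cutoff. *)
Lemma rhs_strips F Fu Fp Fpu Fpp (M : R) : rhs F Fu Fp Fpu Fpp -> 0 < M ->
  exists c C' : R, 0 < c /\ forall e, 0 < e ->
  exists N L Lu K Kx Ku g, [/\ (0 < N)%N,
    (forall k, (k < N)%N -> lagrangian_strip F M c C' e (k%:R / N%:R) (k.+1%:R / N%:R)
        (L k) (Lu k) (K k) (Kx k) (Ku k) (g k)) &
    forall k u p, K k (k.+1%:R / N%:R) u p = K k.+1 (k.+1%:R / N%:R) u p].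
Proof.
move=> [cF cFu cFp cFpu cFpp dFu dFp dFpu dFpp Fc] M0.
pose T := cutoff M; pose dT := dcutoff M; pose ddT := ddcutoff M.
have cT : continuous T by exact: cont_cutoff.
have cdT : continuous dT by exact: cont_dcutoff.
have cddT : continuous ddT by exact: cont_ddcutoff.
have hT x : der T x (dT x) by exact: der_cutoff.
have hdT x : der dT x (ddT x) by exact: der_dcutoff.
have M1 : 0 <= M + 1 by rewrite addr_ge0 // ltW.
have bd (G : R -> R -> R -> R) : cont3 G ->
    (forall x u p, G x u p = G (clamp01 x) u p) ->
    exists2 C, 0 <= C & forall x u p, `|G x (T u) (T p)| <= C.
  move=> cG hG; have [C C0 hC] := box_bounded G (M + 1) cG.
  exists C => // x u p; rewrite hG.
  by apply: hC; [exact: clamp01_itv|exact: cutoff_bound|exact: cutoff_bound].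
have [C1 C10 h1] := bd Fu cFu (fun x u p => let: And4 e _ _ _ := Fc x u p in e).
have [C2 C20 h2] := bd Fp cFp (fun x u p => let: And4 _ e _ _ := Fc x u p in e).
have [C3 C30 h3] := bd Fpu cFpu (fun x u p => let: And4 _ _ e _ := Fc x u p in e).
have [C4 C40 h4] := bd Fpp cFpp (fun x u p => let: And4 _ _ _ e := Fc x u p in e).
have bT s : `|dT s| <= 1 by exact: dcutoff_bound.
have bbT s : `|ddT s| <= 1 by exact: ddcutoff_bound.
have b1 (y a b : R) : `|y| <= b -> `|a| <= 1 -> `|y * a| <= b.
  move=> hy ha; rewrite normrM -[b]mulr1; exact: ler_pM.
apply: (lagrangian_strips (fun x u p => F x (T u) (T p))
  (fun x u p => Fu x (T u) (T p) * dT u) (fun x u p => Fp x (T u) (T p) * dT p)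
  (fun x u p => Fpu x (T u) (T p) * dT u * dT p)
  (fun x u p => Fpp x (T u) (T p) * dT p * dT p + Fp x (T u) (T p) * ddT p)
  (1 + C1 + C2 + C3 + C4)).
- rewrite /cont3; cont_tac.
- rewrite /cont3; cont_tac.
- rewrite /cont3; cont_tac.
- rewrite /cont3; cont_tac.
- rewrite /cont3; cont_tac.
- by move=> x u p; exact: (der_comp (fun s => F x s (T p)) T u _ _ (dFu x (T u) (T p)) (hT u)).
- by move=> x u p; exact: (der_comp (fun s => F x (T u) s) T p _ _ (dFp x (T u) (T p)) (hT p)).
- move=> x u p; apply: der_to.
    apply: der_mul; last exact: der_const.
    exact: (der_comp (fun s => Fp x s (T p)) T u _ _ (dFpu x (T u) (T p)) (hT u)).
  by rewrite mulr0 addr0.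
- move=> x u p; apply: der_to.
    apply: der_mul; last exact: hdT.
    exact: (der_comp (fun s => Fp x (T u) s) T p _ _ (dFpp x (T u) (T p)) (hT p)).
  by [].
- lra.
- by move=> x u p; apply: (b1) => //; apply: le_trans (h1 x u p) _; lra.
- by move=> x u p; apply: (b1) => //; apply: le_trans (h2 x u p) _; lra.
- by move=> x u p; do 2 apply: (b1) => //; apply: le_trans (h3 x u p) _; lra.
- move=> x u p; apply: (@le_trans _ _ (C4 + C2)); last by lra.
  by rewrite (le_trans (ler_normD _ _)) // lerD // ?(b1) // (b1).
- exact: ltW.
- by move=> x u p x01 uM pM; rewrite /T !cutoff_id.
Qed.

Lemma cont_args {T : topologicalType} (g : R -> R -> R -> R -> R -> R)
    (a b c d e : T -> R) : continuous_args g ->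
  continuous a -> continuous b -> continuous c -> continuous d -> continuous e ->
  (forall z, 0 <= a z <= 1) ->
  continuous (fun z => g (a z) (b z) (c z) (d z) (e z)).
Proof.
move=> /subspace_continuousP hg ca cb cc cd ce a01 z.
pose h z := (a z, b z, c z, d z, e z).
have ch : continuous h by rewrite /h; cont_tac.
have := hg (h z) (a01 z) => hgz.
have := cvg_comp h (fun z => g z.1.1.1.1 z.1.1.1.2 z.1.1.2 z.1.2 z.2) _ hgz.
apply => A hA.
have hA' : \forall y \near z, (0 <= a y <= 1) -> A (h y) := ch z _ hA.
apply: (filterS _ hA') => y hy; exact: (hy (a01 y)).
Qed.

(** The derivative in q never vanishes, so each [phi t] is injective and changes sign across its
    zero. The opposite signs at [Phi t0 - e] and [Phi t0 + e] persist for nearby t and enclose the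
    zero of [phi t]. *)
Lemma implicit_continuous {T : topologicalType} (phi dphi : T -> R -> R) (Phi : T -> R) :
  (forall q, continuous (fun t => phi t q)) ->
  (forall t q, der (phi t) q (dphi t q)) -> (forall t q, dphi t q != 0) ->
  (forall t, phi t (Phi t) = 0) -> continuous Phi.
Proof.
move=> cphi dp d0 P0 t0.
have inj t q1 q2 : phi t q1 = phi t q2 -> q1 = q2.
  move=> e; have [z] := MVT_line _ _ q1 q2 (dp t).
  rewrite e subrr => /esym/eqP; rewrite mulf_eq0 (negbTE (d0 _ _)) /= subr_eq0.
  by move=> /eqP->.
have cq t : continuous (phi t) by exact: derivative_continuous (dp t).
apply/cvgrPdist_le => e e0.
set q0 := Phi t0.
have neg : phi t0 (q0 - e) * phi t0 (q0 + e) < 0.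
  rewrite ltNge; apply/negP => h.
  have na : phi t0 (q0 - e) != 0.
    by apply/eqP; rewrite -(P0 t0) => /inj /eqP; rewrite -subr_eq0 addrAC subrr sub0r
      oppr_eq0 gt_eqF.
  have nb : phi t0 (q0 + e) != 0.
    by apply/eqP; rewrite -(P0 t0) => /inj /eqP; rewrite -subr_eq0 addrAC subrr add0r gt_eqF.
  pose sg := Num.sg (phi t0 (q0 - e)).
  pose psi q := sg * phi t0 q.
  have cpsi : continuous psi by rewrite /psi; have := cq t0 => c; cont_tac.
  have p0 : psi q0 = 0 by rewrite /psi P0 mulr0.
  have pa : psi (q0 - e) = `|phi t0 (q0 - e)| by rewrite /psi normrEsg.
  have pb : 0 < psi (q0 + e).
    rewrite /psi /sg; move: h; rewrite le_eqVlt => /predU1P[/esym/eqP|].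
      by rewrite mulf_eq0 (negbTE na) (negbTE nb).
    case: (ltgtP (phi t0 (q0 - e)) 0) => [hn|hp|h0].
    - by rewrite (nmulr_rgt0 _ hn) (ltr0_sg hn) mulN1r oppr_gt0.
    - by rewrite (pmulr_rgt0 _ hp) (gtr0_sg hp) mul1r.
    - by rewrite h0 eqxx in na.
  have pa0 : 0 < psi (q0 - e) by rewrite pa normr_gt0.
  (* With equal signs at both ends, the value [v] would be taken on either side of [q0], against
     injectivity. *)
  pose v := Num.min (psi (q0 - e)) (psi (q0 + e)) / 2.
  have v0 : 0 < v by rewrite divr_gt0 // lt_min pa0 pb.
  have va : v <= psi (q0 - e).
    rewrite /v ler_pdivrMr // (le_trans (_ : _ <= psi (q0 - e))) ?ge_min ?lexx //.
    by rewrite ler_peMr // ?ltW //; lra.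
  have vb : v <= psi (q0 + e).
    rewrite /v ler_pdivrMr // (le_trans (_ : _ <= psi (q0 + e))) ?ge_min ?lexx ?orbT //.
    by rewrite ler_peMr // ?ltW //; lra.
  have [] := @IVT R psi (q0 - e) q0 v.
  - by rewrite gerBl ltW.
  - exact: continuous_subspaceT.
  - by rewrite p0 (min_idPr (ltW pa0)) (max_idPl (ltW pa0)) va ltW.
  move=> c1; rewrite in_itv /= => /andP[c1a c1b] e1.
  have [] := @IVT R psi q0 (q0 + e) v.
  - by rewrite lerDl ltW.
  - exact: continuous_subspaceT.
  - by rewrite p0 (min_idPl (ltW pb)) (max_idPr (ltW pb)) vb ltW.
  move=> c2; rewrite in_itv /= => /andP[c2a c2b] e2.
  have sg0 : sg != 0 by rewrite sgr_eq0.
  have c12 : c1 = c2.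
    by apply: (inj t0); apply: (mulfI sg0); rewrite -/(psi c1) -/(psi c2) e1 e2.
  have c1q : c1 = q0 by apply/eqP; rewrite eq_le c1b /= c12 c2a.
  by move: v0; rewrite -e1 c1q p0 ltxx.
have cprod : continuous (fun t => phi t (q0 - e) * phi t (q0 + e)).
  by apply: contM; exact: cphi.
have := cprod t0 => /cvgrPdist_lt.
move=> /(_ (- (phi t0 (q0 - e) * phi t0 (q0 + e)))).
rewrite oppr_gt0 => /(_ neg); apply: filterS => t ht.
have pneg : phi t (q0 - e) * phi t (q0 + e) < 0.
  by move: ht; rewrite ltr_norml => /andP[h _]; move: h; lra.
have [] := @IVT R (phi t) (q0 - e) (q0 + e) 0.
- by move: e0; lra.
- exact: continuous_subspaceT (cq t).
- rewrite ge_min le_max; move: pneg.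
  case: (ltgtP (phi t (q0 - e)) 0) => [hn|hp|->].
  + by rewrite (nmulr_rlt0 _ hn) => /ltW ->; rewrite orbT.
  + by rewrite (pmulr_rlt0 _ hp) => /ltW ->; rewrite orbT.
  + by rewrite mul0r ltxx.
move=> c; rewrite in_itv /= => hcI hc.
have -> : Phi t = c by apply: (inj t); rewrite P0 hc.
by rewrite ler_distlC.
Qed.

End RightHandSide.

(** * Implicit differentiation of the solved equation *)

Section SolvedEquation.
Context {R : realType}.
Implicit Types f g : R -> R -> R -> R -> R -> R.

Lemma der_div (a b : R -> R) x (da db : R) : b x != 0 ->
  der a x da -> der b x db ->
  der (fun y => a y / b y) x ((da * b x - a x * db) / (b x * b x)).
Proof.
move=> b0 ha hb; apply: der_to.
  apply: der_mul; [exact: ha | exact: (is_deriveV b0 hb)].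
by rewrite /= /GRing.scale /=; field.
Qed.

Lemma class_C1_der g x u p q r : class_C1 g -> 0 <= x <= 1 ->
  [/\ der (fun s => g x s p q r) u (partial_u g x u p q r),
      der (fun s => g x u s q r) p (partial_p g x u p q r),
      der (fun s => g x u p s r) q (partial_q g x u p q r)
    & der (fun s => g x u p q s) r (partial_r g x u p q r)].
Proof.
move=> [_ _ h _] x01; have [h1 h2 h3 h4] := h x u p q r x01.
split; [exact: (derivable_der _ _ h1)|exact: (derivable_der _ _ h2)
  |exact: (derivable_der _ _ h3)|exact: (derivable_der _ _ h4)].
Qed.

Lemma class_C1_cont g : class_C1 g -> [/\ continuous_args g,
  continuous_args (partial_u g), continuous_args (partial_p g),
  continuous_args (partial_q g) & continuous_args (partial_r g)].
Proof. by move=> [? _ _ []]. Qed.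

Section Solve.
Variable f : R -> R -> R -> R -> R -> R.
Hypotheses (f_C1 : class_C1 f) (fp_C1 : class_C1_at_r0 (partial_p f))
  (fq_C1 : class_C1_at_r0 (partial_q f)) (f_parabolic : parabolic f)
  (f_F0 : F0_well_defined f).

Lemma partial_q_neq0 x u p q r : 0 <= x <= 1 -> partial_q f x u p q r != 0.
Proof.
by move=> x01; have := f_parabolic x u p q r x01; apply: contraTneq => ->; rewrite mul0r ltxx.
Qed.

Lemma partial_r_neq0 x u p q r : 0 <= x <= 1 -> partial_r f x u p q r != 0.
Proof.
by move=> x01; have := f_parabolic x u p q r x01; apply: contraTneq => ->; rewrite mulr0 ltxx.
Qed.

(* Applied on the segment from [(q0, 0)] to [(q, r)], Rolle's theorem gives
   f_q (q - q0) + f_r r = 0 at an intermediate point, where f_q f_r < 0. *)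
Lemma parabolic_sign x u p q q0 r : 0 <= x <= 1 -> f x u p q r = 0 ->
  f x u p q0 0 = 0 -> r != 0 -> 0 < (q - q0) * r.
Proof.
move=> x01 fqr fq0 r0.
have [_ _ _ cfq cfr] := class_C1_cont _ f_C1.
have d1 y z : der (fun s => f x u p s z) y (partial_q f x u p y z).
  by have [] := class_C1_der f x u p y z f_C1 x01.
have d2 y z : der (fun s => f x u p y s) z (partial_r f x u p y z).
  by have [] := class_C1_der f x u p y z f_C1 x01.
have c1 : cont2 (partial_q f x u p) by rewrite /cont2; apply: cont_args => //; cont_tac.
have c2 : cont2 (partial_r f x u p) by rewrite /cont2; apply: cont_args => //; cont_tac.
have dl (a b t : R) : der (fun s => a + s * b) t b.
  apply: der_to; first by apply: der_add; [exact: der_const|apply: der_mul;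
    [exact: der_var|exact: der_const]].
  by rewrite /=; ring.
have [t] := MVT_line _ _ 0 1 (fun t => der_chain2 (f x u p) _ _ (fun s => q0 + s * (q - q0))
  (fun s => 0 + s * r) t _ _ c1 c2 d1 d2 (dl q0 (q - q0) t) (dl 0 r t)).
rewrite !mul0r !mul1r !addr0 !add0r subr0 mulr1 [q0 + _]addrC subrK fqr fq0 subrr.
set fq := partial_q _ _ _ _ _ _; set fr := partial_r _ _ _ _ _ _ => e _.
have s : fq * fr < 0 by exact: f_parabolic.
have e' : fq * (q - q0) = - (fr * r) by lra.
have fq2 : 0 < fq ^+ 2 by rewrite exprn_even_gt0 //= partial_q_neq0.
rewrite -(pmulr_rgt0 _ fq2).
have -> : fq ^+ 2 * ((q - q0) * r) = (fq * (q - q0)) * (fq * r) by ring.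
have -> : (fq * (q - q0)) * (fq * r) = - (fq * fr) * r ^+ 2 by rewrite e'; ring.
by rewrite mulr_gt0 ?oppr_gt0 // exprn_even_gt0.
Qed.

Lemma F0_unique x u p q q' : 0 <= x <= 1 -> f x u p q 0 = 0 ->
  f x u p q' 0 = 0 -> q = q'.
Proof.
move=> x01 e e'; have [_ _ _ cfq cfr] := class_C1_cont _ f_C1.
have d1 y : der (fun s => f x u p s 0) y (partial_q f x u p y 0).
  by have [] := class_C1_der f x u p y 0 f_C1 x01.
have [z] := MVT_line _ _ q' q d1.
rewrite e e' subrr => /esym/eqP; rewrite mulf_eq0 (negbTE (partial_q_neq0 _ _ _ _ _ x01)).
by rewrite /= subr_eq0 => /eqP.
Qed.

(** Implicit differentiation at r = 0 gives F_u = - f_u / f_q and F_p = - f_p / f_q; the latter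
    quotient has continuous derivatives in u and p because f_p and f_q are of class C^1 there. The
    last two conjuncts keep the relations for use in the linearization. *)
Lemma rhs_exists : exists F Fu Fp Fpu Fpp, [/\ rhs F Fu Fp Fpu Fpp,
  (forall x u p, 0 <= x <= 1 -> f x u p (F x u p) 0 = 0),
  (forall x u p, 0 <= x <= 1 -> partial_q f x u p (F x u p) 0 * Fu x u p =
     - partial_u f x u p (F x u p) 0) &
  (forall x u p, 0 <= x <= 1 -> partial_q f x u p (F x u p) 0 * Fp x u p =
     - partial_p f x u p (F x u p) 0)].
Proof.
have [cf cfu cfp cfq _] := class_C1_cont _ f_C1.
have [_ cfpu cfpp cfpq _] := class_C1_cont _ fp_C1.
have [_ cfqu cfqp cfqq _] := class_C1_cont _ fq_C1.
have X01 (y : R) := clamp01_itv y.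
have /choice[F1 hF1] : forall z : R * R * R, exists q, f (clamp01 z.1.1) z.1.2 z.2 q 0 = 0.
  by move=> z; exact: (f_F0 _ _ _ (clamp01_itv _)).
pose X := @clamp01 R.
have cX : continuous X by exact: cont_clamp01.
pose F x u p := F1 (x, u, p).
have hF x u p : f (X x) u p (F x u p) 0 = 0 by exact: (hF1 (x, u, p)).
have cF : cont3 F.
  apply: (implicit_continuous (fun (z : R * R * R) q => f (X z.1.1) z.1.2 z.2 q 0)
    (fun z q => partial_q f (X z.1.1) z.1.2 z.2 q 0)).
  - by move=> q; apply: cont_args => //; cont_tac.
  - by move=> z q; have [] := class_C1_der f (X z.1.1) z.1.2 z.2 q 0 f_C1 (X01 _).
  - by move=> z q; apply: partial_q_neq0; exact: X01.
  - by move=> z; exact: hF.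
pose fu x u p q := partial_u f (X x) u p q 0.
pose fp x u p q := partial_p f (X x) u p q 0.
pose fq x u p q := partial_q f (X x) u p q 0.
have fq0 x u p q : fq x u p q != 0 by apply: partial_q_neq0; exact: X01.
pose Fu x u p := - fu x u p (F x u p) / fq x u p (F x u p).
pose Fp x u p := - fp x u p (F x u p) / fq x u p (F x u p).
(* These are derivatives of the restrictions of f_p and f_q to r = 0, whence the dummy last
   argument. *)
pose fpu x u p q := partial_u (fun x u p q _ => partial_p f x u p q 0) (X x) u p q 0.
pose fpp x u p q := partial_p (fun x u p q _ => partial_p f x u p q 0) (X x) u p q 0.
pose fpq x u p q := partial_q (fun x u p q _ => partial_p f x u p q 0) (X x) u p q 0.
pose fqu x u p q := partial_u (fun x u p q _ => partial_q f x u p q 0) (X x) u p q 0.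
pose fqp x u p q := partial_p (fun x u p q _ => partial_q f x u p q 0) (X x) u p q 0.
pose fqq x u p q := partial_q (fun x u p q _ => partial_q f x u p q 0) (X x) u p q 0.
pose quot a da b db : R := - (da * b - a * db) / (b * b).
pose Fpu x u p := let q := F x u p in
  quot (fp x u p q) (fpu x u p q + fpq x u p q * Fu x u p)
       (fq x u p q) (fqu x u p q + fqq x u p q * Fu x u p).
pose Fpp x u p := let q := F x u p in
  quot (fp x u p q) (fpp x u p q + fpq x u p q * Fp x u p)
       (fq x u p q) (fqp x u p q + fqq x u p q * Fp x u p).
have c4 (T : topologicalType) g (a b c d : T -> R) : continuous_args g ->
    continuous a -> continuous b -> continuous c -> continuous d ->
    continuous (fun z => g (X (a z)) (b z) (c z) (d z) 0).
  by move=> cg ca cb cc cd; apply: cont_args => //; cont_tac.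
have cc (T : topologicalType) g (a b c : T -> R) : continuous_args g ->
    continuous a -> continuous b -> continuous c ->
    continuous (fun z => g (X (a z)) (b z) (c z) (F (a z) (b z) (c z)) 0).
  by move=> cg ca cb cc; apply: c4 => //; cont_tac.
have cc3 g : continuous_args g -> cont3 (fun x u p => g (X x) u p (F x u p) 0).
  by move=> cg; apply: cc => //; cont_tac.
have c3M (a b : R -> R -> R -> R) : cont3 a -> cont3 b ->
    cont3 (fun x u p => a x u p * b x u p) by move=> ca cb; rewrite /cont3; cont_tac.
have c3D (a b : R -> R -> R -> R) : cont3 a -> cont3 b ->
    cont3 (fun x u p => a x u p + b x u p) by move=> ca cb; rewrite /cont3; cont_tac.
have c3N (a : R -> R -> R -> R) : cont3 a -> cont3 (fun x u p => - a x u p).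
  by move=> ca; rewrite /cont3; cont_tac.
have cquot a da b db : cont3 a -> cont3 da -> cont3 b -> cont3 db ->
    (forall x u p, b x u p != 0) ->
    cont3 (fun x u p => quot (a x u p) (da x u p) (b x u p) (db x u p)).
  move=> ca cda cb cdb b0; rewrite /quot; apply: c3M.
    by rewrite /cont3; cont_tac.
  by apply: contV => [|z]; [rewrite /cont3; cont_tac|rewrite mulf_neq0].
have fq0' x u p : fq x u p (F x u p) != 0 by exact: fq0.
have cfu3 : cont3 (fun x u p => fu x u p (F x u p)) := cc3 _ cfu.
have cfp3 : cont3 (fun x u p => fp x u p (F x u p)) := cc3 _ cfp.
have cfq3 : cont3 (fun x u p => fq x u p (F x u p)) := cc3 _ cfq.
have cfpu3 : cont3 (fun x u p => fpu x u p (F x u p)) := cc3 _ cfpu.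
have cfpp3 : cont3 (fun x u p => fpp x u p (F x u p)) := cc3 _ cfpp.
have cfpq3 : cont3 (fun x u p => fpq x u p (F x u p)) := cc3 _ cfpq.
have cfqu3 : cont3 (fun x u p => fqu x u p (F x u p)) := cc3 _ cfqu.
have cfqp3 : cont3 (fun x u p => fqp x u p (F x u p)) := cc3 _ cfqp.
have cfqq3 : cont3 (fun x u p => fqq x u p (F x u p)) := cc3 _ cfqq.
have cinv : cont3 (fun x u p => (fq x u p (F x u p))^-1).
  by apply: (contV _ cfq3) => z; exact: fq0'.
have cFu : cont3 Fu := c3M _ _ (c3N _ cfu3) cinv.
have cFp : cont3 Fp := c3M _ _ (c3N _ cfp3) cinv.
have cFpu : cont3 Fpu := cquot _ _ _ _ cfp3 (c3D _ _ cfpu3 (c3M _ _ cfpq3 cFu))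
  cfq3 (c3D _ _ cfqu3 (c3M _ _ cfqq3 cFu)) fq0'.
have cFpp : cont3 Fpp := cquot _ _ _ _ cfp3 (c3D _ _ cfpp3 (c3M _ _ cfpq3 cFp))
  cfq3 (c3D _ _ cfqp3 (c3M _ _ cfqq3 cFp)) fq0'.
have dfp x u p q : [/\ der (fun s => fp x s p q) u (fpu x u p q),
    der (fun s => fp x u s q) p (fpp x u p q) & der (fun s => fp x u p s) q (fpq x u p q)].
  by have [h1 h2 h3 _] := class_C1_der _ (X x) u p q 0 fp_C1 (X01 x);
    split; [exact: h1|exact: h2|exact: h3].
have dfq x u p q : [/\ der (fun s => fq x s p q) u (fqu x u p q),
    der (fun s => fq x u s q) p (fqp x u p q) & der (fun s => fq x u p s) q (fqq x u p q)].
  by have [h1 h2 h3 _] := class_C1_der _ (X x) u p q 0 fq_C1 (X01 x);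
    split; [exact: h1|exact: h2|exact: h3].
have D g (hg : class_C1 g) x := fun u p q r => class_C1_der g (X x) u p q r hg (X01 x).
have dFu x u p : der (fun s => F x s p) u (Fu x u p).
  apply: (der_implicit (fun s q => f (X x) s p q 0) (fun s q => fu x s p q)
    (fun s q => fq x s p q)).
  - by apply: (c4 _ _ (fun=> x)) => //; cont_tac.
  - by apply: (c4 _ _ (fun=> x)) => //; cont_tac.
  - by move=> s q; have [h _ _ _] := D f f_C1 x s p q 0; exact: h.
  - by move=> s q; have [_ _ h _] := D f f_C1 x s p q 0; exact: h.
  - by have h : continuous (fun s => F x s p); [cont_tac | exact: (h u)].
  - by move=> s; exact: hF.
  - exact: fq0.
have dFp x u p : der (fun s => F x u s) p (Fp x u p).
  apply: (der_implicit (fun s q => f (X x) u s q 0) (fun s q => fp x u s q)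
    (fun s q => fq x u s q)).
  - by apply: (c4 _ _ (fun=> x)) => //; cont_tac.
  - by apply: (c4 _ _ (fun=> x)) => //; cont_tac.
  - by move=> s q; have [_ h _ _] := D f f_C1 x u s q 0; exact: h.
  - by move=> s q; have [_ _ h _] := D f f_C1 x u s q 0; exact: h.
  - by have h : continuous (fun s => F x u s); [cont_tac | exact: (h p)].
  - by move=> s; exact: hF.
  - exact: fq0.
have neg (a b : R -> R) y da db : b y != 0 -> der a y da -> der b y db ->
    der (fun s => - a s / b s) y (quot (a y) da (b y) db).
  move=> b0 ha hb; apply: der_to; first exact: (der_div _ _ _ _ _ b0 (der_opp _ _ _ ha) hb).
  by rewrite /quot; congr (_ / _); ring.
have dFpu x u p : der (fun s => Fp x s p) u (Fpu x u p).
  apply: neg; first exact: fq0.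
  - apply: der_to; first apply: (der_chain2 (fun s q => fp x s p q) (fun s q => fpu x s p q)
      (fun s q => fpq x s p q)).
    + by apply: (c4 _ _ (fun=> x)) => //; cont_tac.
    + by apply: (c4 _ _ (fun=> x)) => //; cont_tac.
    + by move=> s q; have [h _ _] := dfp x s p q; exact: h.
    + by move=> s q; have [_ _ h] := dfp x s p q; exact: h.
    + exact: der_var.
    + exact: dFu.
    exact: (congr1 (fun z => z + _) (mulr1 _)).
  - apply: der_to; first apply: (der_chain2 (fun s q => fq x s p q) (fun s q => fqu x s p q)
      (fun s q => fqq x s p q)).
    + by apply: (c4 _ _ (fun=> x)) => //; cont_tac.
    + by apply: (c4 _ _ (fun=> x)) => //; cont_tac.
    + by move=> s q; have [h _ _] := dfq x s p q; exact: h.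
    + by move=> s q; have [_ _ h] := dfq x s p q; exact: h.
    + exact: der_var.
    + exact: dFu.
    exact: (congr1 (fun z => z + _) (mulr1 _)).
have dFpp x u p : der (fun s => Fp x u s) p (Fpp x u p).
  apply: neg; first exact: fq0.
  - apply: der_to; first apply: (der_chain2 (fun s q => fp x u s q) (fun s q => fpp x u s q)
      (fun s q => fpq x u s q)).
    + by apply: (c4 _ _ (fun=> x)) => //; cont_tac.
    + by apply: (c4 _ _ (fun=> x)) => //; cont_tac.
    + by move=> s q; have [_ h _] := dfp x u s q; exact: h.
    + by move=> s q; have [_ _ h] := dfp x u s q; exact: h.
    + exact: der_var.
    + exact: dFp.
    exact: (congr1 (fun z => z + _) (mulr1 _)).
  - apply: der_to; first apply: (der_chain2 (fun s q => fq x u s q) (fun s q => fqp x u s q)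
      (fun s q => fqq x u s q)).
    + by apply: (c4 _ _ (fun=> x)) => //; cont_tac.
    + by apply: (c4 _ _ (fun=> x)) => //; cont_tac.
    + by move=> s q; have [_ h _] := dfq x u s q; exact: h.
    + by move=> s q; have [_ _ h] := dfq x u s q; exact: h.
    + exact: der_var.
    + exact: dFp.
    exact: (congr1 (fun z => z + _) (mulr1 _)).
have XX x : X (X x) = X x by rewrite /X clamp01_id // X01.
(* The root was chosen separately at every x; its uniqueness makes the choices at [x] and [X x]
   agree. *)
have FX x u p : F (X x) u p = F x u p.
  have h := hF (X x) u p; rewrite XX in h.
  exact: (F0_unique (X x) u p _ _ (X01 x) h (hF x u p)).
have e1 x u p q : fu (X x) u p q = fu x u p q
  := congr1 (fun y => partial_u f y u p q 0) (XX x).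
have e2 x u p q : fp (X x) u p q = fp x u p q
  := congr1 (fun y => partial_p f y u p q 0) (XX x).
have e3 x u p q : fq (X x) u p q = fq x u p q
  := congr1 (fun y => partial_q f y u p q 0) (XX x).
have e4 x u p q : fpu (X x) u p q = fpu x u p q
  := congr1 (fun y => partial_u (fun x u p q _ => partial_p f x u p q 0) y u p q 0) (XX x).
have e5 x u p q : fpp (X x) u p q = fpp x u p q
  := congr1 (fun y => partial_p (fun x u p q _ => partial_p f x u p q 0) y u p q 0) (XX x).
have e6 x u p q : fpq (X x) u p q = fpq x u p q
  := congr1 (fun y => partial_q (fun x u p q _ => partial_p f x u p q 0) y u p q 0) (XX x).
have e7 x u p q : fqu (X x) u p q = fqu x u p q
  := congr1 (fun y => partial_u (fun x u p q _ => partial_q f x u p q 0) y u p q 0) (XX x).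
have e8 x u p q : fqp (X x) u p q = fqp x u p q
  := congr1 (fun y => partial_p (fun x u p q _ => partial_q f x u p q 0) y u p q 0) (XX x).
have e9 x u p q : fqq (X x) u p q = fqq x u p q
  := congr1 (fun y => partial_q (fun x u p q _ => partial_q f x u p q 0) y u p q 0) (XX x).
have eFu x u p : Fu (X x) u p = Fu x u p by rewrite /Fu FX e1 e3.
have eFp x u p : Fp (X x) u p = Fp x u p by rewrite /Fp FX e2 e3.
have eFpu x u p : Fpu (X x) u p = Fpu x u p.
  by rewrite /Fpu FX e2 e4 e6 e3 e7 e9 eFu.
have eFpp x u p : Fpp (X x) u p = Fpp x u p.
  by rewrite /Fpp FX e2 e5 e6 e3 e8 e9 eFp.
exists F, Fu, Fp, Fpu, Fpp; split.
- split; [exact: cF|exact: cFu|exact: cFp|exact: cFpu|exact: cFpp|exact: dFu|exact: dFp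
    |exact: dFpu|exact: dFpp|].
  by move=> x u p; split; [rewrite -(eFu x)|rewrite -(eFp x)|rewrite -(eFpu x)|rewrite -(eFpp x)].
- by move=> x u p x01; have h := hF x u p; rewrite /X clamp01_id in h.
- move=> x u p x01.
  have h : fq x u p (F x u p) * Fu x u p = - fu x u p (F x u p).
    by rewrite /Fu mulrC divfK.
  by rewrite /fq /fu /X clamp01_id in h.
- move=> x u p x01.
  have h : fq x u p (F x u p) * Fp x u p = - fp x u p (F x u p).
    by rewrite /Fp mulrC divfK.
  by rewrite /fq /fp /X clamp01_id in h.
Qed.

End Solve.
End SolvedEquation.

(** * Energies and their dissipation *)

Section Energy.
Context {R : realType}.
Implicit Types (u p : R -> R) (bc : boundary_condition R).

Definition bc_continuous bc : Prop := if bc is Robin b then continuous b else True.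

Definition bc_bounded_by bc (M Mb : R) : Prop :=
  if bc is Robin b then forall y : R, `|y| <= M -> `|b y| <= Mb else True.

(* Chosen so that the boundary terms left by the integration by parts in the
   time derivative of the energy vanish to first order. *)
Definition bc_potential bc (kap : R -> R -> R) (v : R) : R :=
  if bc is Robin b then prim (fun y => kap y (b y)) v else 0.

Definition node (N k : nat) : R := k%:R / N%:R.

Lemma node_in01 N k x : (k < N)%N -> node N k <= x <= node N k.+1 -> 0 <= x <= 1.
Proof.
move=> kN; have N0 : 0 < N%:R :> R by rewrite ltr0n (leq_ltn_trans _ kN).
move=> /andP[h1 h2]; rewrite (le_trans _ h1) ?divr_ge0 //= (le_trans h2) //.
by rewrite /node ler_pdivrMr // mul1r ler_nat.
Qed.

Lemma node_le N k : node N k <= node N k.+1.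
Proof. by rewrite /node ler_wpM2r ?invr_ge0 // ler_nat. Qed.

Lemma node0 N : node N 0 = 0. Proof. by rewrite /node mul0r. Qed.

Lemma nodeN N : (0 < N)%N -> node N N = 1.
Proof. by move=> N0; rewrite /node divff // pnatr_eq0 -lt0n. Qed.

Definition profile (M : R) u p : Prop := [/\ continuous (fun x => u (clamp01 x)),
  continuous (fun x => p (clamp01 x)) &
  forall x, 0 <= x <= 1 -> `|u x| <= M /\ `|p x| <= M].

Section Functional.
Variables (bc0 bc1 : boundary_condition R) (N : nat).
Variables (L K : nat -> R -> R -> R -> R).

Definition density_along k u p y := L k (clamp01 y) (u (clamp01 y)) (p (clamp01 y)).

(** The Lagrangian changes from strip to strip, hence the sum. The potentials carry the signs
    opposite to those of K u_t at 0 and 1 after integration by parts; at x = 1 the strip in force is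
    the last one, of index [N.-1]. *)
Definition energy u p : R :=
  \sum_(k < N) (prim (density_along k u p) (node N k.+1)
                 - prim (density_along k u p) (node N k))
  + bc_potential bc0 (K 0%N 0) (u 0) - bc_potential bc1 (K N.-1 1) (u 1).

Variables (Lu Kx Ku g : nat -> R -> R -> R -> R) (F : R -> R -> R -> R).
Variables (M c C e : R).
Hypotheses (N0 : (0 < N)%N) (c0 : 0 < c) (M0 : 0 <= M).
Hypotheses (cbc0 : bc_continuous bc0) (cbc1 : bc_continuous bc1).
Hypothesis hL : forall k, (k < N)%N ->
  lagrangian_strip F M c C e (node N k) (node N k.+1)
    (L k) (Lu k) (K k) (Kx k) (Ku k) (g k).

Lemma strip_C0 : 0 <= C.
Proof.
have h := hL 0%N N0; have i : node N 0 <= 0 <= node N 1.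
  by rewrite node0 lexx /node divr_ge0.
have := ls_gc _ _ _ _ _ _ _ _ _ _ _ _ _ h 0 0 0 i.
have := ls_gC _ _ _ _ _ _ _ _ _ _ _ _ _ h 0 0 0 i.
by move=> h1 h2; rewrite (le_trans (ltW c0)) // (le_trans h2).
Qed.

Lemma density_cont k u p : (k < N)%N -> profile M u p -> continuous (density_along k u p).
Proof.
move=> kN [cu cp _]; have cL := ls_cL _ _ _ _ _ _ _ _ _ _ _ _ _ (hL k kN).
have cc := @cont_clamp01 R.
exact: (cont3_comp (L k) clamp01 (fun x => u (clamp01 x)) (fun x => p (clamp01 x))
  cL cc cu cp).
Qed.

Lemma convex_itv (a b s : R) : `|a| <= M -> `|b| <= M ->
  Num.min a b <= s <= Num.max a b -> `|s| <= M.
Proof.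
rewrite !ler_norml => /andP[? ?] /andP[? ?].
by case: (leP a b) => _ /andP[? ?]; apply/andP; split; lra.
Qed.

Lemma kap_cont k bc x : (k < N)%N -> bc_continuous bc ->
  if bc is Robin b then continuous (fun y => K k x y (b y)) else True.
Proof.
move=> kN; case: bc => //= b cb; have cK := ls_cK _ _ _ _ _ _ _ _ _ _ _ _ _ (hL k kN).
cont_tac.
Qed.

Lemma potential_lip bc x k v w eta : (k < N)%N -> bc_continuous bc ->
  node N k <= x <= node N k.+1 -> forall Mb,
  bc_bounded_by bc M Mb -> 0 <= Mb ->
  `|v| <= M -> `|w| <= M -> `|v - w| <= eta ->
  `|bc_potential bc (K k x) v - bc_potential bc (K k x) w| <= C * Mb * eta.
Proof.
move=> kN cb xk Mb hMb Mb0 vM wM vw.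
have C0 := strip_C0; have eta0 : 0 <= eta by exact: le_trans vw.
case: bc cb hMb (kap_cont k bc x kN) => [|b] /= cb hMb hc.
  by rewrite subrr normr0 !mulr_ge0.
apply: (@le_trans _ _ (C * Mb * `|v - w|)); last by rewrite ler_wpM2l ?mulr_ge0.
apply: prim_bound; first exact: hc.
move=> s hs; have sM : `|s| <= M by exact: convex_itv hs.
apply: (le_trans (ls_KC _ _ _ _ _ _ _ _ _ _ _ _ _ (hL k kN) x s (b s) xk)).
by rewrite ler_wpM2l // hMb.
Qed.

Lemma sum_nodes (a : R) : \sum_(k < N) a * (node N k.+1 - node N k) = a.
Proof.
rewrite -mulr_sumr -(big_mkord xpredT (fun k => node N k.+1 - node N k)).
by rewrite telescope_sumr // nodeN // node0 subr0 mulr1.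
Qed.

(** The constant involves neither the mesh nor the error [e], so the estimate will pass to the
    limit: C bounds L_u, C M bounds K = L_p, and each boundary potential contributes C Mb. *)
Lemma energy_lip u p u' p' eta Mb : profile M u p -> profile M u' p' ->
  bc_bounded_by bc0 M Mb ->
  bc_bounded_by bc1 M Mb -> 0 <= Mb ->
  (forall x, 0 <= x <= 1 -> `|u x - u' x| <= eta /\ `|p x - p' x| <= eta) ->
  `|energy u p - energy u' p'| <= C * (1 + M + 2 * Mb) * eta.
Proof.
move=> pu pu' hb0 hb1 Mb0 heta.
have C0 := strip_C0.
have N1 : (N.-1 < N)%N by rewrite prednK.
have i01 : 0 <= (0 : R) <= 1 by rewrite lexx ler01.
have i11 : 0 <= (1 : R) <= 1 by rewrite lexx ler01.
have x0 : node N 0 <= 0 <= node N 1 by rewrite node0 lexx /node divr_ge0.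
have x1 : node N N.-1 <= 1 <= node N N.-1.+1.
  by have := node_le N N.-1; rewrite prednK // nodeN // => ->; rewrite lexx.
have [_ _ b1] := pu; have [_ _ b2] := pu'.
have e0 := potential_lip bc0 0 0%N (u 0) (u' 0) eta N0 cbc0 x0 Mb hb0 Mb0
  (b1 _ i01).1 (b2 _ i01).1 (heta _ i01).1.
have e1 := potential_lip bc1 1 N.-1 (u 1) (u' 1) eta N1 cbc1 x1 Mb hb1 Mb0
  (b1 _ i11).1 (b2 _ i11).1 (heta _ i11).1.
pose S u p := \sum_(k < N) (prim (density_along k u p) (node N k.+1)
                 - prim (density_along k u p) (node N k)).
have eS : `|S u p - S u' p'| <= C * (1 + M) * eta.
  rewrite /S -sumrB -(sum_nodes (C * (1 + M) * eta)).
  rewrite (le_trans (ler_norm_sum _ _ _)) // ler_sum // => k _.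
  have kN := ltn_ord k.
  have cd := density_cont k u p kN pu; have cd' := density_cont k u' p' kN pu'.
  set f := density_along k u p; set f' := density_along k u' p'.
  have cff : continuous (fun y => f y - f' y) by apply: contB.
  have -> : prim f (node N k.+1) - prim f (node N k) -
    (prim f' (node N k.+1) - prim f' (node N k)) =
     prim (fun y => f y - f' y) (node N k.+1) - prim (fun y => f y - f' y) (node N k).
    by rewrite !primB //; ring.
  rewrite -(@ger0_norm _ (node N k.+1 - node N k)) ?subr_ge0 ?node_le //.
  apply: prim_bound => // s; rewrite (min_idPl (node_le _ _)) (max_idPr (node_le _ _)) => sk.
  have s01 := node_in01 _ _ _ kN sk; rewrite /f /f' /density_along clamp01_id //.
  have [us ps] := b1 _ s01; have [us' ps'] := b2 _ s01; have [eu ep] := heta _ s01.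
  have -> : L k s (u s) (p s) - L k s (u' s) (p' s) =
    (L k s (u s) (p s) - L k s (u' s) (p s)) + (L k s (u' s) (p s) - L k s (u' s) (p' s)) by ring.
  have -> : C * (1 + M) * eta = C * eta + C * M * eta by ring.
  rewrite (le_trans (ler_normD _ _)) // lerD //.
    apply: (@le_trans _ _ (C * `|u s - u' s|)); last by rewrite ler_wpM2l.
    apply: (MVT_bound (fun z => L k s z (p s)) (fun z => Lu k s z (p s))) => [z|z zI].
      exact: (ls_dLu _ _ _ _ _ _ _ _ _ _ _ _ _ (hL k kN) s z (p s)).
    apply: (ls_LuC _ _ _ _ _ _ _ _ _ _ _ _ _ (hL k kN)) => //.
    by rewrite minC maxC in zI; exact: convex_itv zI.
  apply: (@le_trans _ _ (C * M * `|p s - p' s|)); last by rewrite ler_wpM2l // mulr_ge0.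
  apply: (MVT_bound (L k s (u' s)) (K k s (u' s))) => [z|z zI].
    exact: (ls_dLp _ _ _ _ _ _ _ _ _ _ _ _ _ (hL k kN) s (u' s) z).
  apply: le_trans (ls_KC _ _ _ _ _ _ _ _ _ _ _ _ _ (hL k kN) _ _ _ sk) _.
  by rewrite ler_wpM2l //; rewrite minC maxC in zI; exact: convex_itv zI.
rewrite /energy -!/(S _ _).
have -> : S u p + bc_potential bc0 (K 0%N 0) (u 0) - bc_potential bc1 (K N.-1 1) (u 1)
  - (S u' p' + bc_potential bc0 (K 0%N 0) (u' 0) - bc_potential bc1 (K N.-1 1) (u' 1)) =
  (S u p - S u' p') + (bc_potential bc0 (K 0%N 0) (u 0) - bc_potential bc0 (K 0%N 0) (u' 0))
  - (bc_potential bc1 (K N.-1 1) (u 1) - bc_potential bc1 (K N.-1 1) (u' 1)) by ring.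
rewrite (le_trans (ler_normB _ _)) //.
apply: (@le_trans _ _ ((C * (1 + M) * eta + C * Mb * eta) + C * Mb * eta)).
  by rewrite lerD // (le_trans (ler_normD _ _)) // lerD.
by rewrite le_eqVlt; apply/orP; left; apply/eqP; ring.
Qed.

End Functional.
End Energy.

(** * Boundary-layer weights *)

Section Tools.
Context {R : realType}.

Lemma near_all_lt {T : Type} (FF : set_system T) (P : nat -> T -> Prop) (n : nat) :
  Filter FF -> (forall k, (k < n)%N -> \forall t \near FF, P k t) ->
  \forall t \near FF, forall k, (k < n)%N -> P k t.
Proof.
move=> fF; elim: n => [_|n IH h]; first by apply: filterE => t k; rewrite ltn0.
have h1 := IH (fun k kn => h k (ltnW kn)); have h2 := h n (ltnSn n).
apply: filterS2 h1 h2 => t a b k; rewrite ltnS leq_eqVlt => /predU1P[->//|].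
exact: a.
Qed.

(** A weight with integral 2 / (n + 1) over [0, 1] that is nevertheless at least 1/2 near both ends,
    where u_xx and u_t are bounded without being uniformly continuous. *)
Definition layer n (x : R) : R := x ^+ n + (1 - x) ^+ n.
Definition layer_prim n (x : R) : R := (x ^+ n.+1 - (1 - x) ^+ n.+1) / n.+1%:R.

Lemma der_exprn n (x : R) : der (fun y => y ^+ n.+1) x (n.+1%:R * x ^+ n).
Proof.
elim: n => [|n IH].
  by rewrite expr0 mulr1; apply: der_var.
have -> : (fun y : R => y ^+ n.+2) = (fun y => y * y ^+ n.+1).
  by apply/funext => y; rewrite exprS.
apply: der_to; first by apply: der_mul; [exact: der_var | exact: IH].
by rewrite -[n.+2%:R]natr1 /= exprS; ring.
Qed.

Lemma der_layer_prim n x : der (layer_prim n) x (layer n x).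
Proof.
have d1 : der (fun y => 1 - y) x (0 - 1).
  by apply: der_sub; [exact: der_const|exact: der_var].
apply: der_to.
  apply: der_mul; last exact: der_const.
  apply: der_sub; first exact: der_exprn.
  exact: (der_comp (fun y => y ^+ n.+1) (fun y => 1 - y) x _ _ (der_exprn n (1 - x)) d1).
have n0 : n.+1%:R != 0 :> R by rewrite pnatr_eq0.
by rewrite /layer mulr0 addr0 sub0r mulrN1 opprK -mulrDr mulrC mulrA mulVf // mul1r.
Qed.

Lemma layer_prim01 n : layer_prim n 1 - layer_prim n 0 = 2 / n.+1%:R.
Proof. by rewrite /layer_prim subrr subr0 !expr1n !expr0n /=; ring. Qed.

Lemma layer_ge0 n x : 0 <= x <= 1 -> 0 <= layer n x.
Proof. by move=> /andP[x0 x1]; rewrite addr_ge0 // exprn_ge0 // subr_ge0. Qed.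

Lemma layer_ge_half n : exists2 d, 0 < d < 1 / 2 & forall x, 0 <= x <= 1 ->
  x <= d \/ 1 - d <= x -> 1 / 2 <= layer n x.
Proof.
have n0 : 0 < n.+1%:R :> R by rewrite ltr0n.
have bern (d : R) m : 0 <= d <= 1 -> 1 - m%:R * d <= (1 - d) ^+ m.
  move=> /andP[d0 d1]; elim: m => [|m IH]; first by rewrite mul0r subr0 expr0.
  rewrite exprS -natr1; apply: (@le_trans _ _ ((1 - d) * (1 - m%:R * d))).
    have : 0 <= m%:R * d * d by rewrite !mulr_ge0.
    by lra.
  by rewrite ler_wpM2l // subr_ge0.
(* Bernoulli's inequality gives (1 - d)^n >= 1 - n d >= 1/2; with [n.+2] instead of n, [d] is
   defined and below 1/2 for all n. *)
pose d : R := 1 / 2 / n.+2%:R.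
have d0 : 0 < d by rewrite !divr_gt0.
have n2 : 1 < n.+2%:R :> R by rewrite ltr1n.
have dh : d < 1 / 2 by rewrite ltr_pdivrMr ?ltr0n //; lra.
exists d; first by rewrite d0 dh.
have hd : 1 / 2 <= (1 - d) ^+ n.
  apply: (@le_trans _ _ (1 - n%:R * d)); last by apply: bern; apply/andP; split; lra.
  have : n%:R * d <= n.+2%:R * d by rewrite ler_wpM2r ?(ltW d0) // ler_nat; exact: leqW (leqnSn n).
  rewrite [n.+2%:R * d]mulrC divfK ?pnatr_eq0 //; lra.
move=> x /andP[x0 x1] [xd|xd].
- apply: (le_trans hd); rewrite /layer -[leLHS]add0r lerD ?exprn_ge0 //.
  by rewrite lerXn2r ?nnegrE ?subr_ge0 //; lra.
- apply: (le_trans hd); rewrite /layer -[leLHS]addr0 lerD ?exprn_ge0 ?subr_ge0 //.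
  by rewrite lerXn2r ?nnegrE //; lra.
Qed.

End Tools.

(** * Energy increment on one strip *)

Section StripIncrement.
Context {R : realType}.

Definition prim_along (L : R -> R -> R -> R) (u p : R -> R) : R -> R :=
  prim (fun y => L (clamp01 y) (u (clamp01 y)) (p (clamp01 y))).

Variables (F : R -> R -> R -> R) (M c C e a b : R).
Variables (L Lu K Kx Ku g : R -> R -> R -> R).
Hypothesis hL : lagrangian_strip F M c C e a b L Lu K Kx Ku g.
Hypothesis c0 : 0 < c.

(* Only convexity of [L] in p is used here, so no mixed derivative u_xt is
   ever needed. *)
Lemma strip_pointwise x u u' p p' q' e1 e2 D : a <= x <= b ->
  `|u| <= M -> `|p'| <= M -> `|Ku x u p'| <= D ->
  (forall z, Num.min u u' <= z <= Num.max u u' -> `|Lu x z p' - Lu x u p'| <= e1) ->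
  `|p' - p| <= e2 ->
  L x u' p' - L x u p - ((Kx x u p' + Ku x u p' * p + g x u p' * q') * (u' - u)
     + K x u p' * (p' - p))
  <= - (g x u p' * ((q' - F x u p') * (u' - u))) + (e + e1 + D * e2) * `|u' - u|.
Proof.
move=> xab uM pM hD he1 he2.
have [z ez zI] := MVT_line _ _ p p' (ls_dLp _ _ _ _ _ _ _ _ _ _ _ _ _ hL x u).
have conv : K x u z * (p' - p) <= K x u p' * (p' - p).
  have [y ey _] := MVT_line _ _ z p' (ls_dKp _ _ _ _ _ _ _ _ _ _ _ _ _ hL x u).
  have g0 : 0 <= g x u y.
    exact: le_trans (ltW c0) (ls_gc _ _ _ _ _ _ _ _ _ _ _ _ _ hL x u y xab).
  rewrite -subr_ge0 -mulrBl ey -mulrA mulr_ge0 //.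
  by move: zI; case: (leP p p') => h /andP[h1 h2];
    [rewrite mulr_ge0 ?subr_ge0|rewrite mulr_le0 ?subr_le0 // ltW].
have [y ey yI] := MVT_line _ _ u u' (fun s => ls_dLu _ _ _ _ _ _ _ _ _ _ _ _ _ hL x s p').
have res := ls_res _ _ _ _ _ _ _ _ _ _ _ _ _ hL x u p' xab uM pM.
set X := Lu x u p' - _ - _ - _ in res.
have split1 : L x u' p' - L x u p = Lu x y p' * (u' - u) + K x u z * (p' - p).
  by rewrite -ey -ez; ring.
have E : Lu x y p' * (u' - u) + K x u p' * (p' - p) -
   ((Kx x u p' + Ku x u p' * p + g x u p' * q') * (u' - u) + K x u p' * (p' - p)) =
   - (g x u p' * ((q' - F x u p') * (u' - u))) +
   (X + (Lu x y p' - Lu x u p') + Ku x u p' * (p' - p)) * (u' - u).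
  by rewrite /X; ring.
rewrite split1; apply: (@le_trans _ _ (Lu x y p' * (u' - u) + K x u p' * (p' - p) -
   ((Kx x u p' + Ku x u p' * p + g x u p' * q') * (u' - u) + K x u p' * (p' - p)))).
  by rewrite lerD2r lerD2l.
rewrite E lerD2l (le_trans (ler_norm _)) // normrM ler_wpM2r //.
rewrite (le_trans (ler_normD _ _)) // lerD //.
  by rewrite (le_trans (ler_normD _ _)) // lerD // he1.
by rewrite normrM ler_pM.
Qed.

(** Integration by parts of K (P' - P), carried out by exhibiting a nonincreasing function [J]. As K
    is taken at the old u and the new slope, its total x-derivative involves [P] and [Q'] but no
    derivative of [P]. *)
Lemma strip_increment (U U' P P' Q' r : R -> R) : 0 <= a -> a <= b -> b <= 1 ->
  continuous (fun x => U (clamp01 x)) -> continuous (fun x => U' (clamp01 x)) ->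
  continuous (fun x => P (clamp01 x)) -> continuous (fun x => P' (clamp01 x)) ->
  continuous r ->
  (forall x, 0 < x < 1 -> [/\ der U x (P x), der U' x (P' x) & der P' x (Q' x)]) ->
  (forall x, a < x < b -> L x (U' x) (P' x) - L x (U x) (P x)
     - ((Kx x (U x) (P' x) + Ku x (U x) (P' x) * P x + g x (U x) (P' x) * Q' x) * (U' x - U x)
        + K x (U x) (P' x) * (P' x - P x)) <= r x) ->
  (prim_along L U' P' b - prim_along L U' P' a)
   - (prim_along L U P b - prim_along L U P a)
   - (K b (U b) (P' b) * (U' b - U b) - K a (U a) (P' a) * (U' a - U a))
  <= prim r b - prim r a.
Proof.
move=> a0 ab b1 cU cU' cP cP' cr dd hr.
have cL := ls_cL _ _ _ _ _ _ _ _ _ _ _ _ _ hL.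
have cK := ls_cK _ _ _ _ _ _ _ _ _ _ _ _ _ hL.
have cc := @cont_clamp01 R.
have near01 (x : R) : 0 < x < 1 -> \forall y \near x, clamp01 y = y.
  by move=> /near_in01; apply: filterS => y /itv01_open_closed/clamp01_id.
have clp (f : R -> R) df (x : R) : 0 < x < 1 -> der f x df -> der (fun y => f (clamp01 y)) x df.
  move=> x01; apply: der_ext; have := near01 x x01.
  by apply: filterS => y ->.
pose ell u p y := L (clamp01 y) (u (clamp01 y)) (p (clamp01 y)).
have cell : continuous (ell U P).
  exact: (cont3_comp L clamp01 (fun y => U (clamp01 y)) (fun y => P (clamp01 y)) cL).
have cell' : continuous (ell U' P').
  exact: (cont3_comp L clamp01 (fun y => U' (clamp01 y)) (fun y => P' (clamp01 y)) cL).
pose k x := K x (U (clamp01 x)) (P' (clamp01 x)).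
have ck : continuous k.
  exact: (cont3_comp K id (fun y => U (clamp01 y)) (fun y => P' (clamp01 y)) cK cont_id).
pose w x := U' (clamp01 x) - U (clamp01 x).
have cw : continuous w by exact: contB.
pose J x := prim (ell U' P') x - prim (ell U P) x - k x * w x - prim r x.
have cp h : continuous h -> continuous (prim h).
  by move=> ch; apply: derivative_continuous (der_prim _ ch).
have cJ : continuous J.
  by apply: contB; [apply: contB; [apply: contB; exact: cp | exact: contM] | exact: cp].
have : J b <= J a; last first.
  rewrite /J /k /w !clamp01_id ?a0 ?b1 ?andbT ?(le_trans a0) ?(le_trans ab) //.
  by rewrite /prim_along -!/(ell _ _); lra.
pose dJ x := ell U' P' x - ell U P x -
  ((Kx x (U x) (P' x) * 1 + Ku x (U x) (P' x) * P x + g x (U x) (P' x) * Q' x) * w x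
   + k x * (P' x - P x)) - r x.
have x01 (x : R) : a < x < b -> 0 < x < 1.
  by move=> /andP[ax xb]; rewrite (le_lt_trans a0 ax) (lt_le_trans xb b1).
apply: (MVT_nonincreasing J dJ) => //.
- move=> x /x01 xI; have [d1 d2 d3] := dd x xI.
  have cx : clamp01 x = x by rewrite clamp01_id // itv01_open_closed.
  apply: der_sub; last exact: der_prim.
  apply: der_sub; first by apply: der_sub; exact: der_prim.
  apply: der_mul; last by apply: der_sub; exact: clp.
  have := der_chain3 K Kx Ku g id (fun y => U (clamp01 y)) (fun y => P' (clamp01 y)) x
    1 (P x) (Q' x) (ls_cKx _ _ _ _ _ _ _ _ _ _ _ _ _ hL)
    (ls_cKu _ _ _ _ _ _ _ _ _ _ _ _ _ hL) (ls_cg _ _ _ _ _ _ _ _ _ _ _ _ _ hL)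
    (ls_dKx _ _ _ _ _ _ _ _ _ _ _ _ _ hL) (ls_dKu _ _ _ _ _ _ _ _ _ _ _ _ _ hL)
    (ls_dKp _ _ _ _ _ _ _ _ _ _ _ _ _ hL) (der_var x) (clp _ _ _ xI d1) (clp _ _ _ xI d3).
  by rewrite cx.
- exact: continuous_subspaceT.
- move=> x xab; have xI := x01 x xab.
  have cx : clamp01 x = x by rewrite clamp01_id // itv01_open_closed.
  have := hr x xab; rewrite /dJ /ell /w /k cx mulr1; lra.
Qed.
End StripIncrement.

(** * Linear inequalities of the dissipation estimate *)

Section Arithmetic.
Context {R : realType}.
Implicit Types A B C G Y c e h i r w x y z eps eta : R.

Lemma half_lt r : 0 < r -> r / 2 < r. Proof. by lra. Qed.

Lemma subr_swap x y z w : x - y = z - w -> x - z = y - w. Proof. by lra. Qed.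

Lemma arith_product w B DF : 0 < w ->
  (w + w) * B + (B + DF) * w <= w * (2 * B + (B + DF) + 1).
Proof. by lra. Qed.

Lemma arith_layer_mass A i eps : 0 <= i -> i * (2 * A + 1) <= eps -> A * (2 * i) <= eps.
Proof. by lra. Qed.

Lemma arith_interior G c x r y z eps : G * (x - r) <= G * y -> c * x <= G * x ->
  G * r <= eps -> 0 <= z -> - (G * y) <= - c * x + eps + z.
Proof. by rewrite mulrBr; lra. Qed.

Lemma arith_layer G C c Y x y z eps : 2 * (C + c) * Y * (1 / 2) <= z ->
  - (G * y) <= C * Y -> c * x <= c * Y -> 0 < eps ->
  - (G * y) <= - c * x + eps / 8 + z.
Proof. by lra. Qed.

Lemma arith_rest e eta B h eps : eta * B * h <= eps / 16 * h ->
  (e + eta + eta) * (B * h) <= h * (e * B + eps / 8).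
Proof. by lra. Qed.

Lemma arith_strip G c x y z h e B eps w : h * - (G * y) <= h * (- c * x + eps / 8 + z) ->
  w <= h * (e * B + eps / 8) ->
  - (G * (y * h)) + w <= h * (- c * x + (e * B + eps / 4) + z).
Proof. by lra. Qed.

Lemma arith_total c x e B eps h z : h * z <= h * (eps / 8) -> 0 < h * eps ->
  h * (- c * x + (e * B + eps / 4) + z) + 2 * (eps / 16 * h) <=
  (- c * x + e * B + eps) * h.
Proof. by lra. Qed.

End Arithmetic.

(** * Dissipation of the approximate energies *)

Section Dissipation.
Context {R : realType}.

(* [P], [Q], [D] stand for u_x, u_xx, u_t; nothing is assumed on u_xt. *)
Record orbit (F : R -> R -> R -> R) (M : R) (bc0 bc1 : boundary_condition R)
    (U P Q D : R -> R -> R) : Prop := Orbit {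
  orb_dx : forall t x, 0 < x < 1 -> der (U t) x (P t x);
  orb_dxx : forall t x, 0 < x < 1 -> der (P t) x (Q t x);
  orb_dt : forall t x, 0 < x < 1 -> der (fun s => U s x) t (D t x);
  orb_cQ : forall t x, 0 < x < 1 ->
    {for (t, x), continuous (fun z : R * R => Q z.1 z.2)};
  orb_cD : forall t x, 0 < x < 1 ->
    {for (t, x), continuous (fun z : R * R => D z.1 z.2)};
  orb_prof : forall t, profile M (U t) (P t);
  orb_near : forall t e, 0 < e -> \forall s \near t, forall x, 0 <= x <= 1 ->
    `|U s x - U t x| <= e /\ `|P s x - P t x| <= e;
  orb_bound : forall a b, exists2 B, 0 <= B & forall s x, a <= s <= b -> 0 < x < 1 ->
    `|Q s x| <= B /\ `|D s x| <= B;
  orb_bc : forall t, bc_holds bc0 (U t 0) (P t 0) /\ bc_holds bc1 (U t 1) (P t 1);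
  orb_sign : forall t x, 0 < x < 1 -> D t x != 0 ->
    0 < (Q t x - F x (U t x) (P t x)) * D t x }.

(** Under a Robin condition the potential has slope K(z, b z) at an intermediate point z, while the
    boundary term has coefficient K(u, b u'); both are close to K(u, b u). Under a Dirichlet
    condition u and u' are both 0. *)
Lemma boundary_increment (bc : boundary_condition R) (kap : R -> R -> R) u e :
  cont2 kap -> bc_continuous bc -> 0 < e -> exists2 r, 0 < r &
  forall p u' p', `|u' - u| < r -> bc_holds bc u p -> bc_holds bc u' p' ->
  `|kap u p' * (u' - u) - (bc_potential bc kap u' - bc_potential bc kap u)|
    <= e * `|u' - u|.
Proof.
case: bc => [|b] /= ck cb e0.
  exists 1 => // p u' p' _ -> ->.
  by rewrite !subrr mulr0 subr0 normr0 mulr0.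
pose G (z : R * R) := kap z.1 (b z.2).
have cG : continuous G by rewrite /G; cont_tac.
have e2 : 0 < e / 2 by rewrite divr_gt0.
have /cvgrPdist_lt/(_ _ e2) := cG (u, u).
move=> [[A1 A2] /= [/nbhs_ballP[r1 /= r10 h1] /nbhs_ballP[r2 /= r20 h2]] AB].
exists (Num.min r1 r2); first by rewrite lt_min r10 r20.
move=> p u' p'; rewrite lt_min => /andP[ur1 ur2] _ ->.
have ckb : continuous (fun y => kap y (b y)) by cont_tac.
have [z -> zI] := MVT_line _ _ u u' (der_prim _ ckb).
rewrite -mulrBl normrM ler_wpM2r //.
have zu : `|u - z| <= `|u' - u|.
  move: zI; rewrite (distrC u'); case: (leP u u') => h /andP[za zb].
    by rewrite !ler0_norm ?subr_le0 // !opprB; lra.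
  by rewrite !ger0_norm ?subr_ge0 ?(ltW h) //; lra.
have g1 := AB (u, u'); have g2 := AB (z, z).
have {g1} : `|G (u, u) - G (u, u')| < e / 2.
  apply: g1; split => /=; first by apply: h1; rewrite /ball /= subrr normr0.
  by apply: h2; rewrite /ball /= distrC.
have {g2} : `|G (u, u) - G (z, z)| < e / 2.
  apply: g2; split => /=; first by apply: h1; rewrite /ball /= (le_lt_trans zu).
  by apply: h2; rewrite /ball /= (le_lt_trans zu).
rewrite /G /= => l1 l2.
have -> : kap u (b u') - kap z (b z) =
  (kap u (b u) - kap z (b z)) - (kap u (b u) - kap u (b u')) by ring.
by rewrite (le_trans (ler_normB _ _)) // (splitr e) lerD // ltW.
Qed.

Lemma bc_bounded (bc0 bc1 : boundary_condition R) (M : R) : bc_continuous bc0 ->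
  bc_continuous bc1 -> exists2 Mb, 0 <= Mb & bc_bounded_by bc0 M Mb /\ bc_bounded_by bc1 M Mb.
Proof.
have B bc : bc_continuous bc -> exists2 Mb, 0 <= Mb & bc_bounded_by bc M Mb.
  case: bc => [_|b /= cb]; first by exists 0.
  have [Mb Mb0 h] := compact_bounded_funs b _ (@segment_compact R (- M) M) cb.
  by exists Mb => // y yM; apply: h; rewrite /= in_itv /= -ler_norml.
move=> /B[m0 m00 h0] /B[m1 m10 h1]; exists (m0 + m1); first by rewrite addr_ge0.
split; [case: bc0 h0|case: bc1 h1] => //= b h y /h k; apply: (le_trans k).
  by rewrite lerDl.
by rewrite lerDr.
Qed.

Section Main.
Variables (F : R -> R -> R -> R) (M : R) (bc0 bc1 : boundary_condition R).
Variables (U P Q D : R -> R -> R).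
Hypothesis (orb : orbit F M bc0 bc1 U P Q D) (cF : cont3 F).
Hypotheses (cbc0 : bc_continuous bc0) (cbc1 : bc_continuous bc1) (M0 : 0 <= M).

(** Two times occur because u(s) - u(t) is a multiple of u_t at an intermediate time [s'], while
    u_xx and the slope are taken at [s]. Uniformity comes from compactness of [d, 1 - d], since u_xx
    and u_t are continuous only inside. *)
Lemma interior_uniform t d e : 0 < d -> 0 < e -> exists2 r, 0 < r & forall s s' x,
  t <= s' <= s -> s < t + r -> d <= x <= 1 - d ->
  `|(Q s x - F x (U t x) (P s x)) * D s' x
     - (Q t x - F x (U t x) (P t x)) * D t x| <= e.
Proof.
move=> d0 e0.
have [B B0 hB] := orb_bound _ _ _ _ _ _ _ _ orb t (t + 1).
have [DF DF0 hDF] := box_bounded F M cF.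
(* The factors of [w] when a product is varied: [2 * B] from varying u_xx - F against u_t, [B + DF]
   from varying u_t. *)
pose W := 2 * B + (B + DF) + 1.
have W0 : 0 < W by rewrite /W; lra.
pose w := e / W; have w0 : 0 < w by rewrite divr_gt0.
have [r1 r10 hr1] := box_uniform F M w cF w0.
have cI : compact `[d, 1 - d]%classic by exact: segment_compact.
have I01 (x : R) : d <= x <= 1 - d -> 0 < x < 1 by move=> /andP[? ?]; apply/andP; split; lra.
have I01' x : `[d, 1 - d]%classic x -> 0 < x < 1 by rewrite /= in_itv; exact: I01.
have UQ := near_uniform Q _ t cI (fun x xI => orb_cQ _ _ _ _ _ _ _ _ orb t x (I01' x xI)) w w0.
have UD := near_uniform D _ t cI (fun x xI => orb_cD _ _ _ _ _ _ _ _ orb t x (I01' x xI)) w w0.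
have r12 : 0 < r1 / 2 by rewrite divr_gt0.
have UP := orb_near _ _ _ _ _ _ _ _ orb t _ r12.
have /nbhs_ballP[rQ /= rQ0 hrQ] := UQ.
have /nbhs_ballP[rD /= rD0 hrD] := UD.
have /nbhs_ballP[rP /= rP0 hrP] := UP.
pose r2 := Num.min rQ (Num.min rD rP).
have r20 : 0 < r2 by rewrite !lt_min rQ0 rD0.
have hr2 s : ball t r2 s -> [/\ ball t rQ s, ball t rD s & ball t rP s].
  by rewrite /ball /= !lt_min => /andP[-> /andP[-> ->]].
exists (Num.min r2 1); first by rewrite lt_min r20 ltr01.
move=> s s' x /andP[ts' s's]; rewrite -ltrBlDl lt_min => /andP[sr2 sr1] xI.
have x01 := I01 x xI; have x01' := itv01_open_closed x x01.
have ts : t <= s by exact: le_trans s's.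
have bs : ball t r2 s by rewrite /ball /= ler0_norm ?subr_le0 // opprB.
have bs' : ball t r2 s'.
  by rewrite /ball /= ler0_norm ?subr_le0 // opprB (le_lt_trans _ sr2) // lerD2r.
have xI' : `[d, 1 - d]%classic x by rewrite /= in_itv.
have [/hrQ hQ _ /hrP hP] := hr2 s bs; have [_ /hrD hD _] := hr2 s' bs'.
have {}hQ := hQ x xI'; have {}hD := hD x xI'; have [_ {}hP] := hP x x01'.
have [_ _ hbox] := orb_prof _ _ _ _ _ _ _ _ orb t.
have [uM pM] := hbox x x01'.
have s1 : t <= s <= t + 1 by rewrite ts -lerBlDl ltW.
have s'1 : t <= s' <= t + 1 by rewrite ts' (le_trans s's) // -lerBlDl ltW.
have t1 : t <= t <= t + 1 by rewrite lexx lerDl ler01.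
have [bQ _] := hB s x s1 x01; have [_ bD] := hB s' x s'1 x01.
have [bQt bDt] := hB t x t1 x01.
have hF : `|F x (U t x) (P s x) - F x (U t x) (P t x)| <= w.
  have := hr1 x (U t x) (P t x) 0 (P s x - P t x) x01' uM pM.
  rewrite normr0 addr0 [P t x + _]addrC subrK; apply => //.
  exact: (le_lt_trans hP (half_lt _ r10)).
set A := Q s x - _; set A' := Q t x - _.
have hA : `|A - A'| <= w + w.
  have -> : A - A' = (Q s x - Q t x) - (F x (U t x) (P s x) - F x (U t x) (P t x)).
    by rewrite /A /A'; ring.
  by rewrite (le_trans (ler_normB _ _)) // lerD // ltW.
have hA' : `|A'| <= B + DF.
  by rewrite /A' (le_trans (ler_normB _ _)) // lerD // hDF.
have -> : A * D s' x - A' * D t x = (A - A') * D s' x + A' * (D s' x - D t x) by ring.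
rewrite (le_trans (ler_normD _ _)) // !normrM.
apply: (@le_trans _ _ ((w + w) * B + (B + DF) * w)).
  by rewrite lerD // ler_pM // ltW.
have <- : w * W = e by rewrite /w divfK // gt_eqF.
exact: arith_product.
Qed.

Variables (N : nat) (L Lu K Kx Ku g : nat -> R -> R -> R -> R) (c C e : R).
Hypotheses (N0 : (0 < N)%N) (c0 : 0 < c) (e0 : 0 < e).
Hypothesis hL : forall k, (k < N)%N ->
  lagrangian_strip F M c C e (node N k) (node N k.+1)
    (L k) (Lu k) (K k) (Kx k) (Ku k) (g k).
Hypothesis hK : forall k u p, K k (node N k.+1) u p = K k.+1 (node N k.+1) u p.

Let V t := energy bc0 bc1 N L K (U t) (P t).

Lemma energy_continuous : continuous V.
Proof.
have [Mb Mb_0 [h0' h1']] := bc_bounded bc0 bc1 M cbc0 cbc1.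
have C0 : 0 <= C := strip_C0 _ _ _ _ _ _ _ _ _ _ _ _ N0 c0 hL.
move=> t; apply/cvgrPdist_le => d d0.
pose Z := C * (1 + M + 2 * Mb) + 1.
have Z1 : 0 <= C * (1 + M + 2 * Mb) by rewrite mulr_ge0 // !addr_ge0 // mulr_ge0.
have Z0 : 0 < Z by rewrite /Z; lra.
have dZ : 0 < d / Z by rewrite divr_gt0.
have := orb_near _ _ _ _ _ _ _ _ orb t _ dZ; apply: filterS => s hs.
have := energy_lip bc0 bc1 N L K Lu Kx Ku g F M c C e N0 c0 M0 cbc0 cbc1 hL _ _ _ _
  (d / Z) Mb (orb_prof _ _ _ _ _ _ _ _ orb t) (orb_prof _ _ _ _ _ _ _ _ orb s) h0' h1' Mb_0.
move=> /(_ _)/le_trans; apply.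
  by move=> x x01; rewrite distrC [`|P t x - _|]distrC; exact: hs.
rewrite mulrA ler_pdivrMr // mulrC ler_pM2l //; rewrite /Z; lra.
Qed.

(** Every point of [0, 1] is approached from inside by moving it towards 1/2. *)
Lemma le_on_closure (phi : R -> R) k x : continuous phi ->
  (forall y, 0 < y < 1 -> phi y <= k) -> 0 <= x <= 1 -> phi x <= k.
Proof.
move=> cphi h /andP[x0 x1]; rewrite leNgt; apply/negP => kx.
have kx' : 0 < phi x - k by rewrite subr_gt0.
have /cvgrPdist_lt/(_ _ kx')/nbhs_ballP[r /= r0 hr] := cphi x.
pose th := Num.min r 1; have th0 : 0 < th by rewrite lt_min r0 ltr01.
have th1 : th <= 1 by rewrite ge_min lexx orbT.
have thr : th <= r by rewrite ge_min lexx.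
pose y := x + (1 / 2 - x) * th.
have b1 : x * th <= x by rewrite ler_piMr.
have b2 : (1 - x) * th <= 1 - x by rewrite ler_piMr // subr_ge0.
have b3 : 0 <= x * th by rewrite mulr_ge0 // ltW.
have b4 : 0 <= (1 - x) * th by rewrite mulr_ge0 ?subr_ge0 // ltW.
have y01 : 0 < y < 1 by rewrite /y; apply/andP; split; lra.
have by_ : ball x r y.
  rewrite /ball /= /y opprD addNKr normrN; apply: lt_le_trans thr.
  by rewrite ltr_norml; apply/andP; split; lra.
have := hr y by_; have := h y y01 => h1; rewrite ltr_norml => /andP[_]; lra.
Qed.

Lemma increment_bound B a b : 
  (forall s x, a <= s <= b -> 0 < x < 1 -> `|Q s x| <= B /\ `|D s x| <= B) ->
  forall t s x, a <= t <= s -> s <= b -> 0 <= x <= 1 ->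
  `|U s x - U t x| <= B * (s - t).
Proof.
move=> hB t s x /andP[at_ ts] sb x01.
have [cs _ _] := orb_prof _ _ _ _ _ _ _ _ orb s.
have [ct _ _] := orb_prof _ _ _ _ _ _ _ _ orb t.
have cn : continuous (fun y => `|U s (clamp01 y) - U t (clamp01 y)|).
  by move=> y; apply: cvg_norm; exact: cvgB (cs y) (ct y).
have := le_on_closure _ (B * (s - t)) x cn _ x01; rewrite clamp01_id //; apply.
move=> y y01; have y01' := itv01_open_closed y y01.
rewrite clamp01_id // -[s - t]ger0_norm ?subr_ge0 //.
apply: (MVT_bound (fun z => U z y) (fun z => D z y)) => [z|z].
  exact: (orb_dt _ _ _ _ _ _ _ _ orb).
rewrite (min_idPl ts) (max_idPr ts) => /andP[tz zs].
by have [|_] := hB z y _ y01; first by rewrite (le_trans at_ tz) (le_trans zs sb).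
Qed.

(** The terms [z] at inner nodes telescope because K matches there; the two outer ones are compared
    with the boundary potentials. *)
Lemma energy_increment t s h eta (r : R -> R) : t < s -> h = s - t ->
  continuous r -> 
  (forall k x, (k < N)%N -> node N k < x < node N k.+1 ->
    L k x (U s x) (P s x) - L k x (U t x) (P t x)
     - ((Kx k x (U t x) (P s x) + Ku k x (U t x) (P s x) * P t x
         + g k x (U t x) (P s x) * Q s x) * (U s x - U t x)
        + K k x (U t x) (P s x) * (P s x - P t x)) <= r x) ->
  `|K 0%N 0 (U t 0) (P s 0) * (U s 0 - U t 0) -
     (bc_potential bc0 (K 0%N 0) (U s 0) - bc_potential bc0 (K 0%N 0) (U t 0))| <= eta ->
  `|K N.-1 1 (U t 1) (P s 1) * (U s 1 - U t 1) -
     (bc_potential bc1 (K N.-1 1) (U s 1) - bc_potential bc1 (K N.-1 1) (U t 1))| <= eta ->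
  V s - V t <= prim r 1 - prim r 0 + 2 * eta.
Proof.
move=> ts hE cr hr b0 b1.
have [cUs cPs _] := orb_prof _ _ _ _ _ _ _ _ orb s.
have [cUt cPt _] := orb_prof _ _ _ _ _ _ _ _ orb t.
pose z k := K k (node N k) (U t (node N k)) (P s (node N k))
  * (U s (node N k) - U t (node N k)).
pose inc u p k := prim_along (L k) u p (node N k.+1) - prim_along (L k) u p (node N k).
have inck k : (k < N)%N -> inc (U s) (P s) k - inc (U t) (P t) k <=
   (prim r (node N k.+1) - prim r (node N k)) + (z k.+1 - z k).
  move=> kN.
  have n0 : 0 <= node N k :> R by rewrite /node divr_ge0.
  have n1 : node N k.+1 <= 1 :> R.
    have h1 : node N k <= (node N k.+1 : R) <= node N k.+1 by rewrite node_le lexx.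
    by have := node_in01 N k _ kN h1 => /andP[].
  have dd x : 0 < x < 1 -> [/\ der (U t) x (P t x), der (U s) x (P s x) & der (P s) x (Q s x)].
    by move=> x01; split; [exact: orb_dx orb _ _ x01|exact: orb_dx orb _ _ x01
      |exact: orb_dxx orb _ _ x01].
  have := strip_increment F M c C e _ _ _ _ _ _ _ _ (hL k kN) (U t) (U s) (P t) (P s) (Q s) r
    n0 (node_le N k) n1 cUt cUs cPt cPs cr dd (fun x => hr k x kN).
  rewrite -/(inc (U s) (P s) k) -/(inc (U t) (P t) k) hK -/(z k.+1) -/(z k); lra.
have sum1 : \sum_(k < N) (inc (U s) (P s) k - inc (U t) (P t) k) <=
    prim r 1 - prim r 0 + (z N - z 0%N).
  apply: (@le_trans _ _ (\sum_(k < N)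
      ((prim r (node N k.+1) - prim r (node N k)) + (z k.+1 - z k)))).
    by apply: ler_sum => k _; exact: inck.
  rewrite big_split /= -(big_mkord xpredT (fun k => prim r (node N k.+1) - prim r (node N k))).
  rewrite -(big_mkord xpredT (fun k => z k.+1 - z k)).
  by rewrite !telescope_sumr // nodeN // node0.
have z0 : z 0%N = K 0%N 0 (U t 0) (P s 0) * (U s 0 - U t 0) by rewrite /z node0.
have zN : z N = K N.-1 1 (U t 1) (P s 1) * (U s 1 - U t 1).
  rewrite /z nodeN //; congr (_ * _).
  by have := hK N.-1 (U t 1) (P s 1); rewrite prednK // nodeN.
have -> : V s - V t = \sum_(k < N) (inc (U s) (P s) k - inc (U t) (P t) k)
  + (bc_potential bc0 (K 0%N 0) (U s 0) - bc_potential bc0 (K 0%N 0) (U t 0))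
  - (bc_potential bc1 (K N.-1 1) (U s 1) - bc_potential bc1 (K N.-1 1) (U t 1)).
  by rewrite sumrB /V /energy /inc /prim_along /density_along; ring.
rewrite -z0 ler_distl in b0; rewrite -zN ler_distl in b1.
move: b0 b1 => /andP[p1 p2] /andP[p3 p4]; lra.
Qed.

Lemma strips_uniform t eta : 0 < eta -> \forall s \near t, forall k, (k < N)%N ->
  forall x, 0 <= x <= 1 ->
  (forall z, Num.min (U t x) (U s x) <= z <= Num.max (U t x) (U s x) ->
     `|Lu k x z (P s x) - Lu k x (U t x) (P s x)| <= eta) /\
  `|Ku k x (U t x) (P s x)| * `|P s x - P t x| <= eta.
Proof.
move=> eta0.
pose Pr k s := forall x, 0 <= x <= 1 ->
  (forall z, Num.min (U t x) (U s x) <= z <= Num.max (U t x) (U s x) ->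
     `|Lu k x z (P s x) - Lu k x (U t x) (P s x)| <= eta) /\
  `|Ku k x (U t x) (P s x)| * `|P s x - P t x| <= eta.
apply: (near_all_lt (nbhs t) Pr N) => k kN; rewrite /Pr {Pr}.
have cLu := ls_cLu _ _ _ _ _ _ _ _ _ _ _ _ _ (hL k kN).
have cKu := ls_cKu _ _ _ _ _ _ _ _ _ _ _ _ _ (hL k kN).
have [r r0 hr] := box_uniform (Lu k) M eta cLu eta0.
have [DK DK0 hDK] := box_bounded (Ku k) M cKu.
pose rho := Num.min (r / 2) (eta / (DK + 1)).
have rho0 : 0 < rho by rewrite lt_min !divr_gt0 // ltr_wpDl.
have := orb_near _ _ _ _ _ _ _ _ orb t _ rho0; apply: filterS => s hs x x01.
have [_ _ bt] := orb_prof _ _ _ _ _ _ _ _ orb t; have [ut pt] := bt x x01.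
have [_ _ bs] := orb_prof _ _ _ _ _ _ _ _ orb s; have [us ps] := bs x x01.
have [hU hP] := hs x x01; split.
  move=> z zI; have zU : `|z - U t x| <= `|U s x - U t x|.
    move: zI; case: (leP (U t x) (U s x)) => h /andP[z1 z2].
      by rewrite !ger0_norm ?subr_ge0 //; lra.
    by rewrite !ler0_norm ?subr_le0 ?(ltW h) // !opprB; lra.
  have := hr x (U t x) (P s x) (z - U t x) 0 x01 ut ps.
  rewrite addr0 [U t x + _]addrC subrK normr0; apply => //.
  apply: (le_lt_trans zU); apply: (le_lt_trans hU).
  apply: (@le_lt_trans _ _ (r / 2)); last by lra.
  by rewrite ge_min lexx.
apply: (@le_trans _ _ (DK * (eta / (DK + 1)))).
  rewrite ler_pM ?hDK // (le_trans hP) // ge_min lexx orbT //.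
rewrite mulrA ler_pdivrMr ?ltr_wpDl // mulrC ler_wpM2l ?(ltW eta0) // lerDl //.
Qed.

Lemma near_le_after (T0 : R) (Pr : R -> Prop) : (\forall s \near T0, Pr s) ->
  exists2 r, 0 < r & forall s, T0 <= s < T0 + r -> Pr s.
Proof.
move=> /nbhs_ballP[r /= r0 hr]; exists r => // s /andP[s1 s2]; apply: hr.
by rewrite /ball /= ler0_norm ?subr_le0 // opprB ltrBlDl.
Qed.

(** The function [chi] bounds the dissipation density from below; being continuous up to the ends
    and independent of time, it can be integrated. From each t a single short step forward is
    examined: uniform closeness away from the ends, the layer weight near them. The defect [e] of
    the Euler-Lagrange identity costs [e] times the bound [B] on u_t. *)
Lemma energy_dissipation a b B (chi : R -> R) : a <= b -> 0 <= B ->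
  (forall s x, a <= s <= b + 1 -> 0 < x < 1 -> `|Q s x| <= B /\ `|D s x| <= B) ->
  continuous chi -> (forall x, 0 <= chi x) ->
  (forall t x, a <= t <= b -> 0 < x < 1 ->
     chi x <= (Q t x - F x (U t x) (P t x)) * D t x) ->
  V b - V a <= (- c * prim chi 1 + e * B) * (b - a).
Proof.
move=> ab B0 hB cchi chi0 hchi.
have C0 : 0 <= C := strip_C0 _ _ _ _ _ _ _ _ _ _ _ _ N0 c0 hL.
apply: dini_le => //; first exact: energy_continuous.
move=> t eps /andP[at_ tb] eps0.
have [DF DF0 hDF] := box_bounded F M cF.
pose Y := (B + DF) * B; have Y0 : 0 <= Y by rewrite mulr_ge0 // addr_ge0.
(* Half of [A] pays for [C * Y], the worst value of the dissipation term, together with [c * Y], the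
   worst value of [c * chi]. *)
pose A := 2 * (C + c) * Y.
have A0 : 0 <= A by rewrite !mulr_ge0 // addr_ge0 // ltW.
have A21 : 0 < 2 * A + 1 by rewrite ltr_wpDl // mulr_ge0.
have eA : 0 < eps / 8 / (2 * A + 1) by rewrite !divr_gt0.
(* So large that [A] times the layer weight has integral at most eps / 8. *)
have [n' n'0 hn] := inv_nat_lt _ eA.
pose n := n'.-1; have nE : n.+1 = n' by rewrite /n prednK.
have hA : A * (2 / n.+1%:R) <= eps / 8.
  rewrite nE; move: hn; rewrite (ltr_pdivlMr _ _ A21) => h.
  have i0 : 0 <= n'%:R^-1 :> R by rewrite invr_ge0.
  by apply: arith_layer_mass => //; exact: ltW.
have [d /andP[d0 d12] hd] := @layer_ge_half R n.
(* Tolerance for the variation of L_u, for the change of slope against K_u, and for each boundary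
   term; multiplied by |u(s) - u(t)| <= B h, each costs at most eps / 16 per unit of time. *)
pose eta := eps / 16 / (B + 1).
have B1 : 0 < B + 1 by rewrite ltr_wpDl.
have eta0 : 0 < eta by rewrite !divr_gt0.
have etaB : eta * B <= eps / 16.
  rewrite -[leRHS](divfK (lt0r_neq0 B1)) -/eta ler_wpM2l ?(ltW eta0) // lerDl //.
have eC : 0 < eps / 8 / (C + 1) by rewrite !divr_gt0 // ltr_wpDl.
have [r1 r10 hr1] := interior_uniform t d _ d0 eC.
have [r2 r20 hr2] := near_le_after _ _ (strips_uniform t eta eta0).
have cK0 : cont2 (K 0%N 0).
  by have cK := ls_cK _ _ _ _ _ _ _ _ _ _ _ _ _ (hL 0%N N0); rewrite /cont2; cont_tac.
have cK1 : cont2 (K N.-1 1).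
  have N1 : (N.-1 < N)%N by rewrite prednK.
  by have cK := ls_cK _ _ _ _ _ _ _ _ _ _ _ _ _ (hL _ N1); rewrite /cont2; cont_tac.
have [r3 r30 hr3] := boundary_increment bc0 _ (U t 0) eta cK0 cbc0 eta0.
have [r4 r40 hr4] := boundary_increment bc1 _ (U t 1) eta cK1 cbc1 eta0.
pose r34 := Num.min r3 r4 / 2; have r340 : 0 < r34 by rewrite divr_gt0 // lt_min r30 r40.
have r34l : r34 < r3 /\ r34 < r4.
  have m1 : Num.min r3 r4 <= r3 by rewrite ge_min lexx.
  have m2 : Num.min r3 r4 <= r4 by rewrite ge_min lexx orbT.
  have m0 : 0 < Num.min r3 r4 by rewrite lt_min r30 r40.
  by split; [exact: lt_le_trans (half_lt _ m0) m1|exact: lt_le_trans (half_lt _ m0) m2].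
have [r5 r50 hr5] := near_le_after _ _ (orb_near _ _ _ _ _ _ _ _ orb t _ r340).
pose h := Num.min (Num.min (Num.min r1 r2) (Num.min r5 1)) (b - t) / 2.
have m0 : 0 < Num.min (Num.min (Num.min r1 r2) (Num.min r5 1)) (b - t).
  by rewrite !lt_min r10 r20 r50 ltr01 subr_gt0 tb.
have h0 : 0 < h by rewrite divr_gt0.
have hm : h < Num.min (Num.min (Num.min r1 r2) (Num.min r5 1)) (b - t) by exact: half_lt.
move: hm; rewrite !lt_min => /andP[/andP[/andP[hr1' hr2'] /andP[hr5' h1]] hbt].
pose s := t + h; have ts : t < s by rewrite ltrDl.
have sh : s - t = h by rewrite /s addrAC subrr add0r.
have sb : s <= b by rewrite /s addrC -lerBrDr ltW.
have sb1 : s <= b + 1 by rewrite (le_trans sb) // lerDl ler01.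
exists s; first by rewrite ts sb.
have i01 : 0 <= (0 : R) <= 1 by rewrite lexx ler01.
have i11 : 0 <= (1 : R) <= 1 by rewrite lexx ler01.
have [bc0s bc1s] := orb_bc _ _ _ _ _ _ _ _ orb s.
have [bc0t bc1t] := orb_bc _ _ _ _ _ _ _ _ orb t.
have s5 : t <= s < t + r5 by rewrite (ltW ts) ltrD2l.
have wB x : 0 <= x <= 1 -> `|U s x - U t x| <= B * h.
  move=> x01; rewrite -sh; apply: (increment_bound B a (b + 1)) => //.
    by rewrite at_ ltW.
have W0 : `|U s 0 - U t 0| < r3.
  by have [? _] := hr5 s s5 0 i01; apply: le_lt_trans r34l.1.
have W1 : `|U s 1 - U t 1| < r4.
  by have [? _] := hr5 s s5 1 i11; apply: le_lt_trans r34l.2.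
have bd0 := hr3 _ _ _ W0 bc0t bc0s; have bd1 := hr4 _ _ _ W1 bc1t bc1s.
have wEta x : 0 <= x <= 1 -> eta * `|U s x - U t x| <= eps / 16 * h.
  move=> x01; apply: (@le_trans _ _ (eta * (B * h))).
    by rewrite ler_wpM2l ?(ltW eta0) // wB.
  by rewrite mulrA ler_wpM2r ?(ltW h0).
(* Pointwise majorant of the increment after integration by parts; its primitive is explicit apart
   from that of [chi]. *)
pose rr x := h * (- c * chi x + (e * B + eps / 4) + A * layer n x).
have clayer : continuous (@layer R n).
  move=> x; apply: cvgD; first exact: exprn_continuous.
  have c1 : continuous (fun y : R => 1 - y) by cont_tac.
  exact: (cont_comp (fun y => y ^+ n) _ (@exprn_continuous R n) c1).
have crr : continuous rr by rewrite /rr; cont_tac.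
have primrr : prim rr 1 - prim rr 0 =
    h * (- c * prim chi 1 + (e * B + eps / 4) + A * (2 / n.+1%:R)).
  pose RR x := h * (- c * prim chi x + (e * B + eps / 4) * x + A * layer_prim n x).
  have dRR x : der RR x (rr x).
    apply: der_to.
      apply: der_mul; first exact: der_const.
      apply: der_add; last by apply: der_mul; [exact: der_const|exact: der_layer_prim].
      apply: der_add; apply: der_mul; try exact: der_const; last exact: der_var.
      exact: der_prim.
    by rewrite /rr /=; ring.
  have := @der_eq0 R (fun x => prim rr x - RR x) 1 0.
  have d0' z : der (fun x => prim rr x - RR x) z 0.
    by rewrite -(subrr (rr z)); apply: der_sub => //; exact: der_prim.
  move=> /(_ d0')/subr_swap ->; rewrite /RR -layer_prim01 (prim0 chi) //; ring.
have main k x : (k < N)%N -> node N k < x < node N k.+1 ->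
    L k x (U s x) (P s x) - L k x (U t x) (P t x)
     - ((Kx k x (U t x) (P s x) + Ku k x (U t x) (P s x) * P t x
         + g k x (U t x) (P s x) * Q s x) * (U s x - U t x)
        + K k x (U t x) (P s x) * (P s x - P t x)) <= rr x.
  move=> kN /andP[x1 x2].
  have xk : node N k <= x <= node N k.+1 by rewrite !ltW.
  have x01' := node_in01 _ _ _ kN xk.
  have x01 : 0 < x < 1.
    have h1' : node N k.+1 <= 1 :> R.
      have h2' : node N k <= (node N k.+1 : R) <= node N k.+1 by rewrite node_le lexx.
      by have := node_in01 N k _ kN h2' => /andP[].
    rewrite (lt_le_trans x2 h1') andbT; apply: le_lt_trans x1.
    by rewrite /node divr_ge0.
  have [_ _ bt] := orb_prof _ _ _ _ _ _ _ _ orb t; have [ut pt] := bt x x01'.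
  have [_ _ bs] := orb_prof _ _ _ _ _ _ _ _ orb s; have [us ps] := bs x x01'.
  have s2 : t <= s < t + r2 by rewrite (ltW ts) ltrD2l.
  have [hLu hKu] := hr2 s s2 k kN x x01'.
  have gc := ls_gc _ _ _ _ _ _ _ _ _ _ _ _ _ (hL k kN) x (U t x) (P s x) xk.
  have gC := ls_gC _ _ _ _ _ _ _ _ _ _ _ _ _ (hL k kN) x (U t x) (P s x) xk.
  have := strip_pointwise F M c C e _ _ _ _ _ _ _ _ (hL k kN) c0 x (U t x) (U s x)
    (P t x) (P s x) (Q s x) eta `|P s x - P t x| _ xk ut ps (lexx _) hLu (lexx _).
  move=> /le_trans; apply.
  set G := g k x _ _ in gc gC *; set Kk := `|Ku _ _ _ _| * _ in hKu *.
  have [z zE zI] := MVT_line _ _ t s (fun z => orb_dt _ _ _ _ _ _ _ _ orb z x x01).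
  rewrite (min_idPl (ltW ts)) (max_idPr (ltW ts)) in zI.
  have zab : a <= z <= b + 1.
    by case/andP: zI => z1 z2; rewrite (le_trans at_ z1) (le_trans z2 sb1).
  have sab : a <= s <= b + 1 by rewrite (le_trans at_ (ltW ts)) sb1.
  have [_ bDz] := hB z x zab x01; have [bQs _] := hB s x sab x01.
  rewrite sh in zE.
  set y := (Q s x - F x (U t x) (P s x)) * D z x.
  have yY : `|y| <= Y.
    rewrite normrM ler_pM // (le_trans (ler_normB _ _)) // lerD //.
    exact: hDF.
  have chiY : chi x <= Y.
    have tab : a <= t <= b by rewrite at_ ltW.
    apply: le_trans (hchi t x tab x01) _; apply: le_trans (ler_norm _) _.
    have tab' : a <= t <= b + 1 by rewrite at_ (le_trans (ltW ts) sb1).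
    have [bQt bDt] := hB t x tab' x01.
    rewrite normrM ler_pM // (le_trans (ler_normB _ _)) // lerD //.
    exact: hDF.
  have zE' : (Q s x - F x (U t x) (P s x)) * (U s x - U t x) = y * h.
    by rewrite zE /y; ring.
  rewrite zE'.
  have G0 : 0 <= G by rewrite (le_trans (ltW c0)).
  have key : - (G * y) <= - c * chi x + eps / 8 + A * layer n x.
    have ly := layer_ge0 n x x01'.
    have Aly : 0 <= A * layer n x by rewrite mulr_ge0.
    have [xd|] := boolP (d <= x <= 1 - d).
      have := hr1 s z x zI _ xd; rewrite ltrD2l => /(_ hr1').
      rewrite ler_distl => /andP[lo _].
      have tab : a <= t <= b by rewrite at_ ltW.
      have lo2 : chi x - eps / 8 / (C + 1) <= y.
        by apply: le_trans lo; rewrite lerD2r; exact: hchi.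
      have l3 : G * (chi x - eps / 8 / (C + 1)) <= G * y by rewrite ler_wpM2l.
      have l4 : c * chi x <= G * chi x by rewrite ler_wpM2r.
      have l5 : G * (eps / 8 / (C + 1)) <= eps / 8.
        rewrite mulrA ler_pdivrMr ?ltr_wpDl // mulrC ler_wpM2l ?divr_ge0 ?(ltW eps0) //.
        by rewrite (le_trans gC) // lerDl.
      exact: arith_interior l3 l4 l5 Aly.
    rewrite negb_and -!ltNge => xd.
    have half : 1 / 2 <= layer n x.
      by apply: hd => //; case/orP: xd => /ltW; [left|right].
    have l1 : A * (1 / 2) <= A * layer n x by rewrite ler_wpM2l.
    have l2 : - (G * y) <= C * Y.
      by rewrite (le_trans (ler_norm _)) // normrN normrM ler_pM // ger0_norm.
    have l3 : c * chi x <= c * Y by rewrite ler_wpM2l ?(ltW c0).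
    exact: arith_layer l1 l2 l3 eps0.
  have rest : (e + eta + Kk) * `|U s x - U t x| <= h * (e * B + eps / 8).
    apply: (@le_trans _ _ ((e + eta + eta) * (B * h))).
      have Kk0 : 0 <= Kk by rewrite mulr_ge0.
      rewrite ler_pM ?wB //; first by rewrite addr_ge0 // addr_ge0 ?(ltW e0) ?(ltW eta0).
      by rewrite lerD2l.
    by apply: arith_rest; rewrite ler_wpM2r ?(ltW h0).
  by apply: arith_strip rest; rewrite ler_wpM2l ?(ltW h0).
have e0' : `|K 0%N 0 (U t 0) (P s 0) * (U s 0 - U t 0) -
     (bc_potential bc0 (K 0%N 0) (U s 0) - bc_potential bc0 (K 0%N 0) (U t 0))| <= eps / 16 * h.
  exact: le_trans bd0 (wEta _ i01).
have e1' : `|K N.-1 1 (U t 1) (P s 1) * (U s 1 - U t 1) -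
     (bc_potential bc1 (K N.-1 1) (U s 1) - bc_potential bc1 (K N.-1 1) (U t 1))| <= eps / 16 * h.
  exact: le_trans bd1 (wEta _ i11).
have := energy_increment t s h _ rr ts (esym sh) crr main e0' e1'.
move=> /le_trans; apply; rewrite primrr sh.
by apply: arith_total; rewrite ?mulr_gt0 // ler_wpM2l ?(ltW h0).
Qed.

End Main.
End Dissipation.

(** * The strict Lyapunov function *)

Section Lyapunov.
Context {R : realType}.

(** The limit is the supremum of the levels that the sequence reaches on a set of [G]; the
    ultrafilter decides against any higher level. *)
Lemma ultra_limit (G : set_system nat) (x : nat -> R) (B : R) : UltraFilter G ->
  (forall n, `|x n| <= B) ->
  exists l, forall e, 0 < e -> G [set n | `|x n - l| <= e].
Proof.
move=> GU hB; have GF : ProperFilter G := ultra_proper.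
pose A := [set s | G [set n | s <= x n]].
have hA : has_sup A.
  split.
    exists (- B); rewrite /A /=; apply: filterE => n.
    by have := hB n; rewrite ler_norml => /andP[].
  exists B => s As; rewrite leNgt; apply/negP => Bs.
  have /filter_ex[n /= sn] := As.
  by have := le_trans sn (le_trans (ler_norm _) (hB n)); rewrite leNgt Bs.
exists (sup A) => e e0.
have [s As ls] := sup_adherent e0 hA.
have [hG|hG] := in_ultra_setVsetC [set n | sup A + e <= x n] GU.
  have : sup A + e <= sup A by apply: ub_le_sup => //; case: hA.
  by rewrite gerDl leNgt e0.
apply: filterS2 As hG => n /= sn /negP; rewrite -ltNge => nn.
by rewrite ler_distl; apply/andP; split; lra.
Qed.

Lemma orbit_cvg (F : R -> R -> R -> R) (M : R) bc0 bc1 U P Q D t x :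
  orbit F M bc0 bc1 U P Q D -> cont3 F -> 0 < x < 1 ->
  {for (t, x), continuous (fun z : R * R =>
     (Q z.1 z.2 - F z.2 (U z.1 z.2) (P z.1 z.2)) * D z.1 z.2)}.
Proof.
move=> orb cF x01.
have x01' := itv01_open_closed x x01.
have near2 (f : R -> R -> R) df : der (f t) x df ->
    (forall e, 0 < e -> \forall s \near t, forall y, 0 <= y <= 1 -> `|f s y - f t y| <= e) ->
    {for (t, x), continuous (fun z : R * R => f z.1 z.2)}.
  move=> /der_continuous cf hf; apply/cvgrPdist_le => e e0.
  have e2 : 0 < e / 2 by rewrite divr_gt0.
  have /cvgrPdist_le/(_ _ e2) h1 := cf; have h2 := hf _ e2.
  have i01 := near_in01 x x01.
  exists ([set s | forall y, 0 <= y <= 1 -> `|f s y - f t y| <= e / 2],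
          [set y | `|f t x - f t y| <= e / 2 /\ 0 < y < 1]).
    by split => //=; exact: filterS2 (fun y a b => conj a b) h1 i01.
  move=> [s y] /= [hs [hy y01]].
  have y01' := itv01_open_closed y y01.
  have -> : f t x - f s y = (f t x - f t y) - (f s y - f t y) by ring.
  by rewrite (le_trans (ler_normB _ _)) // (splitr e) lerD // hs.
have cU : {for (t, x), continuous (fun z : R * R => U z.1 z.2)}.
  apply: near2 (orb_dx _ _ _ _ _ _ _ _ orb t x x01) _ => e e0.
  have := orb_near _ _ _ _ _ _ _ _ orb t e e0; apply: filterS => s h y y01.
  by have [] := h y y01.
have cP : {for (t, x), continuous (fun z : R * R => P z.1 z.2)}.
  apply: near2 (orb_dxx _ _ _ _ _ _ _ _ orb t x x01) _ => e e0.
  have := orb_near _ _ _ _ _ _ _ _ orb t e e0; apply: filterS => s h y y01.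
  by have [] := h y y01.
have c2 : {for (t, x), continuous (fun z : R * R => z.2)} by exact: (cont_snd id cont_id).
have p1 : (fun z : R * R => (z.2, U z.1 z.2)) z @[z --> (t, x)] --> (x, U t x).
  exact: cvg_pair c2 cU.
have p2 : (fun z : R * R => (z.2, U z.1 z.2, P z.1 z.2)) z @[z --> (t, x)] --> (x, U t x, P t x).
  exact: cvg_pair p1 cP.
apply: cvgM; last exact: (orb_cD _ _ _ _ _ _ _ _ orb).
apply: cvgB; first exact: (orb_cQ _ _ _ _ _ _ _ _ orb).
have := cvg_comp _ _ p2 (cF (x, U t x, P t x)); exact.
Qed.

(** An ultrafilter gives limits at all profiles at once, where a convergent subsequence could depend
    on the profile. Subtracting the energy of 0 makes each sequence bounded, by the uniform
    Lipschitz constant. The errors 1 / (n + 1) disappear in the limit while the contribution of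
    [chi] stays. *)
Lemma lyapunov_exists (F Fu Fp Fpu Fpp : R -> R -> R -> R) (M : R)
    (bc0 bc1 : boundary_condition R) :
  rhs F Fu Fp Fpu Fpp -> 0 < M -> bc_continuous bc0 -> bc_continuous bc1 ->
  exists (V : (R -> R) -> (R -> R) -> R) (CV : R), [/\ 0 <= CV,
    (forall u p u' p' eta, profile M u p -> profile M u' p' ->
       (forall x, 0 <= x <= 1 -> `|u x - u' x| <= eta /\ `|p x - p' x| <= eta) ->
       `|V u p - V u' p'| <= CV * eta),
    (forall U P Q D a b, orbit F M bc0 bc1 U P Q D -> a <= b ->
       V (U b) (P b) <= V (U a) (P a)) &
    (forall U P Q D a b t x, orbit F M bc0 bc1 U P Q D -> a < t < b -> 0 < x < 1 ->
       D t x != 0 -> V (U b) (P b) < V (U a) (P a))].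
Proof.
move=> hF M0 cb0 cb1; have cF := rhs_c _ _ _ _ _ hF.
have [c [C [c0 hstrips]]] := rhs_strips F Fu Fp Fpu Fpp M hF M0.
pose en n : R := n.+1%:R^-1.
have en0 n : 0 < en n by rewrite invr_gt0 ltr0n.
have /choice[N /choice[L /choice[Lu /choice[K /choice[Kx /choice[Ku /choice[g hg]]]]]]] :=
  fun n => hstrips (en n) (en0 n).
have [Mb Mb_0 [h0' h1']] := bc_bounded bc0 bc1 M cb0 cb1.
pose E n u p := energy bc0 bc1 (N n) (L n) (K n) u p.
pose CV := C * (1 + M + 2 * Mb).
have hN n : (0 < N n)%N by have [] := hg n.
have hL n : forall k, (k < N n)%N -> lagrangian_strip F M c C (en n) (node (N n) k)
    (node (N n) k.+1) (L n k) (Lu n k) (K n k) (Kx n k) (Ku n k) (g n k).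
  by have [] := hg n.
have hK n k u p : K n k (node (N n) k.+1) u p = K n k.+1 (node (N n) k.+1) u p.
  by have [] := hg n.
have C0 : 0 <= C := strip_C0 _ _ _ _ _ _ _ _ _ _ _ _ (hN 0%N) c0 (hL 0%N).
have CV0 : 0 <= CV by rewrite mulr_ge0 // !addr_ge0 ?mulr_ge0 // ltW.
have lip n u p u' p' eta : profile M u p -> profile M u' p' ->
    (forall x, 0 <= x <= 1 -> `|u x - u' x| <= eta /\ `|p x - p' x| <= eta) ->
    `|E n u p - E n u' p'| <= CV * eta.
  move=> pu pu' he; exact: (energy_lip bc0 bc1 (N n) (L n) (K n) (Lu n) (Kx n) (Ku n) (g n)
    F M c C (en n) (hN n) c0 (ltW M0) cb0 cb1 (hL n) _ _ _ _ eta Mb pu pu' h0' h1' Mb_0 he).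
have prof0 : profile M (fun=> 0) (fun=> 0).
  by split; [exact: cont_cst|exact: cont_cst|move=> x _; rewrite normr0 ltW].
pose W u p n := E n u p - E n (fun=> 0) (fun=> 0).
have [G [GU Goo]] := ultraFilterLemma eventually_filter.
have GF : ProperFilter G := ultra_proper.
have GI A B : G A -> G B -> G (A `&` B) by exact: filterI.
have Gex A : G A -> exists n, A n by exact: filter_ex.
(* On profiles the limit exists, so the default 0 does not occur there. *)
pose V u p := xget 0 [set l | forall e, 0 < e -> G [set n | `|W u p n - l| <= e]].
have hV u p : profile M u p -> forall e, 0 < e -> G [set n | `|W u p n - V u p| <= e].
  move=> pu; rewrite /V; case: xgetP => [l _ //|none].
  have [|l hl] := ultra_limit G (W u p) (CV * M) GU _; last by case: (none l).
  move=> n; apply: lip => // x x01; have [_ _ hb] := pu.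
  by rewrite !subr0; exact: hb.
have diss U P Q D a b (B : R) (chi : R -> R) : orbit F M bc0 bc1 U P Q D -> a <= b -> 0 <= B ->
  (forall s x, a <= s <= b + 1 -> 0 < x < 1 -> `|Q s x| <= B /\ `|D s x| <= B) ->
  continuous chi -> (forall x, 0 <= chi x) ->
  (forall t x, a <= t <= b -> 0 < x < 1 ->
     chi x <= (Q t x - F x (U t x) (P t x)) * D t x) ->
  V (U b) (P b) - V (U a) (P a) <= - c * prim chi 1 * (b - a).
  move=> orb ab B0 hB cchi chi0 hchi.
  have dn n : W (U b) (P b) n - W (U a) (P a) n <=
      (- c * prim chi 1 + en n * B) * (b - a).
    have := energy_dissipation F M bc0 bc1 U P Q D orb cF cb0 cb1 (ltW M0) (N n) (L n)
      (Lu n) (K n) (Kx n) (Ku n) (g n) c C (en n) (hN n) c0 (en0 n) (hL n) (hK n) a b B chi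
      ab B0 hB cchi chi0 hchi.
    by rewrite /W /E; lra.
  apply/ler_addgt0Pr => e e0.
  have pa := orb_prof _ _ _ _ _ _ _ _ orb a; have pb := orb_prof _ _ _ _ _ _ _ _ orb b.
  have e3 : 0 < e / 3 by rewrite divr_gt0.
  have Z0 : 0 < B * (b - a) + 1 by rewrite ltr_wpDl // mulr_ge0 // subr_ge0.
  have e4 : 0 < e / 3 / (B * (b - a) + 1) by rewrite divr_gt0.
  have small : G [set n | en n < e / 3 / (B * (b - a) + 1)].
    apply: Goo; exact: (near_infty_natSinv_lt (PosNum e4)).
  have [n [[/= l1 l2] l3]] := Gex _ (GI _ _ (GI _ _ (hV _ _ pa _ e3) (hV _ _ pb _ e3)) small).
  move: l1 l2; rewrite !ler_distl => /andP[_ l1] /andP[l2 _].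
  have l4 : en n * (B * (b - a)) <= e / 3.
    move: l3; rewrite /= (ltr_pdivlMr _ _ Z0) => l3.
    by have := en0 n; lra.
  by have := dn n; lra.
have zero_chi U P Q D : orbit F M bc0 bc1 U P Q D -> forall t x, 0 < x < 1 ->
    0 <= (Q t x - F x (U t x) (P t x)) * D t x.
  move=> orb t x x01; have [->|Dn] := eqVneq (D t x) 0; first by rewrite mulr0.
  by rewrite ltW // (orb_sign _ _ _ _ _ _ _ _ orb).
have mono U P Q D a b : orbit F M bc0 bc1 U P Q D -> a <= b ->
    V (U b) (P b) <= V (U a) (P a).
  move=> orb ab.
  have [B B0 hB] := orb_bound _ _ _ _ _ _ _ _ orb a (b + 1).
  have := diss U P Q D a b B (fun=> 0) orb ab B0 hB (cont_cst 0) (fun=> lexx 0)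
    (fun t x _ x01 => zero_chi _ _ _ _ orb t x x01).
  have c00 : continuous (fun _ : R => 0 : R) by exact: cont_cst.
  rewrite (der_eq0 (prim (fun _ : R => 0 : R)) 1 0 (der_prim _ c00)) prim0 //.
  by rewrite mulr0 mul0r subr_le0.
exists V, CV; split => //.
  move=> u p u' p' eta pu pu' he; apply/ler_addgt0Pr => e e0.
  have e2 : 0 < e / 2 by rewrite divr_gt0.
  have [n [/= l1 l2]] := Gex _ (GI _ _ (hV _ _ pu _ e2) (hV _ _ pu' _ e2)).
  have := lip n u p u' p' eta pu pu' he; rewrite !ler_norml.
  move: l1 l2; rewrite /W !ler_norml => /andP[? ?] /andP[? ?] /andP[? ?].
  by apply/andP; split; lra.
move=> U P Q D a b t x orb /andP[at_ tb] x01 Dn.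
pose S s y := (Q s y - F y (U s y) (P s y)) * D s y.
have S0 : 0 < S t x by exact: (orb_sign _ _ _ _ _ _ _ _ orb).
have S_ge0 s y : 0 < y < 1 -> 0 <= S s y by exact: zero_chi orb s y.
have cS := orbit_cvg F M bc0 bc1 U P Q D t x orb cF x01.
have S20 : 0 < S t x / 2 by rewrite divr_gt0.
have /cvgrPdist_lt/(_ _ S20) := cS.
move=> [[A1 A2] /= [/nbhs_ballP[r1 /= r10 k1] /nbhs_ballP[r2 /= r20 k2]] AB].
pose r := Num.min r1 r2; have r0 : 0 < r by rewrite lt_min r10 r20.
have hS s y : `|s - t| < r -> `|y - x| < r -> S t x / 2 <= S s y.
  rewrite !lt_min => /andP[s1 _] /andP[_ y2].
  have : `|S t x - S s y| < S t x / 2.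
    by apply: (AB (s, y)); split => /=; [apply: k1|apply: k2]; rewrite /ball /= distrC.
  by rewrite ltr_norml => /andP[_]; lra.
pose eta := S t x / 2.
(* Tent of radius [r] and height half the dissipation density at (t, x); it lies below that density
   throughout a time window around [t]. *)
pose chi y := Num.max 0 (eta * (1 - `|y - x| / r)).
have cabs : continuous (fun y : R => `|y - x|).
  by move=> y; apply: cvg_norm; exact: (contB _ _ cont_id (cont_cst x)).
have cchi : continuous chi by rewrite /chi; cont_tac; exact: cabs.
have chi0 y : 0 <= chi y by rewrite /chi le_max lexx.
pose a1 := Num.max a (t - r / 2); pose b1 := Num.min b (t + r / 2).
have r20' : 0 < r / 2 by rewrite divr_gt0.
have a1t : a1 < t by rewrite /a1 gt_max at_ ltrBlDr ltrDl.
have tb1 : t < b1 by rewrite /b1 lt_min tb ltrDl.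
have aa1 : a <= a1 by rewrite /a1 le_max lexx.
have bb1 : b1 <= b by rewrite /b1 ge_min lexx.
have hchi s y : a1 <= s <= b1 -> 0 < y < 1 -> chi y <= S s y.
  move=> /andP[s1 s2] y01; rewrite /chi ge_max S_ge0 //=.
  have sr : `|s - t| < r.
    move: s1 s2; rewrite /a1 /b1 ge_max le_min => /andP[_ s1] /andP[_ s2].
    by apply: le_lt_trans (half_lt _ r0); rewrite ler_distl s1 s2.
  have [yr|yr] := ltP `|y - x| r.
    apply: le_trans (hS s y sr yr); rewrite ler_piMr ?(ltW S20) //.
    by rewrite gerBl divr_ge0 // ltW.
  apply: le_trans (S_ge0 s y y01); rewrite mulr_ge0_le0 ?(ltW S20) //.
  by rewrite subr_le0 ler_pdivlMr // mul1r.
have [B B0 hB] := orb_bound _ _ _ _ _ _ _ _ orb a1 (b1 + 1).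
have := diss U P Q D a1 b1 B chi orb (ltW (lt_trans a1t tb1)) B0 hB cchi chi0 hchi.
have V1 := mono U P Q D a a1 orb aa1; have V2 := mono U P Q D b1 b orb bb1.
(* On [x, x + th], which lies in [0, 1] and within half the radius, the tent is at least
   [eta / 2]. *)
have chi1 : 0 < prim chi 1.
  pose th := Num.min (r / 2) (1 - x).
  have [x0 x1] : 0 < x /\ x < 1 by case/andP: x01.
  have th0 : 0 < th by rewrite lt_min r20' subr_gt0.
  have thr : th <= r / 2 by rewrite ge_min lexx.
  have th1 : x + th <= 1 by rewrite -lerBrDl ge_min lexx orbT.
  have i1 := der_sub_le (fun=> 0) (prim chi) (fun=> 0) chi 0 x (ltW x0)
    (fun z => der_const 0 z) (der_prim _ cchi) (fun z _ => chi0 z).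
  have i3 := der_sub_le (fun=> 0) (prim chi) (fun=> 0) chi (x + th) 1 th1
    (fun z => der_const 0 z) (der_prim _ cchi) (fun z _ => chi0 z).
  have dlin z : der (fun y => eta / 2 * y) z (eta / 2).
    by apply: der_to; [apply: der_mul; [exact: der_const|exact: der_var]
      |rewrite /= mul0r add0r mulr1].
  have xth : x <= x + th by rewrite lerDl ltW.
  have hlow z : x <= z <= x + th -> eta / 2 <= chi z.
    move=> /andP[z1 z2]; rewrite /chi le_max; apply/orP; right.
    rewrite ler_wpM2l ?(ltW S20) // ger0_norm ?subr_ge0 //.
    have : (z - x) / r <= 1 / 2.
      rewrite ler_pdivrMr // mul1r mulrC; apply: le_trans thr.
      by rewrite lerBlDl.
    by lra.
  have i2 := der_sub_le (fun y => eta / 2 * y) (prim chi) (fun=> eta / 2) chi x (x + th) xth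
    dlin (der_prim _ cchi) hlow.
  have i4 : 0 < eta / 2 * th by rewrite mulr_gt0 // divr_gt0.
  move: i1 i2 i3 i4; rewrite (prim0 chi) //; lra.
have : 0 < c * prim chi 1 * (b1 - a1).
  by rewrite !mulr_gt0 // subr_gt0 (lt_trans a1t).
by move: V1 V2; lra.
Qed.
End Lyapunov.

(** * Orbits of the semiflow *)

Section UnitInterval.
Context {R : realType}.

Lemma within01_cont (f : R -> R) : {within `[0, 1], continuous f} ->
  continuous (fun x => f (clamp01 x)).
Proof.
move=> /subspace_continuousP hf x; have xI := clamp01_itv x.
have xI' : `[0, 1]%classic (clamp01 x) by rewrite /= in_itv.
have := cvg_comp (@clamp01 R) f _ (hf _ xI'); apply => A hA.
have hA' : \forall y \near x, `[0, 1]%classic (clamp01 y) -> A (clamp01 y)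
  := @cont_clamp01 R x _ hA.
by apply: (filterS _ hA') => y hy; apply: hy; rewrite /= in_itv; exact: clamp01_itv.
Qed.

Lemma cvg_at0 (g : R -> R) l : {within `[0, 1], continuous g} ->
  g x @[x --> 0^'+] --> l -> l = g 0.
Proof.
move=> /within01_cont cg hg.
have h1 : g (clamp01 x) @[x --> 0^'+] --> g 0.
  rewrite -{2}(@clamp01_id R 0) ?lexx ?ler01 //.
  by apply: cvg_at_right_filter; exact: cg.
have h2 : g x @[x --> 0^'+] --> g 0; last first.
  by rewrite -(cvg_lim (@Rhausdorff R) hg) (cvg_lim (@Rhausdorff R) h2).
apply: cvg_trans h1; apply: near_eq_cvg.
near=> x; rewrite clamp01_id //; apply/andP; split.
  by apply: ltW; near: x; exact: nbhs_right_gt.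
by apply: ltW; near: x; exact: nbhs_right_lt.
Unshelve. all: by end_near.
Qed.

Lemma cvg_at1 (g : R -> R) l : {within `[0, 1], continuous g} ->
  g x @[x --> 1^'-] --> l -> l = g 1.
Proof.
move=> /within01_cont cg hg.
have h1 : g (clamp01 x) @[x --> 1^'-] --> g 1.
  rewrite -{2}(@clamp01_id R 1) ?lexx ?ler01 //.
  by apply: cvg_at_left_filter; exact: cg.
have h2 : g x @[x --> 1^'-] --> g 1; last first.
  by rewrite -(cvg_lim (@Rhausdorff R) hg) (cvg_lim (@Rhausdorff R) h2).
apply: cvg_trans h1; apply: near_eq_cvg.
near=> x; rewrite clamp01_id //; apply/andP; split.
  by apply: ltW; near: x; exact: nbhs_left_gt.
by apply: ltW; near: x; exact: nbhs_left_lt.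
Unshelve. all: by end_near.
Qed.

Lemma bounded_continuous_at (T : R) (g : R -> R -> R) t x :
  bounded_continuous T g -> 0 < t < T -> 0 < x < 1 ->
  {for (t, x), continuous (fun z : R * R => g z.1 z.2)}.
Proof.
move=> [/subspace_continuousP cg _] tT x01.
have zQ : [set z : R * R | 0 < z.1 < T /\ 0 < z.2 < 1] (t, x) by [].
have := cg _ zQ; apply: cvg_trans => A; rewrite /within /= => hA.
have nt : \forall s \near t, 0 < s < T.
  case/andP: tT => t0 t1; have i0 : \forall y \near t, 0 < y by exact: lt_nbhsr.
  have i1 : \forall y \near t, y < T by exact: lt_nbhsl.
  by apply: filterS2 i0 i1 => y -> ->.
have n2 : \forall z \near (t, x), 0 < z.1 < T /\ 0 < z.2 < 1.
  exists ([set s | 0 < s < T], [set y | 0 < y < 1]).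
    by split; [exact: nt | exact: near_in01].
  by move=> z [].
by apply: filterS2 n2 hA => z h1 h2; exact: h2.
Qed.

End UnitInterval.

(** * Elements of the phase space as functions of class C^1 *)

Section Embedding.
Context {R : realType} {X : completeNormedModType R}.
Variable ev : X -> R -> R.
Hypothesis X_C1 : embedded_in_C1 ev.

(** A slope on the closed interval is fixed once and for all, as [derive1] at 0 or 1 would depend on
    the irrelevant values outside [0, 1]. *)
Lemma slope_exists : exists dv : X -> R -> R, forall phi, C1_on01 (ev phi) (dv phi).
Proof. by have [_ _ /choice[dv hdv] _] := X_C1; exists dv. Qed.

Variable dv : X -> R -> R.
Hypothesis hdv : forall phi, C1_on01 (ev phi) (dv phi).

Lemma ev_within phi : {within `[0, 1], continuous (ev phi)}.
Proof. by have [] := hdv phi. Qed.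

Lemma dv_within phi : {within `[0, 1], continuous (dv phi)}.
Proof. by have [] := hdv phi. Qed.

Lemma dv_derive1 phi x : 0 < x < 1 -> derive1 (ev phi) x = dv phi x.
Proof. by move=> x01; have [_ _ h] := hdv phi; have [] := h x x01. Qed.

Lemma der_ev phi x : 0 < x < 1 -> der (ev phi) x (dv phi x).
Proof.
move=> x01; rewrite -dv_derive1 //; apply: derivable_der.
by have [_ _ h] := hdv phi; have [] := h x x01.
Qed.

Lemma evB phi psi x : 0 <= x <= 1 -> ev (phi - psi) x = ev phi x - ev psi x.
Proof.
move=> x01; have [lin _ _ _] := X_C1.
by rewrite addrC -scaleN1r lin // mulN1r addrC.
Qed.

Lemma ev_inj phi psi : (forall x, 0 <= x <= 1 -> ev phi x = ev psi x) -> phi = psi.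
Proof. by have [_ h _ _] := X_C1; exact: h. Qed.

Lemma dvB phi psi x : 0 < x < 1 -> dv (phi - psi) x = dv phi x - dv psi x.
Proof.
move=> x01; apply: (der_unique (ev (phi - psi)) x); first exact: der_ev.
apply: (der_ext (fun y => ev phi y - ev psi y)); last first.
  by apply: der_sub; exact: der_ev.
apply: filterS (near_in01 x x01) => y /itv01_open_closed y01; by rewrite evB.
Qed.

Lemma ev_C1_bound : exists2 C, 0 <= C & forall phi x, 0 <= x <= 1 ->
  `|ev phi x| <= C * `|phi| /\ `|dv phi x| <= C * `|phi|.
Proof.
have [_ _ _ [C hC]] := X_C1; exists `|C| => // phi x x01.
have CC : C * `|phi| <= `|C| * `|phi| by rewrite ler_wpM2r // ler_norm.
have [h1 h2] := hC phi; split; first exact: le_trans (h1 x x01) CC.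
have cd : continuous (fun y => `|dv phi (clamp01 y)|).
  by move=> y; apply: cvg_norm; exact: (within01_cont _ (dv_within phi)).
have := le_on_closure _ (`|C| * `|phi|) x cd _ x01; rewrite clamp01_id //; apply.
move=> y y01; rewrite clamp01_id ?itv01_open_closed // -dv_derive1 //.
exact: le_trans (h2 y y01) CC.
Qed.

Lemma ev_C1_lip : exists2 C, 0 <= C & forall phi psi x, 0 <= x <= 1 ->
  `|ev phi x - ev psi x| <= C * `|phi - psi| /\ `|dv phi x - dv psi x| <= C * `|phi - psi|.
Proof.
have [C C0 hC] := ev_C1_bound; exists C => // phi psi x x01.
split; first by rewrite -evB //; have [] := hC (phi - psi) x x01.
have c1 := within01_cont _ (dv_within phi); have c2 := within01_cont _ (dv_within psi).
have cd : continuous (fun y => `|dv phi (clamp01 y) - dv psi (clamp01 y)|).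
  by move=> y; apply: cvg_norm; exact: (cvgB (c1 y) (c2 y)).
have := le_on_closure _ (C * `|phi - psi|) x cd _ x01; rewrite clamp01_id //; apply.
move=> y y01; have y01' := itv01_open_closed _ y01; rewrite clamp01_id // -dvB //.
by have [] := hC (phi - psi) y y01'.
Qed.

Lemma ev_eq phi psi : (forall x, 0 < x < 1 -> ev phi x = ev psi x) -> phi = psi.
Proof.
move=> h; apply: ev_inj => x x01.
have c1 := within01_cont _ (ev_within phi); have c2 := within01_cont _ (ev_within psi).
have cd : continuous (fun y => `|ev phi (clamp01 y) - ev psi (clamp01 y)|).
  by move=> y; apply: cvg_norm; exact: (cvgB (c1 y) (c2 y)).
have := le_on_closure _ 0 x cd _ x01; rewrite clamp01_id // => k.
apply/eqP; rewrite -subr_eq0 -normr_le0; apply: k => y y01.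
by rewrite clamp01_id ?itv01_open_closed // h // subrr normr0.
Qed.

End Embedding.

(** * Global orbits as classical solutions *)

Section Semiflow.
Context {R : realType} {X : completeNormedModType R}.
Variables (f : R -> R -> R -> R -> R -> R) (bc0 bc1 : boundary_condition R).
Variables (ev : X -> R -> R) (P : set X) (S : R -> X -> X).
Hypotheses (f_C1 : class_C1 f) (f_parabolic : parabolic f).
Hypothesis X_C1 : embedded_in_C1 ev.
Hypothesis S_classical : classical_semiflow f bc0 bc1 ev P S.
Variable dv : X -> R -> R.
Hypothesis hdv : forall phi, C1_on01 (ev phi) (dv phi).

Lemma equilibriumP phi : equilibrium f bc0 bc1 ev P phi <->
  P phi /\ forall t, 0 <= t -> S t phi = phi.
Proof.
have [[_ S0 _ _] cl] := S_classical; split => -[Pphi h]; split => //.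
- move=> t; rewrite le_eqVlt => /predU1P[<-|t0]; first exact: S0.
  apply: (ev_eq ev X_C1 dv hdv) => x x01.
  have t1 : 0 < t + 1 by rewrite ltr_wpDl // ltW.
  have := (cl phi (t + 1) (fun=> ev phi) Pphi t1).1 (h _ t1) t x.
  by rewrite t0 ltrDl ltr01 => ->.
- move=> T T0; apply/(cl phi T _ Pphi T0) => t x /andP[t0 _] _.
  by rewrite h // ltW.
Qed.

(** Any time is a whole number of equal steps of length at most [d]. *)
Lemma fixed_extends phi d : P phi -> 0 < d -> (forall t, 0 <= t <= d -> S t phi = phi) ->
  forall t, 0 <= t -> S t phi = phi.
Proof.
have [[_ S0 SD _] _] := S_classical => Pphi d0 h t t0.
have td : 0 < d / (t + 1) by rewrite divr_gt0 // ltr_wpDl.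
have [n n0 hn] := inv_nat_lt _ td.
have n0' : 0 < n%:R :> R by rewrite ltr0n.
pose r := t / n%:R; have r0 : 0 <= r by rewrite divr_ge0.
have rd : r <= d.
  have t1 : 0 < t + 1 by rewrite ltr_wpDl.
  move: hn; rewrite ltr_pdivlMr // => /ltW hn; apply: le_trans hn.
  by rewrite /r mulrC ler_wpM2l ?invr_ge0 // lerDl.
have Sr : S r phi = phi by apply: h; rewrite r0 rd.
have Sk k : S (k%:R * r) phi = phi.
  elim: k => [|k IH]; first by rewrite mul0r S0.
  by rewrite -natr1 mulrDl mul1r SD ?mulr_ge0 // Sr.
have -> : t = n%:R * r by rewrite /r mulrC divfK // gt_eqF.
exact: Sk.
Qed.

Variable gam : R -> X.
Hypothesis gam_orbit : global_orbit P S gam.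

Lemma gam_shift t s : 0 <= s -> gam (t + s) = S s (gam t).
Proof. by move=> s0; rewrite addrC; have [_ h] := gam_orbit; exact: h. Qed.

Lemma gam_classical t0 T : 0 < T ->
  classical_solution f bc0 bc1 T (ev (gam t0)) (fun s => ev (gam (t0 + s))).
Proof.
move=> T0; have [_ cl] := S_classical; have [Pg _] := gam_orbit.
apply/(cl (gam t0) T _ (Pg t0) T0) => s x /andP[s0 _] _.
by rewrite gam_shift // ltW.
Qed.

(** The semiflow is continuous within nonnegative times. Viewing gam(s) as evolved from gam(t - 1)
    for about one unit of time moves the question to an interior time. *)
Lemma gam_continuous : continuous gam.
Proof.
move=> t; have [[_ _ _ /subspace_continuousP cS] _] := S_classical.
have [Pg _] := gam_orbit.
have z0 : [set z : R * X | 0 <= z.1 /\ P z.2] (1, gam (t - 1)).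
  by split => /=; [exact: ler01 | exact: Pg].
have e : gam t = S 1 (gam (t - 1)) by rewrite -gam_shift ?ler01 // subrK.
have : gam s @[s --> t] --> S 1 (gam (t - 1)); last by rewrite -e.
move=> A hA.
have h2 : \forall z \near ((1, gam (t - 1)) : R * X), (0 <= z.1 /\ P z.2) -> A (S z.1 z.2)
  := cS _ z0 A hA.
have c : continuous (fun s : R => (s - (t - 1), gam (t - 1))).
  by apply: cont_pair; [apply: contB; [exact: cont_id|exact: cont_cst]|exact: cont_cst].
have t1 : t - (t - 1) = 1 by rewrite opprB addrC subrK.
have {}h2 : \forall z \near ((t - (t - 1), gam (t - 1)) : R * X),
    (0 <= z.1 /\ P z.2) -> A (S z.1 z.2) by rewrite t1.
have h3 : \forall s \near t, 0 <= s - (t - 1) /\ P (gam (t - 1)) ->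
    A (S (s - (t - 1)) (gam (t - 1))) := c t _ h2.
have h4 : \forall s \near t, t - 1 < s by apply: lt_nbhsr; rewrite gtrBl.
apply: filterS2 h3 h4 => s k1 k2.
have s0 : 0 <= s - (t - 1) by rewrite subr_ge0 ltW.
have E : gam s = S (s - (t - 1)) (gam (t - 1)) by rewrite -gam_shift // addrC subrK.
suff : A (gam s) by [].
rewrite E; by apply: k1; split => //; exact: Pg.
Qed.

Lemma dv_at t x : 0 < x < 1 -> derive1 (ev (gam t)) x = dv (gam t) x.
Proof. by move=> x01; exact: dv_derive1. Qed.

Let U t x := ev (gam t) x.
Let Ux t x := dv (gam t) x.
Let Uxx t x := derive1 (derive1 (ev (gam t))) x.
Let Ut t x := derive1 (fun s => ev (gam s) x) t.

(** Classical solutions satisfy the equation for positive times, so the state at t is taken as the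
    state at time 1 of the solution on ]0, 2[ that starts from gam(t - 1). *)
Lemma gam_pointwise t x : 0 < x < 1 -> [/\ der (Ux t) x (Uxx t x),
  der (fun s => U s x) t (Ut t x) & f x (U t x) (Ux t x) (Uxx t x) (Ut t x) = 0].
Proof.
move=> x01; have [h _ _ _] := gam_classical (t - 1) 2 ltac:(by []).
have i12 : 0 < (1 : R) < 2 by rewrite ltr01 ltrDl ltr01.
have [d1 _ d3 d4] := h 1 x i12 x01; rewrite subrK in d3 d4.
have ht : der (fun s => U s x) t (derive1 (fun s => ev (gam (t - 1 + s)) x) 1).
  have e s : U s x = (fun r => ev (gam (t - 1 + r)) x) (s - (t - 1)).
    by rewrite /U /= addrC subrK.
  apply: (der_ext (fun s => (fun r => ev (gam (t - 1 + r)) x) (s - (t - 1)))).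
    by apply: filterE => s; rewrite e.
  have hs : der (fun s => s - (t - 1)) t (1 - 0).
    by apply: der_sub; [exact: der_var|exact: der_const].
  have d1' := derivable_der _ _ d1.
  have e1 : t - (t - 1) = 1 by rewrite opprB addrC subrK.
  have d1'' : der (fun r => ev (gam (t - 1 + r)) x) (t - (t - 1))
     (derive1 (fun s => ev (gam (t - 1 + s)) x) 1) by rewrite e1.
  by apply: der_to; [exact: (der_comp _ (fun s => s - (t - 1)) t _ _ d1'' hs)|rewrite subr0 mulr1].
have e2 : derive1 (fun s => ev (gam (t - 1 + s)) x) 1 = Ut t x.
  by rewrite /Ut (der_derive1 _ _ _ ht).
rewrite e2 in ht d4; split => //.
- apply: (der_ext (derive1 (ev (gam t)))); last exact: derivable_der.
  by apply: filterS (near_in01 x x01) => y y01; rewrite dv_at.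
- by rewrite /Ux -dv_at.
Qed.

(** If u_t vanished throughout, the orbit would rest on [a, b] and hence for ever. *)
Lemma gam_moves a b : a < b -> ~ equilibrium f bc0 bc1 ev P (gam a) ->
  exists t x, [/\ a < t < b, 0 < x < 1 & Ut t x != 0].
Proof.
move=> ab nE; apply: contrapT => none; apply: nE.
have [Pg _] := gam_orbit.
have Z t x : a < t < b -> 0 < x < 1 -> Ut t x = 0.
  by move=> tab x01; apply/eqP/negPn/negP => h; apply: none; exists t, x.
apply/equilibriumP; split; first exact: Pg.
have ba : 0 < b - a by rewrite subr_gt0.
apply: (fixed_extends (gam a) (b - a) (Pg a) ba) => t /andP[t0 tb].
rewrite -gam_shift //; apply: (ev_eq ev X_C1 dv hdv) => x x01.
move: t0; rewrite le_eqVlt => /predU1P[<-|t0]; first by rewrite addr0.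
have at_ : a < a + t by rewrite ltrDl.
have d y : y \in `]a, a + t[%R -> is_derive y 1 (fun s => U s x) (Ut y x).
  by move=> _; have [_ h _] := gam_pointwise y x x01; exact: h.
have c : {within `[a, a + t], continuous (fun s => U s x)}.
  apply: continuous_subspaceT => y; have [_ h _] := gam_pointwise y x x01.
  exact: der_continuous h.
have [z] := MVT at_ d c; rewrite in_itv /= => /andP[z1 z2].
rewrite Z ?mul0r //; last by rewrite z1 (lt_le_trans z2) // -lerBrDl.
by move=> /eqP; rewrite subr_eq0 => /eqP.
Qed.

Lemma shift_at (G : R -> R -> R) t x : {for (1, x), continuous (fun z : R * R => G z.1 z.2)} ->
  {for (t, x), continuous (fun z : R * R => G (z.1 - (t - 1)) z.2)}.
Proof.
move=> cG A hA.
have t1 : t - (t - 1) = 1 by rewrite opprB addrC subrK.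
have cs : continuous (fun z : R * R => (z.1 - (t - 1), z.2)) by cont_tac.
have {}cG : {for (t - (t - 1), x), continuous (fun z : R * R => G z.1 z.2)} by rewrite t1.
exact: (cs (t, x) _ (cG A hA)).
Qed.

(** The boundary conditions concern limits of u and u_x at the ends; by continuity these limits are
    the end values of [ev] and [dv]. *)
Lemma gam_to_orbit (F : R -> R -> R -> R) (M : R) :
  (forall x u p, 0 <= x <= 1 -> f x u p (F x u p) 0 = 0) ->
  (forall t x, 0 <= x <= 1 -> `|U t x| <= M /\ `|Ux t x| <= M) ->
  orbit F M bc0 bc1 U Ux Uxx Ut.
Proof.
move=> hF hM.
have i12 : 0 < (1 : R) < 2 by rewrite ltr01 ltrDl ltr01.
have UtE t0 s x : 0 < x < 1 -> derive1 (fun r => ev (gam (t0 + r)) x) s = Ut (t0 + s) x.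
  move=> x01; apply: der_derive1.
  have [_ d _] := gam_pointwise (t0 + s) x x01.
  have hs : der (fun r => t0 + r) s (0 + 1).
    by apply: der_add; [exact: der_const|exact: der_var].
  by apply: der_to; [exact: (der_comp _ (fun r => t0 + r) s _ _ d hs)|rewrite add0r mulr1].
split.
- by move=> t x x01; exact: (der_ev ev dv hdv (gam t) x x01).
- by move=> t x x01; have [] := gam_pointwise t x x01.
- by move=> t x x01; have [] := gam_pointwise t x x01.
- move=> t x x01; have [_ [_ _ bQ] _ _] := gam_classical (t - 1) 2 ltac:(by []).
  have h := shift_at _ t x (bounded_continuous_at _ _ _ _ bQ i12 x01).
  have E : (fun z : R * R => derive1 (derive1 (ev (gam (t - 1 + (z.1 - (t - 1)))))) z.2)
     = (fun z : R * R => Uxx z.1 z.2).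
    by apply/funext => z; rewrite /Uxx (addrC (t - 1)) subrK.
  by rewrite -E; exact: h.
- move=> t x x01; have [_ [_ bD _] _ _] := gam_classical (t - 1) 2 ltac:(by []).
  have c1 := bounded_continuous_at _ _ _ _ bD i12 x01.
  have {}c1 : {for (1, x), continuous (fun z : R * R => Ut (t - 1 + z.1) z.2)}.
    have k : (fun z : R * R => Ut (t - 1 + z.1) z.2) z @[z --> ((1, x) : R * R)]
        --> derive1 (fun r => ev (gam (t - 1 + r)) x) 1; last by rewrite UtE in k.
    apply: cvg_trans c1; apply: near_eq_cvg.
    have n2 : \forall z \near ((1, x) : R * R), 0 < z.2 < 1.
      exists (setT, [set y | 0 < y < 1]); first by split; [exact: filterT|exact: near_in01].
      by move=> z [].
    by apply: filterS n2 => z z01; rewrite UtE.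
  have h := shift_at (fun s y => Ut (t - 1 + s) y) t x c1.
  have E : (fun z : R * R => Ut (t - 1 + (z.1 - (t - 1))) z.2) = (fun z : R * R => Ut z.1 z.2).
    by apply/funext => z; rewrite (addrC (t - 1)) subrK.
  by rewrite -E; exact: h.
- move=> t; split; last exact: hM.
  + exact: within01_cont (ev_within ev dv hdv (gam t)).
  + exact: within01_cont (dv_within ev dv hdv (gam t)).
- move=> t e e0; have [C C0 hC] := ev_C1_lip ev X_C1 dv hdv.
  have eC : 0 < e / (C + 1) by rewrite divr_gt0 // ltr_wpDl.
  have /cvgrPdist_le/(_ _ eC) := gam_continuous t; apply: filterS => s hs x x01.
  have k : C * `|gam s - gam t| <= e.
    rewrite distrC; apply: (@le_trans _ _ (C * (e / (C + 1)))); first by rewrite ler_wpM2l.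
    by rewrite mulrA ler_pdivrMr ?ltr_wpDl // mulrC ler_wpM2l ?(ltW e0) // lerDl ler01.
  have [h1 h2] := hC (gam s) (gam t) x x01.
  by split; [exact: le_trans h1 k|exact: le_trans h2 k].
- move=> a b.
  have [ab|ba] := leP a b; last first.
    by exists 0 => // s x /andP[h1 h2]; have := le_trans h1 h2; rewrite leNgt ba.
  (* Starting at a - 1 and running until b + 1 puts [a, b] inside the open time interval of the
     solution. *)
  have T0 : 0 < b - a + 2 by rewrite ltr_wpDl ?subr_ge0.
  have [_ [_ [_ [B1 bD]] [_ [B2 bQ]]] _ _] := gam_classical (a - 1) (b - a + 2) T0.
  exists (`|B1| + `|B2|); first by rewrite addr_ge0.
  move=> s x /andP[as_ sb] x01.
  have sI : 0 < s - (a - 1) < b - a + 2 by apply/andP; split; lra.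
  have e1 : a - 1 + (s - (a - 1)) = s by rewrite addrC subrK.
  have := bQ (s - (a - 1), x) (conj sI x01); have := bD (s - (a - 1), x) (conj sI x01).
  rewrite /= UtE // e1 => h1 h2; split.
    by rewrite (le_trans h2) // (le_trans (ler_norm _)) // lerDr.
  by rewrite (le_trans h1) // (le_trans (ler_norm _)) // lerDl.
- move=> t; have [_ _ _ [h0 h1]] := gam_classical (t - 1) 2 ltac:(by []).
  have evc := ev_within ev dv hdv (gam t); have dvc := dv_within ev dv hdv (gam t).
  split.
    move: h0 => [v [v1 [_ _ h]]]; have [c0 c1 hb] := h 1 i12; rewrite subrK in c0 c1.
    have e0 := cvg_at0 _ _ evc c0.
    have c1' : dv (gam t) x @[x --> 0^'+] --> v1 1.
      apply: cvg_trans c1; apply: near_eq_cvg; near=> x.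
      rewrite dv_at //; apply/andP; split; near: x.
        exact: nbhs_right_gt.
      exact: nbhs_right_lt.
    by rewrite /U /Ux -e0 -(cvg_at0 _ _ dvc c1').
  move: h1 => [v [v1 [_ _ h]]]; have [c0 c1 hb] := h 1 i12; rewrite subrK in c0 c1.
  have e0 := cvg_at1 _ _ evc c0.
  have c1' : dv (gam t) x @[x --> 1^'-] --> v1 1.
    apply: cvg_trans c1; apply: near_eq_cvg; near=> x.
    rewrite dv_at //; apply/andP; split; near: x.
      exact: nbhs_left_gt.
    exact: nbhs_left_lt.
  by rewrite /U /Ux -e0 -(cvg_at1 _ _ dvc c1').
- move=> t x x01 Dn; have [_ _ eq] := gam_pointwise t x x01.
  have x01' := itv01_open_closed _ x01.
  exact: (parabolic_sign f f_C1 f_parabolic x (U t x) (Ux t x) (Uxx t x) _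
    (Ut t x) x01' eq (hF _ _ _ x01') Dn).
Unshelve. all: by end_near.
Qed.

End Semiflow.

(** * LaSalle's principle *)

Section Dynamics.
Context {R : realType} {X : completeNormedModType R}.
Variables (P : set X) (S : R -> X -> X) (A : set X).
Hypothesis S_semiflow : semiflow P S.
Hypothesis A_attractor : global_attractor P S A.

Lemma attractor_sub : A `<=` P.
Proof. by have [[]] := A_attractor. Qed.

Lemma attractor_compact : compact A.
Proof. by have [[]] := A_attractor. Qed.

Lemma attractor_closed : closed A.
Proof. by apply: compact_closed attractor_compact; exact: norm_hausdorff. Qed.

Lemma attractor_bounded : exists2 rho, 0 < rho & forall phi, A phi -> `|phi| <= rho.
Proof.
have [M [_ hM]] := compact_bounded attractor_compact.
exists (`|M| + 1); first by rewrite ltr_wpDl.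
by move=> phi Aphi; apply: hM => //; apply: le_lt_trans (ler_norm M) _; rewrite ltrDl.
Qed.

(** Invariance supplies unit-time preimages [b n] inside [A]. The state at t is reached from [b n]
    after time t + n, for any n large enough to make this nonnegative, and does not depend on n. *)
Lemma orbit_through phi : A phi -> exists gam, [/\ global_orbit P S gam, gam 0 = phi &
  forall t, A (gam t)].
Proof.
move=> Aphi; have [S1 S0 SD _] := S_semiflow; have [[AP _ inv] _ _] := A_attractor.
have /choice[pre hpre] : forall psi, exists chi, A psi -> A chi /\ S 1 chi = psi.
  move=> psi; have [Apsi|nA] := pselect (A psi); last by exists psi.
  by move: Apsi; rewrite -{1}(inv 1 ler01) => -[chi Achi e]; exists chi.
pose b n := iter n pre phi.
have Ab n : A (b n).
  by elim: n => [//|n IH] /=; have [] := hpre _ IH.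
have Sb n k : S k%:R (b (n + k)%N) = b n.
  elim: k n => [|k IH] n; first by rewrite addn0 S0 //; exact: AP.
  rewrite -natr1 SD //; last by exact: AP.
  by rewrite addnS /= (proj2 (hpre _ (Ab _))) IH.
pose nn (t : R) := (Num.truncn `|t|).+1.
have nt (t : R) : 0 <= t + (nn t)%:R.
  have h1 : `|t| < (nn t)%:R by exact: truncnS_gt.
  have := ler_norm (- t); rewrite normrN => h2; lra.
have mono (t : R) n m : (n <= m)%N -> 0 <= t + n%:R -> S (t + m%:R) (b m) = S (t + n%:R) (b n).
  move=> nm tn; have -> : t + m%:R = (t + n%:R) + (m - n)%:R.
    by rewrite natrB // ; ring.
  have e := Sb n (m - n)%N; rewrite subnKC // in e.
  by rewrite SD ?ler0n ?e //; exact: AP.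
pose gam (t : R) := S (t + (nn t)%:R) (b (nn t)).
have gamE t m : (nn t <= m)%N -> gam t = S (t + m%:R) (b m).
  by move=> tm; rewrite /gam -(mono t _ m tm).
exists gam; split.
- split.
    by move=> t; apply: S1; [exact: nt|exact: AP].
  move=> s t s0; pose m := maxn (nn (s + t)) (nn t).
  have h1 : (nn (s + t)%R <= m)%N by rewrite leq_maxl.
  have h2 : (nn t <= m)%N by rewrite leq_maxr.
  rewrite (gamE _ m h1) (gamE _ m h2) -addrA SD //; last exact: AP.
  apply: le_trans (nt t) _; rewrite lerD2l ler_nat //.
- by rewrite /gam add0r; have := Sb 0%N (nn 0); rewrite add0n.
- move=> t; rewrite /gam.
  by rewrite -(inv _ (nt t)); exists (b (nn t)).
Qed.

(** The range of the orbit is a bounded set, and gam(t) is the image of one of its points after an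
    arbitrarily long time; attraction and closedness of [A] conclude. *)
Lemma bounded_orbit_sub gam : global_orbit P S gam -> bounded_orbit gam ->
  forall t, A (gam t).
Proof.
move=> [Pg Sg] bg t; apply: attractor_closed; have [_ _ att] := A_attractor.
have rP : range gam `<=` P by move=> _ [s _ <-].
move=> B /nbhs_ballP[e /= e0 eB].
have [t0 h] := att _ rP bg e e0.
have m0 : 0 <= Num.max 0 t0 by rewrite le_max lexx.
have m1 : t0 <= Num.max 0 t0 by rewrite le_max lexx orbT.
have [|a Aa ha] := h _ (gam (t - Num.max 0 t0)) m0 m1; first by exists (t - Num.max 0 t0).
exists a; split => //; apply: eB; rewrite -ball_normE /=.
have e2 : S (Num.max 0 t0) (gam (t - Num.max 0 t0)) = gam t by rewrite -Sg // addrC subrK.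
by rewrite e2 in ha.
Qed.

Lemma fixed_in_attractor phi : P phi -> (forall t, 0 <= t -> S t phi = phi) -> A phi.
Proof.
move=> Pphi h; have [_ mx _] := A_attractor.
apply: (mx [set phi]) => //; split.
- by move=> _ ->.
- exact: compact_set1.
- move=> t t0; apply/seteqP; split => [_ [_ -> <-]|_ ->]; first by rewrite /= h.
  by exists phi => //=; rewrite h.
Qed.

Lemma S_continuous_at s psi : 0 <= s -> P psi -> forall e, 0 < e ->
  \forall phi \near psi, P phi -> `|S s phi - S s psi| < e.
Proof.
move=> s0 Ppsi e e0; have [_ _ _ /subspace_continuousP cS] := S_semiflow.
have z0 : [set z : R * X | 0 <= z.1 /\ P z.2] (s, psi) by [].
have := cS _ z0 => /cvgrPdist_lt/(_ _ e0) h.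
have h2 : \forall z \near ((s, psi) : R * X), (0 <= z.1 /\ P z.2) ->
    `|S s psi - S z.1 z.2| < e := h.
have c : continuous (fun phi : X => (s, phi)).
  by apply: cont_pair; [exact: cont_cst|exact: cont_id].
have h3 : \forall phi \near psi, (0 <= s /\ P phi) -> `|S s psi - S s phi| < e := c psi _ h2.
by apply: filterS h3 => phi k Pphi; rewrite distrC; exact: k.
Qed.

Section LaSalle.
Variables (E : set X) (V : X -> R) (CV : R).
Hypothesis CV0 : 0 <= CV.
Hypothesis E_fixed : forall phi, E phi <-> P phi /\ forall t, 0 <= t -> S t phi = phi.
Hypothesis V_lip : forall phi psi, A phi -> A psi -> `|V phi - V psi| <= CV * `|phi - psi|.
Hypothesis orbit_continuous : forall gam, global_orbit P S gam -> continuous gam.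
Hypothesis V_mono : forall gam a b, global_orbit P S gam -> (forall t, A (gam t)) ->
  a <= b -> V (gam b) <= V (gam a).
Hypothesis V_strict : forall gam a b, global_orbit P S gam -> (forall t, A (gam t)) ->
  a < b -> ~ E (gam a) -> V (gam b) < V (gam a).
Hypothesis E_isolated : forall e, E e -> exists2 r, 0 < r &
  forall e', E e' -> `|e' - e| <= r -> e' = e.

Lemma E_sub_A : E `<=` A.
Proof. by move=> phi /E_fixed[Pphi h]; exact: fixed_in_attractor. Qed.

Lemma E_closed : closed E.
Proof.
move=> phi clphi.
have Aphi : A phi by apply: attractor_closed; apply: closureS clphi; exact: E_sub_A.
have Pphi := attractor_sub _ Aphi.
apply/E_fixed; split=> // t t0; apply/eqP; rewrite -subr_eq0 -normr_le0.
apply/ler_addgt0Pr => e e0; rewrite add0r.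
have e2 : 0 < e / 2 by rewrite divr_gt0.
have n1 := S_continuous_at t phi t0 Pphi _ e2.
have n2 : \forall psi \near phi, `|phi - psi| < e / 2.
  by have := nbhsx_ballx phi _ e2; rewrite -ball_normE.
have [psi [Epsi [h1 h2]]] := clphi _ (filterI n1 n2).
have [Ppsi fix_] := (E_fixed psi).1 Epsi.
have {}h1 := h1 Ppsi; rewrite fix_ // in h1.
have -> : S t phi - phi = - (psi - S t phi) - (phi - psi).
  by rewrite opprB opprB addrA subrK.
rewrite (le_trans (ler_normB _ _)) // normrN (splitr e) lerD // ltW //.
Qed.

Lemma E_finite : finite_set E.
Proof.
have cE : compact E.
  have -> : E = A `&` E by apply/seteqP; split => [x Ex|x []//]; split=> //; exact: E_sub_A.
  exact: (compact_closedI attractor_compact E_closed).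
have /choice[rad hrad] : forall e, exists r, E e -> 0 < r /\
    (forall e', E e' -> `|e' - e| <= r -> e' = e).
  move=> e; have [Ee|nE] := pselect (E e); last by exists 0.
  by have [r r0 h] := E_isolated e Ee; exists r.
rewrite compact_cover in cE.
have [||D DE cov] := cE X E (fun e => ball e (rad e)).
- by move=> e Ee; apply: ball_open; have [] := hrad e Ee.
- by move=> e Ee; exists e => //; apply: ballxx; have [] := hrad e Ee.
apply: (sub_finite_set _ (finite_fset D)) => e Ee.
have [e' De' bee'] := cov e Ee.
have Ee' : E e' by apply/set_mem/DE.
have [_ h] := hrad e' Ee'; rewrite (h e Ee) //.
by move: bee'; rewrite -ball_normE /= distrC => /ltW.
Qed.

(* [FF] stands for the filters at -oo and at +oo, which are generated by
   intervals. *)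
Section LimitSet.
Variables (gam : R -> X) (FF : set_system R) (l : R).
Hypothesis FFP : ProperFilter FF.
Hypotheses (gam_orb : global_orbit P S gam) (gam_A : forall t, A (gam t)).
Hypothesis FF_itv : forall W, FF W -> exists2 W', FF W' & W' `<=` W /\
  forall a b t, W' a -> W' b -> a <= t <= b -> W' t.
Hypothesis V_lim : forall e, 0 < e -> \forall t \near FF,
  `|V (gam t) - l| <= e /\ `|V (gam (1 + t)) - l| <= e.

Lemma limit_in_A psi : cluster (gam @ FF) psi -> A psi.
Proof.
move=> cl; apply: attractor_closed => B nB.
have FA : \forall t \near FF, A (gam t) by apply: filterE => t; exact: gam_A.
exact: cl FA nB.
Qed.

(** [V_lim] follows t and 1 + t together, so that V is found to take the same value at a limit point
    and at its image after unit time, which strict decay allows only at equilibria. *)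
Lemma limit_V psi : cluster (gam @ FF) psi -> V psi = l /\ V (S 1 psi) = l.
Proof.
move=> cl; have Apsi := limit_in_A _ cl; have Ppsi := attractor_sub _ Apsi.
have [[_ _ inv] _ _] := A_attractor.
have AS phi : A phi -> A (S 1 phi).
  by move=> Aphi; rewrite -(inv 1 ler01); exists phi.
have K e : 0 < e -> `|V psi - l| <= e /\ `|V (S 1 psi) - l| <= e.
  move=> e0; pose d := e / 2 / (CV + 1).
  have d0 : 0 < d by rewrite !divr_gt0 // ltr_wpDl.
  have CVd (z : R) : z <= d -> CV * z <= e / 2.
    move=> zd; apply: (@le_trans _ _ (CV * d)); first by rewrite ler_wpM2l.
    rewrite /d mulrA ler_pdivrMr ?ltr_wpDl // mulrC ler_wpM2l ?lerDl ?ler01 //.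
    by rewrite divr_ge0 // ltW.
  have e2 : 0 < e / 2 by rewrite divr_gt0.
  have n1 := S_continuous_at 1 psi ler01 Ppsi _ d0.
  have n2 : \forall phi \near psi, `|psi - phi| < d.
    by have := nbhsx_ballx psi _ d0; rewrite -ball_normE.
  pose G0 := [set phi | exists t, [/\ phi = gam t,
      `|V (gam t) - l| <= e / 2 & `|V (gam (1 + t)) - l| <= e / 2]].
  have G : \forall t \near FF, G0 (gam t).
    by apply: filterS (V_lim _ e2) => t [h1 h2]; exists t.
  have [phi [[t [-> v1 v2]] [k1 k2]]] := cl G0 _ G (filterI n1 n2).
  have {}k1 := k1 (attractor_sub _ (gam_A t)).
  have gt1 : gam (1 + t) = S 1 (gam t) by have [_ h] := gam_orb; exact: h.
  rewrite gt1 in v2; split.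
    have -> : V psi - l = (V psi - V (gam t)) + (V (gam t) - l) by ring.
    rewrite (le_trans (ler_normD _ _)) // (splitr e) lerD //.
    by apply: (le_trans (V_lip _ _ Apsi (gam_A t))); apply: CVd; exact: ltW.
  have -> : V (S 1 psi) - l = (V (S 1 psi) - V (S 1 (gam t))) + (V (S 1 (gam t)) - l) by ring.
  rewrite (le_trans (ler_normD _ _)) // (splitr e) lerD //.
  apply: (le_trans (V_lip _ _ (AS _ Apsi) (AS _ (gam_A t)))); apply: CVd.
  by rewrite distrC ltW.
have Z (a : R) : (forall e, 0 < e -> `|a - l| <= e) -> a = l.
  move=> h; apply/eqP; rewrite -subr_eq0 -normr_le0.
  by apply/ler_addgt0Pr => e e0; rewrite add0r; exact: h.
by split; apply: Z => e e0; have [] := K e e0.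
Qed.

(** Strict decay is a statement about complete orbits, hence the passage to an orbit in [A] through
    [psi]. *)
Lemma limit_equilibrium psi : cluster (gam @ FF) psi -> E psi.
Proof.
move=> cl; apply: contrapT => nE; have Apsi := limit_in_A _ cl.
have [g [gorb g0 gA]] := orbit_through _ Apsi.
have nE' : ~ E (g 0) by rewrite g0.
have := V_strict g 0 1 gorb gA ltr01 nE'.
have -> : g 1 = S 1 psi by rewrite -g0; have [_ h] := gorb; rewrite -h ?ler01 // addr0.
by rewrite g0; have [-> ->] := limit_V _ cl; rewrite ltxx.
Qed.

(** With a second limit point the orbit would, in every interval of the filter base, come near both
    and so cross the sphere of isolation radius around the first. A limit point along the crossing
    times would be an equilibrium on that sphere. *)
Lemma limit_singleton : exists2 e, E e & cluster (gam @ FF) = [set e] /\ V e = l.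
Proof.
have FA : \forall t \near FF, A (gam t) by apply: filterE => t; exact: gam_A.
have [e [Ae cle]] := attractor_compact (gam @ FF) _ FA.
have Ee := limit_equilibrium _ cle.
exists e => //; split; last by have [] := limit_V _ cle.
apply/seteqP; split => [e' cle'|_ ->//].
apply: contrapT => /eqP ne; have Ee' := limit_equilibrium _ cle'.
have [r r0 hr] := E_isolated e Ee.
have re' : r < `|e' - e|.
  by rewrite ltNge; apply/negP => h; move: ne; rewrite (hr e' Ee' h) eqxx.
pose Z := [set t | `|gam t - e| = r].
have cg := orbit_continuous gam gam_orb.
have cn : continuous (fun t => `|gam t - e|).
  by move=> t; apply: cvg_norm; exact: (cvgB (cg t) (cvg_cst e)).
have meet W : FF W -> exists2 t, W t & Z t.
  move=> /FF_itv[W' FW' [W'W conv]].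
  pose G0 := [set phi | exists2 t, W' t & phi = gam t].
  have G : \forall t \near FF, G0 (gam t).
    by apply: filterS FW' => t Wt; exists t.
  have n1 : \forall phi \near e, `|e - phi| < r.
    by have := nbhsx_ballx e _ r0; rewrite -ball_normE.
  have d0 : 0 < `|e' - e| - r by rewrite subr_gt0.
  have n2 : \forall phi \near e', `|e' - phi| < `|e' - e| - r.
    by have := nbhsx_ballx e' _ d0; rewrite -ball_normE.
  have [_ [[t1 W1 ->] h1]] := cle G0 _ G n1.
  have [_ [[t2 W2 ->] h2]] := cle' G0 _ G n2.
  have g1 : `|gam t1 - e| <= r by rewrite distrC ltW.
  have g2 : r <= `|gam t2 - e|.
    have : `|e' - e| <= `|e' - gam t2| + `|gam t2 - e| by exact: ler_distD.
    by move: h2; lra.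
  have [t12|t21] := leP t1 t2.
    have [] := @IVT R (fun t => `|gam t - e|) t1 t2 r t12.
    - exact: continuous_subspaceT.
    - by rewrite ge_min g1 le_max g2 orbT.
    move=> t; rewrite in_itv /= => tI tr; exists t => //.
    by apply: W'W; exact: conv W1 W2 tI.
  have [] := @IVT R (fun t => `|gam t - e|) t2 t1 r (ltW t21).
  - exact: continuous_subspaceT.
  - by rewrite ge_min g1 orbT le_max g2.
  move=> t; rewrite in_itv /= => tI tr; exists t => //.
  by apply: W'W; exact: conv W2 W1 tI.
have FZ : ProperFilter (within Z FF).
  apply: Build_ProperFilter_ex => W /meet[t Wt Zt].
  by exists t; exact: Wt.
have FA' : \forall t \near within Z FF, A (gam t) by apply: filterE => t; exact: gam_A.
have [psi [Apsi clpsi]] := attractor_compact (gam @ within Z FF) _ FA'.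
have clpsi' : cluster (gam @ FF) psi.
  move=> B C hB hC.
  have hB' : \forall t \near within Z FF, B (gam t).
    have {}hB : \forall t \near FF, B (gam t) := hB.
    by rewrite near_withinE; apply: (filterS _ hB) => t Bt _; exact: Bt.
  exact: clpsi B C hB' hC.
have psir : `|psi - e| = r.
  apply/eqP; rewrite -subr_eq0 -normr_le0; apply/ler_addgt0Pr => d d0; rewrite add0r.
  have n1 : \forall phi \near psi, `|psi - phi| < d.
    by have := nbhsx_ballx psi _ d0; rewrite -ball_normE.
  have G : \forall t \near within Z FF, [set phi | `|phi - e| = r] (gam t).
    by rewrite near_withinE; apply: filterE => t.
  have [phi [/= hr' hd]] := clpsi [set phi | `|phi - e| = r] _ G n1.
  rewrite -hr'; apply: le_trans (ler_dist_dist _ _) _.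
  have -> : psi - e - (phi - e) = psi - phi by rewrite opprB addrA subrK.
  exact: ltW.
have Epsi := limit_equilibrium _ clpsi'.
have pe : psi = e by apply: hr => //; rewrite psir.
by move: psir; rewrite pe subrr normr0 => r0'; rewrite -r0' ltxx in r0.
Qed.

End LimitSet.

Lemma pinfty_itv (W : set R) : (+oo%R : set_system R) W ->
  exists2 W', (+oo%R : set_system R) W' & W' `<=` W /\
  forall a b t, W' a -> W' b -> a <= t <= b -> W' t.
Proof.
move=> [m [mr hm]]; exists [set t | m < t].
  by exists m; split.
split; first by move=> t /= /hm.
by move=> a b t /= ma _ /andP[at_ _]; exact: lt_le_trans at_.
Qed.

Lemma ninfty_itv (W : set R) : (-oo%R : set_system R) W ->
  exists2 W', (-oo%R : set_system R) W' & W' `<=` W /\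
  forall a b t, W' a -> W' b -> a <= t <= b -> W' t.
Proof.
move=> [m [mr hm]]; exists [set t | t < m].
  by exists m; split.
split; first by move=> t /= /hm.
by move=> a b t /= _ mb /andP[_ tb]; exact: le_lt_trans mb.
Qed.

Lemma V_bounded : exists B, forall phi, A phi -> `|V phi| <= B.
Proof.
have [rho rho0 hrho] := attractor_bounded.
have [[phi0 A0]|nA] := pselect (exists phi, A phi); last first.
  by exists 0 => phi Aphi; case: nA; exists phi.
exists (`|V phi0| + CV * (rho + rho)) => phi Aphi.
have -> : V phi = V phi0 + (V phi - V phi0) by ring.
rewrite (le_trans (ler_normD _ _)) // lerD2l (le_trans (V_lip _ _ Aphi A0)) //.
by rewrite ler_wpM2l // (le_trans (ler_normB _ _)) // lerD // hrho.
Qed.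

(** By monotonicity V tends to [sup W] at -oo and to [inf W] at +oo. Equal limit equilibria would
    make V constant along the orbit, against its strict decrease from time 0 to time 1. *)
Lemma connecting_orbit gam : global_orbit P S gam -> (forall t, A (gam t)) ->
  ~ E (gam 0) -> heteroclinic E P S gam.
Proof.
move=> gorb gA nE; split => //; have [B hB] := V_bounded.
pose W := [set V (gam t) | t in setT].
have W0 : W !=set0 by exists (V (gam 0)); exists 0.
have mono a b : a <= b -> V (gam b) <= V (gam a) by exact: V_mono.
have hsup : has_sup W.
  split=> //; exists B => _ [t _ <-]; exact: le_trans (ler_norm _) (hB _ (gA t)).
have hinf : has_inf W.
  split=> //; exists (- B) => _ [t _ <-].
  by have := hB _ (gA t); rewrite ler_norml => /andP[].
have ub t : V (gam t) <= sup W by apply: ub_le_sup; [case: hsup|exists t].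
have lb t : inf W <= V (gam t) by apply: ge_inf; [case: hinf|exists t].
have limP e : 0 < e -> \forall t \near +oo%R,
    `|V (gam t) - inf W| <= e /\ `|V (gam (1 + t)) - inf W| <= e.
  move=> e0; have [_ [T _ <-] hT] := inf_adherent e0 hinf.
  have k t : T <= t -> `|V (gam t) - inf W| <= e.
    move=> Tt; rewrite ger0_norm ?subr_ge0 // lerBlDl.
    by apply: le_trans (mono _ _ Tt) _; exact: ltW.
  exists T; split; first exact: num_real.
  move=> t Tt; split; apply: k; first exact: ltW.
  by apply: (le_trans (ltW Tt)); rewrite lerDr ler01.
have limN e : 0 < e -> \forall t \near -oo%R,
    `|V (gam t) - sup W| <= e /\ `|V (gam (1 + t)) - sup W| <= e.
  move=> e0; have [_ [T _ <-] hT] := sup_adherent e0 hsup.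
  have k t : t <= T -> `|V (gam t) - sup W| <= e.
    move=> tT; rewrite distrC ger0_norm ?subr_ge0 // lerBlDr -lerBlDl.
    by apply: le_trans (mono _ _ tT); exact: ltW.
  (* One unit earlier, as 1 + t must lie below [T] as well. *)
  exists (T - 1); split; first exact: num_real.
  move=> t tT; split; apply: k.
    by apply: (le_trans (ltW tT)); rewrite gerBl ler01.
  by rewrite addrC -lerBrDr ltW.
have [e1 Ee1 [a1 v1]] := limit_singleton gam (-oo%R) (sup W) _ gorb gA ninfty_itv limN.
have [e2 Ee2 [a2 v2]] := limit_singleton gam (+oo%R) (inf W) _ gorb gA pinfty_itv limP.
exists e1, e2; split => // e12.
have := V_strict gam 0 1 gorb gA ltr01 nE; rewrite ltNge => /negP; apply.
by apply: le_trans (ub 0) _; apply: le_trans (lb 1); rewrite -v1 -v2 e12.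
Qed.

Lemma attractor_structure : finite_set E /\
  A = E `|` [set phi | exists gam : R -> X,
        [/\ heteroclinic E P S gam, bounded_orbit gam & exists t, gam t = phi]].
Proof.
split; first exact: E_finite.
apply/seteqP; split => [phi Aphi|phi [|[gam [[gorb _] bg [t <-]]]]].
- have [Ephi|nE] := pselect (E phi); [by left|right].
  have [gam [gorb g0 gA]] := orbit_through _ Aphi.
  exists gam; split; last by exists 0.
    by apply: connecting_orbit => //; rewrite g0.
  have [rho rho0 hrho] := attractor_bounded.
  exists rho; split; first exact: num_real.
  by move=> m rm _ [t _ <-]; apply: le_trans (hrho _ (gA t)) _; exact: ltW.
- exact: E_sub_A.
- exact: bounded_orbit_sub.
Qed.

End LaSalle.
End Dynamics.

(** * Isolation of hyperbolic equilibria *)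

Section RealResolvent.
Context {R : realType}.
Variables (f : R -> R -> R -> R -> R -> R) (bc0 bc1 : boundary_condition R).

Lemma derive1_zero : derive1 (fun _ : R => 0 : R) = fun=> 0.
Proof. by apply/funext => x; rewrite derive1_cst. Qed.

Lemma linearized_bc0 (bc : boundary_condition R) c : bc_holds (linearized_bc bc c) 0 0.
Proof. by case: bc => [|b] //=; rewrite mulr0. Qed.

Lemma C1_on01_zero : C1_on01 (fun _ : R => 0) (fun=> 0).
Proof.
split; [exact: continuous_subspaceT (cont_cst 0)|exact: continuous_subspaceT (cont_cst 0)|].
by move=> x _; split; [exact: derivable_cst | rewrite derive1_cst].
Qed.

(** The point 0 lies on the imaginary axis, hence in the resolvent set; a real function enters the
    complex estimate with zero imaginary part. *)
Lemma real_resolvent v : hyperbolic f bc0 bc1 v -> exists2 M, 0 <= M &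
  forall w K, linearization_dom bc0 bc1 v w ->
  (forall x, 0 < x < 1 -> `|linearization f v w x| <= K) ->
  forall x, 0 <= x <= 1 -> `|w x| <= M * K.
Proof.
move=> hyp; have : resolvent_set f bc0 bc1 v 0.
  by apply: contrapT => h; have /eqP := hyp 0 h.
move=> [_ [M hM]]; exists `|M| => // w K wdom wK x x01.
have K0 : 0 <= K.
  by apply: le_trans (normr_ge0 _) (wK (1 / 2) _); apply/andP; split; lra.
pose wc y : R[i] := Complex (w y) 0.
have rew : re wc = w by [].
have imw : im wc = fun=> 0 by [].
have lin0 y : linearization f v (fun=> 0) y = 0.
  by rewrite /linearization !derive1_zero !mulr0 !addr0 oppr0 mul0r.
have norm_real (a : R) : Normc.normc (Complex a 0) = `|a|.
  by rewrite /= expr0n addr0 sqrtr_sqr.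
have := hM wc K; rewrite /complex_linearization_dom rew imw.
have dom0 : linearization_dom bc0 bc1 v (fun=> 0).
  exists (fun=> 0), (fun=> 0); split; [exact: C1_on01_zero|exact: C1_on01_zero|].
  by split; exact: linearized_bc0.
move=> /(_ (conj wdom dom0)) h.
have {}h : Normc.normc (wc x) <= M * K.
  apply: h => // y y01; rewrite mul0r subr0 /complex_linearization rew imw lin0.
  by rewrite norm_real; exact: wK.
rewrite norm_real in h; apply: (le_trans h); rewrite ler_wpM2r // ler_norm //.
Qed.

(** The defect [s] with which the difference of two solutions meets the linearized condition is
    placed in the slope, where adding a polynomial can remove it. *)
Lemma bc_linearize (bc : boundary_condition R) u e : class_C1_bc bc -> 0 < e ->
  exists2 r, 0 < r & forall p u' p', `|u' - u| < r -> bc_holds bc u p ->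
    bc_holds bc u' p' -> exists2 s, `|s| <= e * `|u' - u| &
      bc_holds (linearized_bc bc u) (u' - u) (p' - p + s).
Proof.
case: bc => [|b] /=.
  move=> _ e0; exists 1 => // p u' p' _ -> ->; exists 0; last by rewrite subrr.
  by rewrite subrr normr0 mulr0.
move=> [db _] e0; have /derP/(_ e e0) := derivable_der _ _ (db u).
move=> /nbhs_ballP[r /= r0 hr]; exists r => // p u' p' ur -> ->.
exists (derive1 b u * (u' - u) - (b u' - b u)); last by ring.
by rewrite distrC; apply: hr; rewrite /ball /= distrC.
Qed.

(** The Hermite cubic that vanishes at 0 and 1 and has slopes [s0] and [s1] there. *)
Definition corrector (s0 s1 x : R) : R := s0 * (x * (1 - x) * (1 - x)) - s1 * (x * x * (1 - x)).
Definition corrector1 (s0 s1 x : R) : R :=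
  s0 * ((1 - x) * (1 - x) - 2 * (x * (1 - x))) - s1 * (2 * (x * (1 - x)) - x * x).
Definition corrector2 (s0 s1 x : R) : R := s0 * (x * 6 - 4) - s1 * (2 - x * 6).

Lemma der_corrector s0 s1 x : der (corrector s0 s1) x (corrector1 s0 s1 x).
Proof.
have d1 : der (fun y => 1 - y) x (0 - 1) by apply: der_sub; [exact: der_const|exact: der_var].
apply: der_to.
  apply: der_sub; apply: der_mul; try exact: der_const.
    apply: der_mul; last exact: d1.
    by apply: der_mul; [exact: der_var|exact: d1].
  apply: der_mul; last exact: d1.
  by apply: der_mul; exact: der_var.
by rewrite /corrector1 /=; ring.
Qed.

Lemma der_corrector1 s0 s1 x : der (corrector1 s0 s1) x (corrector2 s0 s1 x).
Proof.
have d1 : der (fun y => 1 - y) x (0 - 1) by apply: der_sub; [exact: der_const|exact: der_var].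
have d2 : der (fun y => 2 * (y * (1 - y))) x (0 * (x * (1 - x)) + 2 * (1 * (1 - x) + x * (0 - 1))).
  apply: (der_mul (fun=> 2)); first exact: der_const.
  by apply: der_mul; [exact: der_var|exact: d1].
apply: der_to.
  apply: der_sub; apply: der_mul; try exact: der_const.
    by apply: der_sub; [apply: der_mul; exact: d1|exact: d2].
  by apply: der_sub; [exact: d2|apply: der_mul; exact: der_var].
by rewrite /corrector2 /=; ring.
Qed.

Lemma cont_corrector2 s0 s1 : continuous (corrector2 s0 s1).
Proof. rewrite /corrector2; cont_tac. Qed.

Lemma corrector_bounds s0 s1 x e : `|s0| <= e -> `|s1| <= e -> 0 <= x <= 1 ->
  [/\ `|corrector s0 s1 x| <= 2 * e, `|corrector1 s0 s1 x| <= 6 * e &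
      `|corrector2 s0 s1 x| <= 8 * e].
Proof.
move=> h0 h1 /andP[x0 x1].
have e0 : 0 <= e by exact: le_trans h0.
have y0 : 0 <= 1 - x by rewrite subr_ge0.
have a1 : 0 <= x * (1 - x) by rewrite mulr_ge0.
have a2 : x * (1 - x) <= 1 by rewrite mulr_ile1 // gerBl.
have b1 : 0 <= (1 - x) * (1 - x) <= 1.
  by rewrite mulr_ge0 //= mulr_ile1 // gerBl.
have b2 : 0 <= x * x <= 1 by rewrite mulr_ge0 //= mulr_ile1.
have K (a b m : R) : `|a| <= m -> `|b| <= m -> 0 <= m ->
   `|s0 * a - s1 * b| <= 2 * m * e.
  move=> am bm m0; rewrite (le_trans (ler_normB _ _)) //.
  have -> : 2 * m * e = e * m + e * m by ring.
  by rewrite lerD // normrM ler_pM.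
split.
- rewrite /corrector -[2]mulr1; apply: K => //; rewrite ger0_norm ?mulr_ge0 //.
    by rewrite mulr_ile1 // gerBl.
  by case/andP: b2 => *; rewrite mulr_ile1 // ?gerBl // mulr_ge0.
- have -> : 6 * e = 2 * 3 * e by ring.
  case/andP: b1 => ? ?; case/andP: b2 => ? ?.
  by apply: K => //; rewrite ler_norml; apply/andP; split; lra.
- have -> : 8 * e = 2 * 4 * e by ring.
  by apply: K => //; rewrite ler_norml; apply/andP; split; lra.
Qed.

End RealResolvent.

(** * Interpolation bound for the slope *)

Section SlopeEstimate.
Context {R : realType}.

Lemma EVT01 (g : R -> R) : continuous g -> exists2 c, 0 <= c <= 1 &
  forall x, 0 <= x <= 1 -> g x <= g c.
Proof.
move=> cg; have [c] := @EVT_max R g 0 1 ler01 (continuous_subspaceT cg).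
rewrite in_itv /= => c01 h; exists c => // x x01; apply: h; by rewrite in_itv.
Qed.

(* The slope is close to a difference quotient over an interval of length [l]
   on which it varies by at most [(e0 + e1) / 2]. *)
Lemma slope_bound (d d1 d2 : R -> R) (La e0 e1 : R) : 0 <= La ->
  continuous d -> continuous d1 ->
  (forall x, 0 < x < 1 -> der d x (d1 x)) -> (forall x, 0 < x < 1 -> der d1 x (d2 x)) ->
  (forall x, 0 <= x <= 1 -> `|d x| <= e0) ->
  (forall x, 0 <= x <= 1 -> `|d1 x| <= e1) ->
  (forall x, 0 < x < 1 -> `|d2 x| <= La * (e0 + e1)) ->
  (exists2 c, 0 <= c <= 1 & `|d1 c| = e1) ->
  e1 <= (8 * (La + 1) + 1) * e0.
Proof.
move=> La0 cd cd1 h1 h2 b0 b1 b2 [c c01 ec].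
(* The [+ 1] also gives [l <= 1 / 2], so that on one side or the other of [c] an interval of length
   [l] fits into [0, 1]. *)
pose l := 1 / 2 / (La + 1).
have LaP : 0 < La + 1 by rewrite ltr_wpDl.
have l0 : 0 < l by rewrite !divr_gt0.
have lLa : l * (La + 1) = 1 / 2 by rewrite /l divfK // gt_eqF.
have lh : l <= 1 / 2.
  rewrite -lLa; have : 0 <= l * La by rewrite mulr_ge0 // ltW.
  by lra.
have e00 : 0 <= e0 by apply: le_trans (b0 c c01).
have e10 : 0 <= e1 by rewrite -ec.
have [a [a0 al ca cal]] : exists a, [/\ 0 <= a, a + l <= 1, a <= c & c <= a + l].
  case/andP: c01 => c0 c1; have [ch|ch] := leP c (1 / 2).
    by exists c; split; lra.
  by exists (c - l); split; lra.
have aal : a < a + l by rewrite ltrDl.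
have inI y : a < y < a + l -> 0 < y < 1.
  by move=> /andP[y1 y2]; rewrite (le_lt_trans a0) // (lt_le_trans y2).
have dd y : y \in `]a, a + l[%R -> is_derive y 1 d (d1 y).
  by rewrite in_itv /= => /inI/h1.
have [xi] := MVT aal dd (continuous_subspaceT cd).
rewrite in_itv /= [a + l - a]addrAC subrr add0r => xiI xiE.
have xi01 := itv01_open_closed _ (inI _ xiI).
have k1 : `|d1 xi| * l <= 2 * e0.
  rewrite -[l]ger0_norm ?(ltW l0) // -normrM -xiE (le_trans (ler_normB _ _)) //.
  have i1 : 0 <= a <= 1 by apply/andP; split; lra.
  have i2 : 0 <= a + l <= 1 by apply/andP; split; lra.
  by have := b0 _ i1; have := b0 _ i2; lra.
have k2 : `|d1 c - d1 xi| <= La * (e0 + e1) * l.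
  have sub (y z : R) : a <= y -> y < z -> z <= a + l -> `|d1 z - d1 y| <= La * (e0 + e1) * l.
    move=> ay yz zl.
    have dd1 s : s \in `]y, z[%R -> is_derive s 1 d1 (d2 s).
      rewrite in_itv /= => /andP[s1 s2]; apply: h2; apply: inI.
      by rewrite (le_lt_trans ay) //= (lt_le_trans s2).
    have [s] := MVT yz dd1 (continuous_subspaceT cd1).
    rewrite in_itv /= => /andP[s1 s2] ->.
    rewrite normrM ler_pM // ?b2 //.
      by apply: inI; rewrite (le_lt_trans ay) //= (lt_le_trans s2).
    by rewrite ger0_norm ?subr_ge0 ?(ltW yz) //; lra.
  case/andP: xiI => x1 x2; case: (ltgtP c xi) => [cx|xc|->].
  - by rewrite distrC; apply: sub => //; exact: ltW.
  - by apply: sub => //; exact: ltW.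
  - by rewrite subrr normr0 mulr_ge0 ?(ltW l0) // mulr_ge0 // addr_ge0.
have k3 : e1 <= `|d1 c - d1 xi| + `|d1 xi|.
  by rewrite -ec -{1}[d1 c](subrK (d1 xi)) ler_normD.
have k4 : `|d1 xi| <= 4 * (La + 1) * e0.
  have : `|d1 xi| * (l * (La + 1)) <= 2 * e0 * (La + 1).
    by rewrite mulrA ler_wpM2r // ltW.
  by rewrite lLa; lra.
have k5 : La * (e0 + e1) * l <= 1 / 2 * (e0 + e1).
  have : 0 <= l * (e0 + e1) by rewrite mulr_ge0 ?addr_ge0 // ltW.
  have : l * (La + 1) * (e0 + e1) = 1 / 2 * (e0 + e1) by rewrite lLa.
  by lra.
by move: k2 k3 k4 k5; lra.
Qed.

End SlopeEstimate.

(** * Differences of neighbouring equilibria *)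

Section Isolation.
Context {R : realType} {X : completeNormedModType R}.
Variables (f : R -> R -> R -> R -> R -> R) (bc0 bc1 : boundary_condition R).
Variables (ev : X -> R -> R) (P : set X) (S : R -> X -> X).
Hypotheses (f_C1 : class_C1 f) (f_parabolic : parabolic f).
Hypotheses (bc0_C1 : class_C1_bc bc0) (bc1_C1 : class_C1_bc bc1).
Hypothesis X_C1 : embedded_in_C1 ev.
Hypothesis S_classical : classical_semiflow f bc0 bc1 ev P S.
Variable dv : X -> R -> R.
Hypothesis hdv : forall phi, C1_on01 (ev phi) (dv phi).
Variables (F Fu Fp Fpu Fpp : R -> R -> R -> R).
Hypothesis F_rhs : rhs F Fu Fp Fpu Fpp.
Hypothesis F_eq : forall x u p, 0 <= x <= 1 -> f x u p (F x u p) 0 = 0.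
Hypothesis Fu_eq : forall x u p, 0 <= x <= 1 ->
  partial_q f x u p (F x u p) 0 * Fu x u p = - partial_u f x u p (F x u p) 0.
Hypothesis Fp_eq : forall x u p, 0 <= x <= 1 ->
  partial_q f x u p (F x u p) 0 * Fp x u p = - partial_p f x u p (F x u p) 0.

Let E := equilibrium f bc0 bc1 ev P.

Lemma equilibrium_orbit phi : E phi -> global_orbit P S (fun=> phi).
Proof.
move=> /(equilibriumP f bc0 bc1 ev P S X_C1 S_classical dv hdv)[Pphi h].
by split => // s t s0; rewrite h.
Qed.

(** Along a constant orbit u_t = 0, so u_xx is a root of f at r = 0 and equals F by uniqueness. *)
Lemma equilibrium_ode phi : E phi ->
  (forall x, 0 < x < 1 -> der (dv phi) x (F x (ev phi x) (dv phi x)) /\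
     derive1 (derive1 (ev phi)) x = F x (ev phi x) (dv phi x)) /\
  bc_holds bc0 (ev phi 0) (dv phi 0) /\ bc_holds bc1 (ev phi 1) (dv phi 1).
Proof.
move=> Ephi; have orb := equilibrium_orbit phi Ephi.
split=> [x x01|].
  have [d _ eq] := gam_pointwise f bc0 bc1 ev P S S_classical dv hdv _ orb 0 x x01.
  rewrite derive1_cst in eq; have x01' := itv01_open_closed _ x01.
  have e := F0_unique f f_C1 f_parabolic _ _ _ _ _ x01' eq (F_eq _ _ _ x01').
  by rewrite e in d.
have [C C0 hC] := ev_C1_bound ev X_C1 dv hdv.
have o := gam_to_orbit f bc0 bc1 ev P S f_C1 f_parabolic X_C1 S_classical dv hdv _ orb F
  (C * `|phi|) F_eq (fun t x x01 => hC phi x x01).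
exact: (orb_bc _ _ _ _ _ _ _ _ o 0).
Qed.

Lemma rhs_linearize (M e : R) : 0 < e -> exists2 r, 0 < r &
  forall x u p a b, 0 <= x <= 1 -> `|u| <= M -> `|p| <= M -> `|a| < r -> `|b| < r ->
  `|F x (u + a) (p + b) - F x u p - Fu x u p * a - Fp x u p * b| <= e * (`|a| + `|b|).
Proof.
move=> e0; have [r1 r10 h1] := box_uniform Fu M e (rhs_cu _ _ _ _ _ F_rhs) e0.
have [r2 r20 h2] := box_uniform Fp M e (rhs_cp _ _ _ _ _ F_rhs) e0.
exists (Num.min r1 r2); first by rewrite lt_min r10 r20.
move=> x u p a b x01 uM pM; rewrite !lt_min => /andP[a1 a2] /andP[b1 b2].
have [y ey yI] := MVT_line _ _ u (u + a) (fun s => rhs_du _ _ _ _ _ F_rhs x s (p + b)).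
have [z ez zI] := MVT_line _ _ p (p + b) (rhs_dp _ _ _ _ _ F_rhs x u).
rewrite addrAC subrr add0r in ey; rewrite addrAC subrr add0r in ez.
have bet (s c w : R) : Num.min s (s + c) <= w <= Num.max s (s + c) -> `|w - s| <= `|c|.
  have [c0|c0] := leP 0 c.
    rewrite (min_idPl _) ?lerDl // (max_idPr _) ?lerDl // => /andP[w1 w2].
    by rewrite ger0_norm ?subr_ge0 // lerBlDl ger0_norm.
  rewrite (min_idPr _) ?gerDl ?(ltW c0) // (max_idPl _) ?gerDl ?(ltW c0) // => /andP[w1 w2].
  by rewrite ler0_norm ?subr_le0 // ltr0_norm // opprB lerBlDl -lerBlDr opprK.
have k1 := h1 x u p (y - u) b x01 uM pM (le_lt_trans (bet _ _ _ yI) a1) b1.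
have z2 : `|z - p| < r2 by exact: le_lt_trans (bet _ _ _ zI) b2.
have k2 := h2 x u p 0 (z - p) x01 uM pM _ z2.
rewrite normr0 in k2; have {}k2 := k2 r20.
rewrite [u + (y - u)]addrC subrK in k1.
rewrite addr0 [p + (z - p)]addrC subrK in k2.
have -> : F x (u + a) (p + b) - F x u p - Fu x u p * a - Fp x u p * b =
   (Fu x y (p + b) - Fu x u p) * a + (Fp x u z - Fp x u p) * b.
  by rewrite !mulrBl -ey -ez; ring.
rewrite mulrDr (le_trans (ler_normD _ _)) // lerD // normrM ler_wpM2r //.
Qed.

(** Up to sign, f_q / f_r is the factor between the linearization applied to w and w'' - F_p w' -
    F_u w. *)
Lemma coefficient_bounded phi : exists2 Kk, 0 <= Kk & forall x, 0 <= x <= 1 ->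
  `|partial_q f x (ev phi x) (dv phi x) (F x (ev phi x) (dv phi x)) 0
    / partial_r f x (ev phi x) (dv phi x) (F x (ev phi x) (dv phi x)) 0| <= Kk.
Proof.
have [_ _ _ cq cr] := class_C1_cont _ f_C1.
have c1 := within01_cont _ (ev_within ev dv hdv phi).
have c2 := within01_cont _ (dv_within ev dv hdv phi).
have cF := rhs_c _ _ _ _ _ F_rhs.
have cc := @cont_clamp01 R.
have c3 : continuous (fun x => F (clamp01 x) (ev phi (clamp01 x)) (dv phi (clamp01 x))).
  exact: (cont3_comp F _ _ _ cF cc c1 c2).
have i01 := @clamp01_itv R.
have kq := cont_args _ _ _ _ _ _ cq cc c1 c2 c3 (cont_cst 0) i01.
have kr := cont_args _ _ _ _ _ _ cr cc c1 c2 c3 (cont_cst 0) i01.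
have kri : continuous (fun x => (partial_r f (clamp01 x) (ev phi (clamp01 x)) (dv phi (clamp01 x))
   (F (clamp01 x) (ev phi (clamp01 x)) (dv phi (clamp01 x))) 0)^-1).
  by apply: (contV _ kr) => z; apply: partial_r_neq0 => //; exact: i01.
have [Kk Kk0 h] := compact_bounded_funs _ _ (@segment_compact R 0 1) (contM _ _ kq kri).
exists Kk => // x x01; have := h x; rewrite /= in_itv /= clamp01_id //; apply; exact: x01.
Qed.

(** All quantities are measured by [n0], the maximum of the difference [d] of the two equilibria.
    The resolvent bounds the corrected difference [w] by a multiple of e n0, and the corrector has
    that size as well; with [e] small against 1 / Z this reads n0 <= n0 / 2. *)
Lemma hyperbolic_isolated phi : E phi -> hyperbolic f bc0 bc1 (ev phi) ->
  exists2 r, 0 < r & forall psi, E psi -> `|psi - phi| <= r -> psi = phi.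
Proof.
move=> Ephi /real_resolvent[M0 M00 hM0].
have [ode [hb0 hb1]] := equilibrium_ode phi Ephi.
have [C C0 hC] := ev_C1_bound ev X_C1 dv hdv.
have [C' C'0 hC'] := ev_C1_lip ev X_C1 dv hdv.
pose M := C * `|phi|.
have hM x : 0 <= x <= 1 -> `|ev phi x| <= M /\ `|dv phi x| <= M by exact: hC.
have [B1 B10 hB1] := box_bounded Fu M (rhs_cu _ _ _ _ _ F_rhs).
have [B2 B20 hB2] := box_bounded Fp M (rhs_cp _ _ _ _ _ F_rhs).
have [Kk Kk0 hKk] := coefficient_bounded phi.
pose BF := B1 + B2; have BF0 : 0 <= BF by rewrite addr_ge0.
pose La := BF + 1; have La0 : 0 <= La by rewrite addr_ge0.
pose C2 := 8 * (La + 1) + 1.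
have C20 : 0 <= C2 by rewrite addr_ge0 // mulr_ge0 // addr_ge0.
(* Contributions to the image of [w]: [1 + C2] from the first-order remainder of F, 8 from the
   second derivative of the corrector, and 6 + 2 times [BF] from its slope and its value. *)
pose C3 := 1 + C2 + 8 + BF * 8.
have C30 : 0 <= C3 by do 2?[apply: addr_ge0]; [apply: addr_ge0|..] => //; exact: mulr_ge0.
pose Z := M0 * (Kk * C3) + 2.
have Z0 : 0 < Z by rewrite ltr_wpDl // !mulr_ge0.
pose e := Num.min 1 (1 / 2 / Z).
have e0 : 0 < e by rewrite lt_min ltr01 !divr_gt0.
have e1 : e <= 1 by rewrite ge_min lexx.
have eZ : Z * e <= 1 / 2.
  rewrite mulrC -ler_pdivlMr //; by rewrite ge_min lexx orbT.
have [r1 r10 hr1] := rhs_linearize M e e0.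
have [r2 r20 hr2] := bc_linearize bc0 (ev phi 0) e bc0_C1 e0.
have [r3 r30 hr3] := bc_linearize bc1 (ev phi 1) e bc1_C1 e0.
pose rho := Num.min r1 (Num.min r2 r3).
have rho0 : 0 < rho by rewrite !lt_min r10 r20 r30.
have C'1 : 0 < C' + 1 by rewrite ltr_wpDl.
exists (rho / 2 / (C' + 1)); first by rewrite !divr_gt0.
move=> psi Epsi psir.
have Cr : C' * `|psi - phi| < rho.
  apply: le_lt_trans (half_lt _ rho0).
  have h : C' * `|psi - phi| <= C' * (rho / 2 / (C' + 1)) by rewrite ler_wpM2l.
  apply: (le_trans h); rewrite mulrA ler_pdivrMr // mulrC ler_wpM2l ?lerDl ?ler01 //.
  by rewrite divr_ge0 // ltW.
have [ode' [hb0' hb1']] := equilibrium_ode psi Epsi.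
have i01 : 0 <= (0 : R) <= 1 by rewrite lexx ler01.
have i11 : 0 <= (1 : R) <= 1 by rewrite lexx ler01.
pose d x := ev psi x - ev phi x; pose d1 x := dv psi x - dv phi x.
pose d2 x := F x (ev psi x) (dv psi x) - F x (ev phi x) (dv phi x).
have small x : 0 <= x <= 1 -> `|d x| < rho /\ `|d1 x| < rho.
  by move=> x01; have [h1 h2] := hC' psi phi x x01; split; exact: le_lt_trans Cr.
have cd : continuous (fun x => d (clamp01 x)).
  by apply: contB; apply: within01_cont; exact: ev_within hdv _.
have cd1 : continuous (fun x => d1 (clamp01 x)).
  by apply: contB; apply: within01_cont; exact: dv_within hdv _.
have cnd : continuous (fun x => `|d (clamp01 x)|) by move=> x; apply: cvg_norm; exact: cd.
have cnd1 : continuous (fun x => `|d1 (clamp01 x)|) by move=> x; apply: cvg_norm; exact: cd1.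
have [c c01 hc] := EVT01 _ cnd; have [c' c'01 hc'] := EVT01 _ cnd1.
rewrite /= (clamp01_id c) // in hc; rewrite /= (clamp01_id c') // in hc'.
set n0 := `|d c| in hc; set n1 := `|d1 c'| in hc'.
have hn0 x : 0 <= x <= 1 -> `|d x| <= n0 by move=> x01; have := hc x x01; rewrite clamp01_id.
have hn1 x : 0 <= x <= 1 -> `|d1 x| <= n1 by move=> x01; have := hc' x x01; rewrite clamp01_id.
have n00 : 0 <= n0 by rewrite /n0.
have n10 : 0 <= n1 by rewrite /n1.
have dd x : 0 < x < 1 -> der d x (d1 x).
  by move=> x01; apply: der_sub; exact: der_ev hdv _ _ x01.
have dd1 x : 0 < x < 1 -> der d1 x (d2 x).
  by move=> x01; apply: der_sub; [exact: (ode' x x01).1|exact: (ode x x01).1].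
have lin x : 0 <= x <= 1 -> `|d2 x - Fu x (ev phi x) (dv phi x) * d x
    - Fp x (ev phi x) (dv phi x) * d1 x| <= e * (n0 + n1).
  move=> x01; have [h1 h2] := hM x x01; have [s1 s2] := small x x01.
  have s1' : `|d x| < r1 by move: s1; rewrite lt_min => /andP[].
  have s2' : `|d1 x| < r1 by move: s2; rewrite lt_min => /andP[].
  have := hr1 x (ev phi x) (dv phi x) (d x) (d1 x) x01 h1 h2 s1' s2'.
  rewrite /d /d1 [ev phi x + _]addrC [dv phi x + _]addrC !subrK => h.
  apply: (le_trans h); rewrite ler_wpM2l ?(ltW e0) // lerD //; [exact: hn0|exact: hn1].
have d2b x : 0 < x < 1 -> `|d2 x| <= La * (n0 + n1).
  move=> /itv01_open_closed x01; have [h1 h2] := hM x x01.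
  have k1 := hB1 x _ _ x01 h1 h2; have k2 := hB2 x _ _ x01 h1 h2.
  set G1 := Fu x _ _ in k1; set G2 := Fp x _ _ in k2.
  have -> : d2 x = (d2 x - G1 * d x - G2 * d1 x) + (G1 * d x + G2 * d1 x) by ring.
  have -> : La * (n0 + n1) = 1 * (n0 + n1) + (BF * n0 + BF * n1) by rewrite /La; ring.
  rewrite (le_trans (ler_normD _ _)) // lerD //.
    by apply: le_trans (lin x x01) _; rewrite ler_wpM2r ?addr_ge0.
  rewrite (le_trans (ler_normD _ _)) // lerD // normrM ler_pM // ?hn0 ?hn1 //.
    by apply: le_trans k1 _; rewrite /BF lerDl.
  by apply: le_trans k2 _; rewrite /BF lerDr.
(* The resolvent estimate concerns the sup-norm alone; the differential inequality for [d] recovers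
   its slope, so that remainders of size e (n0 + n1) are again multiples of e n0. *)
have n1b : n1 <= C2 * n0.
  apply: (slope_bound (fun x => d (clamp01 x)) (fun x => d1 (clamp01 x)) d2) => //.
  - move=> x x01; rewrite clamp01_id ?itv01_open_closed //.
    apply: (der_ext d); last exact: dd.
    by apply: filterS (near_in01 x x01) => y /itv01_open_closed y01; rewrite clamp01_id.
  - move=> x x01; apply: (der_ext d1); last exact: dd1.
    by apply: filterS (near_in01 x x01) => y /itv01_open_closed y01; rewrite clamp01_id.
  - by exists c' => //; rewrite clamp01_id.
have [sm0 _] := small 0 i01; have [sm1 _] := small 1 i11.
have sm0' : `|ev psi 0 - ev phi 0| < r2 by move: sm0; rewrite !lt_min => /andP[_ /andP[]].
have sm1' : `|ev psi 1 - ev phi 1| < r3 by move: sm1; rewrite !lt_min => /andP[_ /andP[]].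
have [s0 hs0 bs0] := hr2 _ _ _ sm0' hb0 hb0'.
have [s1 hs1 bs1] := hr3 _ _ _ sm1' hb1 hb1'.
have {}hs0 : `|s0| <= e * n0 by apply: (le_trans hs0); rewrite ler_wpM2l ?(ltW e0) // hn0.
have {}hs1 : `|s1| <= e * n0 by apply: (le_trans hs1); rewrite ler_wpM2l ?(ltW e0) // hn0.
pose w x := d x + corrector s0 s1 x; pose w1 x := d1 x + corrector1 s0 s1 x.
pose w2 x := d2 x + corrector2 s0 s1 x.
have dw x : 0 < x < 1 -> der w x (w1 x).
  by move=> x01; apply: der_add; [exact: dd|exact: der_corrector].
have dw1 x : 0 < x < 1 -> der w1 x (w2 x).
  by move=> x01; apply: der_add; [exact: dd1|exact: der_corrector1].
have withinD (g h : R -> R) : {within `[0, 1], continuous g} -> {within `[0, 1], continuous h} ->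
    {within `[0, 1], continuous (fun x => g x + h x)}.
  by move=> cg ch x; exact: cvgD (cg x) (ch x).
have withinB (g h : R -> R) : {within `[0, 1], continuous g} -> {within `[0, 1], continuous h} ->
    {within `[0, 1], continuous (fun x => g x - h x)}.
  by move=> cg ch x; exact: cvgB (cg x) (ch x).
have withinT (g : R -> R) : continuous g -> {within `[0, 1], continuous g}.
  by move=> cg; exact: continuous_subspaceT.
have cF := rhs_c _ _ _ _ _ F_rhs.
have withinF chi : {within `[0, 1], continuous (fun x => F x (ev chi x) (dv chi x))}.
  have c1 := within01_cont _ (ev_within ev dv hdv chi).
  have c2 := within01_cont _ (dv_within ev dv hdv chi).
  have h : continuous (fun x => F x (ev chi (clamp01 x)) (dv chi (clamp01 x))).
    exact: (cont3_comp F _ _ _ cF cont_id c1 c2).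
  apply: (subspace_eq_continuous _ (withinT _ h)) => x; rewrite inE /= in_itv /= => x01.
  by rewrite /from_subspace clamp01_id.
have dom : linearization_dom bc0 bc1 (ev phi) w.
  exists w1, w2; split.
  - split.
    + apply: withinD; last exact: withinT (derivative_continuous _ _ (der_corrector s0 s1)).
      by apply: withinB; exact: ev_within hdv _.
    + apply: withinD; last exact: withinT (derivative_continuous _ _ (der_corrector1 s0 s1)).
      by apply: withinB; exact: dv_within hdv _.
    + move=> x x01; split; last exact: der_derive1 (dw x x01).
      by case: (dw x x01).
  - split.
    + apply: withinD; last exact: withinT (derivative_continuous _ _ (der_corrector1 s0 s1)).
      by apply: withinB; exact: dv_within hdv _.
    + apply: withinD; last exact: withinT (cont_corrector2 s0 s1).
      by apply: withinB; exact: withinF.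
    + move=> x x01; split; last exact: der_derive1 (dw1 x x01).
      by case: (dw1 x x01).
  - have z0 : corrector s0 s1 0 = 0 by rewrite /corrector; ring.
    have z1 : corrector s0 s1 1 = 0 by rewrite /corrector; ring.
    have z10 : corrector1 s0 s1 0 = s0 by rewrite /corrector1; ring.
    have z11 : corrector1 s0 s1 1 = s1 by rewrite /corrector1; ring.
    by split; rewrite /w /w1 ?z0 ?z1 ?z10 ?z11 addr0.
have est x : 0 < x < 1 -> `|linearization f (ev phi) w x| <= Kk * (C3 * (e * n0)).
  move=> x01; have x01' := itv01_open_closed _ x01.
  have [h1 h2] := hM x x01'.
  have e1' : derive1 (ev phi) x = dv phi x by exact: dv_derive1 hdv _ _ x01.
  have e2' := (ode x x01).2.
  have e3' : derive1 w x = w1 x by exact: der_derive1 (dw x x01).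
  have e4' : derive1 (derive1 w) x = w2 x.
    apply: der_derive1; apply: (der_ext w1); last exact: dw1.
    by apply: filterS (near_in01 x x01) => y y01; rewrite (der_derive1 _ _ _ (dw y y01)).
  rewrite /linearization e2' e1' e3' e4'.
  have fu := Fu_eq x (ev phi x) (dv phi x) x01'.
  have fp := Fp_eq x (ev phi x) (dv phi x) x01'.
  have hk := hKk x x01'.
  have k1 := hB1 x _ _ x01' h1 h2; have k2 := hB2 x _ _ x01' h1 h2.
  have hl := lin x x01'.
  set G1 := Fu x _ _ in fu k1 hl; set G2 := Fp x _ _ in fp k2 hl.
  set fq := partial_q f _ _ _ _ _ in fu fp hk *; set fr := partial_r f _ _ _ _ _ in hk *.
  set pp := partial_p f _ _ _ _ _ in fp *; set pu := partial_u f _ _ _ _ _ in fu *.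
  have -> : - (fq * w2 x + pp * w1 x + pu * w x) / fr =
     - (fq / fr * (w2 x - G2 * w1 x - G1 * w x)).
    have -> : pp = - (fq * G2) by rewrite fp opprK.
    have -> : pu = - (fq * G1) by rewrite fu opprK.
    by ring.
  rewrite normrN normrM ler_pM //.
  have [z0 z1 z2] := corrector_bounds s0 s1 x (e * n0) hs0 hs1 x01'.
  have -> : w2 x - G2 * w1 x - G1 * w x = (d2 x - G1 * d x - G2 * d1 x)
     + corrector2 s0 s1 x - (G2 * corrector1 s0 s1 x + G1 * corrector s0 s1 x).
    by rewrite /w /w1 /w2; ring.
  have en0 : 0 <= e * n0 by rewrite mulr_ge0 // ltW.
  have hl' : e * (n0 + n1) <= (1 + C2) * (e * n0).
    have : e * n1 <= e * (C2 * n0) by rewrite ler_wpM2l // ltW.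
    by rewrite mulrDr [(1 + C2) * _]mulrDl mul1r mulrCA lerD2l.
  have k3 : `|G2 * corrector1 s0 s1 x| <= BF * (6 * (e * n0)).
    rewrite normrM ler_pM //; by apply: le_trans k2 _; rewrite /BF lerDr.
  have k4 : `|G1 * corrector s0 s1 x| <= BF * (2 * (e * n0)).
    rewrite normrM ler_pM //; by apply: le_trans k1 _; rewrite /BF lerDl.
  have -> : C3 * (e * n0) = ((1 + C2) * (e * n0) + 8 * (e * n0))
     + (BF * (6 * (e * n0)) + BF * (2 * (e * n0))) by rewrite /C3; ring.
  rewrite (le_trans (ler_normB _ _)) // lerD //.
    by rewrite (le_trans (ler_normD _ _)) // lerD // (le_trans hl).
  by rewrite (le_trans (ler_normD _ _)) // lerD.
have wc := hM0 w _ dom est c c01.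
have [zc _ _] := corrector_bounds s0 s1 c (e * n0) hs0 hs1 c01.
have n0le : n0 <= n0 / 2.
  have : n0 <= `|w c| + `|corrector s0 s1 c|.
    have -> : n0 = `|w c - corrector s0 s1 c| by rewrite /w addrK.
    exact: ler_normB.
  move=> /le_trans; apply; apply: (le_trans (lerD wc zc)).
  have -> : M0 * (Kk * (C3 * (e * n0))) + 2 * (e * n0) = (Z * e) * n0 by rewrite /Z; ring.
  by rewrite [n0 / 2]mulrC -[2^-1]mul1r ler_wpM2r.
have n0z : n0 = 0 by apply/eqP; rewrite eq_le n00 andbT; move: n0le n00; lra.
apply: (ev_inj ev X_C1) => x x01; apply/eqP; rewrite -subr_eq0 -normr_le0 -n0z.
exact: hn0.
Qed.

End Isolation.

(** * Structure of the global attractor *)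

Lemma class_C1_bc_continuous (R : realType) (bc : boundary_condition R) :
  class_C1_bc bc -> bc_continuous bc.
Proof.
by case: bc => [//|b] [db _] s; exact: der_continuous _ _ _ (derivable_der _ _ (db s)).
Qed.

Theorem corollary1p2 (R : realType) (f : R -> R -> R -> R -> R -> R)
  (bc0 bc1 : boundary_condition R)
  (X : completeNormedModType R) (ev : X -> R -> R)
  (P : set X) (S : R -> X -> X) (A : set X)
  (f_C1 : class_C1 f)
  (fp_C1 : class_C1_at_r0 (partial_p f))
  (fq_C1 : class_C1_at_r0 (partial_q f))
  (fr_C1 : class_C1_at_r0 (partial_r f))
  (f_parabolic : parabolic f)
  (f_F0 : F0_well_defined f)
  (bc0_C1 : class_C1_bc bc0) (bc1_C1 : class_C1_bc bc1)
  (X_C1 : embedded_in_C1 ev)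
  (P_phase : phase_space ev bc0 bc1 P)
  (S_classical : classical_semiflow f bc0 bc1 ev P S)
  (S_dissipative : bounded_dissipative P S)
  (S_precompact : precompact_orbits P S)
  (E_hyperbolic : forall v, equilibrium f bc0 bc1 ev P v ->
     hyperbolic f bc0 bc1 (ev v))
  (A_attractor : global_attractor P S A) :
  let E := equilibrium f bc0 bc1 ev P in
  finite_set E /\
  A = E `|` [set phi | exists gam : R -> X,
        [/\ heteroclinic E P S gam, bounded_orbit gam
          & exists t, gam t = phi]].
Proof.
move=> E; have [dv hdv] := slope_exists ev X_C1.
have [F [Fu [Fp [Fpu [Fpp [hF F_eq Fu_eq Fp_eq]]]]]] :=
  rhs_exists f f_C1 fp_C1 fq_C1 f_parabolic f_F0.
have [C C0 hC] := ev_C1_bound ev X_C1 dv hdv.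
have [C' C'0 hC'] := ev_C1_lip ev X_C1 dv hdv.
have [rho rho0 hrho] := attractor_bounded P S A A_attractor.
(* A bound of the attractor in C^1, which serves as the cutoff level; the [+ 1] makes it
   positive. *)
pose M := C * rho + 1.
have M0 : 0 < M by rewrite ltr_wpDl // mulr_ge0 // ltW.
have hM phi x : A phi -> 0 <= x <= 1 -> `|ev phi x| <= M /\ `|dv phi x| <= M.
  move=> Aphi x01.
  have b : C * `|phi| <= M.
    by apply: ler_wpDr => //; rewrite ler_wpM2l // hrho.
  by have [h1 h2] := hC phi x x01; split; exact: le_trans b.
have [V [CV [CV0 Vlip Vmono Vstrict]]] := lyapunov_exists F Fu Fp Fpu Fpp M bc0 bc1 hF M0
  (class_C1_bc_continuous _ _ bc0_C1) (class_C1_bc_continuous _ _ bc1_C1).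
have prof phi : A phi -> profile M (ev phi) (dv phi).
  move=> Aphi; split; [apply: within01_cont; exact: ev_within hdv _
    |apply: within01_cont; exact: dv_within hdv _|by move=> x; exact: hM].
have orb gam : global_orbit P S gam -> (forall t, A (gam t)) ->
    orbit F M bc0 bc1 (fun t x => ev (gam t) x) (fun t x => dv (gam t) x)
      (fun t x => derive1 (derive1 (ev (gam t))) x)
      (fun t x => derive1 (fun s => ev (gam s) x) t).
  move=> gorb gA.
  exact: (gam_to_orbit f bc0 bc1 ev P S f_C1 f_parabolic X_C1 S_classical dv hdv
    gam gorb F M F_eq (fun t x => hM _ x (gA t))).
(* V becomes a function on the phase space through values and slopes; on [A] it is Lipschitz with
   the constant [CV * C']. *)
apply: (attractor_structure P S A S_classical.1 A_attractor E
  (fun phi => V (ev phi) (dv phi)) (CV * C')).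
- by rewrite mulr_ge0.
- by move=> phi; exact: equilibriumP X_C1 S_classical dv hdv phi.
- move=> phi psi Aphi Apsi; rewrite -mulrA.
  by apply: Vlip; [exact: prof|exact: prof|move=> x; exact: hC'].
- by move=> gam; exact: gam_continuous S_classical gam.
- by move=> gam a b gorb gA ab; exact: Vmono _ _ _ _ _ _ (orb gam gorb gA) ab.
- move=> gam a b gorb gA ab nE.
  have [t [x [tab x01 d0]]] := gam_moves f bc0 bc1 ev P S X_C1 S_classical dv hdv gam gorb
    a b ab nE.
  exact: Vstrict _ _ _ _ _ _ t x (orb gam gorb gA) tab x01 d0.
- move=> e Ee; exact: (hyperbolic_isolated f bc0 bc1 ev P S f_C1 f_parabolic bc0_C1 bc1_C1
    X_C1 S_classical dv hdv F Fu Fp Fpu Fpp hF F_eq Fu_eq Fp_eq e Ee (E_hyperbolic e Ee)).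
Qed.
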